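(* Let $k$ be a field. For any representation $L$ over $k$ of the type-$B$ Artin group $B_n$, there is an isomorphism $$H_*(B_n;L)\cong H_{2n+2-*}\Big(C(n+1)_*\otimes \mathrm{Ind}^{A_{n+1}}_{B_n}(L^* )\Big)^*,$$ where $L^*$ is the dual representation, $(-)^*$ on the outside is the $k$-linear dual, and $C(n+1)_*\otimes \mathrm{Ind}^{A_{n+1}}_{B_n}(L^* )$ is the Fox-Neuwirth/Fuks complex with coefficients in the $A_{n+1}$-representation $\mathrm{Ind}^{A_{n+1}}_{B_n}(L^* )$.
   Context: $A_{n+1}$ is the braid group on $n+1$ strands with Artin generators $\sigma_1,\dots,\sigma_n$. $B_n$ is the $n$-th Artin group of type $B$ with generators $\sigma_1,\dots,\sigma_{n-1},\tau_n$; it is identified with the index $n+1$ subgroup of $A_{n+1}$ consisting of braids whose underlying permutation fixes $n+1$, via $\sigma_i\mapsto\sigma_i$ and $\tau_n\mapsto\sigma_n^2$. For a $B_n$-representation $M$ over $k$, $\mathrm{Ind}^{A_{n+1}}_{B_n}(M)=k[A_{n+1}]\otimes_{k[B_n]}M$ is the induced representation. A $(p,q)$-shuffle is a permutation $\gamma\in S_{p+q}$ that preserves order on the first $p$ and on the last $q$ elements; $(-1)^{|\gamma|}$ is its sign; its lift $\tilde\gamma\in A_{p+q}$ is the braid that shuffles the endpoints according to $\gamma$ by moving the right $q$ strands in front of the left $p$ strands, i.e. the positive permutation braid ($\tilde\gamma=\sigma_{i_1}\cdots\sigma_{i_r}$ for a reduced expression $\gamma=s_{i_1}\cdots s_{i_r}$,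 permutations composed right to left). For an $A_N$-representation $T$ the complex $C(N)_*\otimes T$ is defined as follows: $C(N)_q$ is the free abelian group on compositions (ordered partitions into positive parts) $\lambda=(\lambda_1,\dots,\lambda_{q-N})$ of $N$ with $q-N$ parts, and $$d[(\lambda_1,\dots,\lambda_{q-N})\otimes t]=\sum_{i=1}^{q-N-1}(-1)^{i-1}\Big[(\lambda_1,\dots,\lambda_{i-1},\lambda_i+\lambda_{i+1},\dots,\lambda_{q-N})\otimes\sum_\gamma(-1)^{|\gamma|}\tilde\gamma(t)\Big],$$ where $\gamma$ runs over all $(\lambda_i,\lambda_{i+1})$-shuffles and $\tilde\gamma$ is its lift to the copy $A_{\lambda_i+\lambda_{i+1}}\le A_N$ of braids nontrivial only on the $\lambda_i+\lambda_{i+1}$ consecutive strands starting with strand number $\lambda_1+\dots+\lambda_{i-1}+1$.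
   Formalization: L is assumed finite-dimensional and n ≥ 1: for L trivial of countably infinite dimension, H_0(B_n;L) = L while the right-hand side is the double dual L^**, of uncountable dimension, so the claim fails for arbitrary L. *)

(* Defs.v *)
From HB Require Import structures.
From mathcomp Require Import monalg.
From mathcomp Require Import all_boot all_order all_algebra all_fingroup.
From mathcomp Require Import generic_quotient finmap boolp.

Set Implicit Arguments.
Unset Strict Implicit.
Unset Printing Implicit Defensive.

Import GRing.Theory.
Local Open Scope ring_scope.
Local Open Scope quotient_scope.

(* The direct sum of copies of [V] indexed by [T], as finitely supported
   functions.  [{malg V[T]}] only has a module structure when [V] is the
   ground ring, hence the alias. *)
Definition dsum (k : nzRingType) (T : choiceType) (V : lmodType k) : Type :=
  {malg V[T]}.

Section DirectSum.
Variables (k : nzRingType) (T : choiceType) (V : lmodType k).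
Local Notation dsum := (dsum T V).

HB.instance Definition _ := GRing.Zmodule.copy dsum {malg V[T]}.

Definition dsum_scale (c : k) (x : dsum) : dsum :=
  [malg t in msupp x => c *: x@_t].

Lemma dsum_scaleE c x t : (dsum_scale c x)@_t = c *: x@_t.
Proof.
rewrite mcoeffE; case: ifPn => // /mcoeff_outdom ->.
by rewrite scaler0.
Qed.

Lemma dsum_scaleA a b x :
  dsum_scale a (dsum_scale b x) = dsum_scale (a * b) x.
Proof. by apply/malgP => t; rewrite !dsum_scaleE scalerA. Qed.

Lemma dsum_scale1 : left_id 1 dsum_scale.
Proof. by move=> x; apply/malgP => t; rewrite dsum_scaleE scale1r. Qed.

Lemma dsum_scaleDr : right_distributive dsum_scale +%R.
Proof.
move=> c x y; apply/malgP => t.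
by rewrite dsum_scaleE !mcoeffD !dsum_scaleE scalerDr.
Qed.

Lemma dsum_scaleDl x : {morph dsum_scale^~ x : a b / a + b}.
Proof.
move=> a b; apply/malgP => t.
by rewrite mcoeffD !dsum_scaleE scalerDl.
Qed.

HB.instance Definition _ := GRing.Zmodule_isLmodule.Build k dsum
  dsum_scaleA dsum_scale1 dsum_scaleDr dsum_scaleDl.

Definition dsum_in (t : T) (v : V) : dsum := << v *g t >>.

Lemma dsum_in_linear t : linear (dsum_in t).
Proof.
move=> c u v; apply/malgP => s.
rewrite mcoeffD [in RHS]/GRing.scale /= dsum_scaleE !mcoeffU.
by case: eqP => _; rewrite ?mulr1n ?mulr0n ?scaler0 ?addr0.
Qed.

HB.instance Definition _ t :=
  GRing.isLinear.Build k V dsum _ (dsum_in t) (dsum_in_linear t).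

Variables (W : lmodType k) (F : T -> {linear V -> W}).

Definition dsum_ext (x : dsum) : W := \sum_(t <- msupp x) F t x@_t.

Lemma dsum_extE (d : {fset T}) (x : dsum) :
  fsubset (msupp x) d -> dsum_ext x = \sum_(t <- d) F t x@_t.
Proof.
move=> le; rewrite /dsum_ext (big_fset_incl _ le) //= => t _ /mcoeff_outdom ->.
by rewrite linear0.
Qed.

Lemma dsum_ext_linear : linear dsum_ext.
Proof.
move=> c x y; pose d := (msupp (c *: x + y) `|` (msupp x `|` msupp y))%fset.
rewrite !(@dsum_extE d) ?fsubsetUl //; first last.
- by rewrite /d fsetUCA fsubsetUl.
- by rewrite /d fsetUA fsubsetUr.
rewrite scaler_sumr -big_split; apply: eq_bigr => t _ /=.
by rewrite mcoeffD [in LHS]/GRing.scale /= dsum_scaleE linearP.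
Qed.

HB.instance Definition _ :=
  GRing.isLinear.Build k dsum W _ dsum_ext dsum_ext_linear.

Lemma dsum_ext_in t v : dsum_ext (dsum_in t v) = F t v.
Proof.
rewrite (@dsum_extE [fset t]%fset) ?msuppU_le //.
by rewrite big_seq_fset1 mcoeffUU.
Qed.

End DirectSum.

Section DirectSumExt.
Variables (k : nzRingType) (T : choiceType) (V W : lmodType k).

Lemma dsum_ind (P : dsum T V -> Prop) :
    P 0 -> (forall t v x, P x -> P (dsum_in t v + x)) ->
  forall x, P x.
Proof.
move=> P0 Pin x; rewrite [x]monalgE.
elim: (X in \sum_(t <- X) _) => [|t r IH]; first by rewrite big_nil.
by rewrite big_cons; apply: Pin.
Qed.

Lemma dsum_eq_linear (f g : {linear dsum T V -> W}) :
  (forall t v, f (dsum_in t v) = g (dsum_in t v)) -> f =1 g.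
Proof.
move=> fg; elim/dsum_ind => [|t v x IH]; first by rewrite !linear0.
by rewrite !linearD fg IH.
Qed.

End DirectSumExt.

Section Quotient.
Variables (k : nzRingType) (V : lmodType k) (S : submodClosed V).

Definition quot_equiv (u v : V) := u - v \in S.

Lemma quot_equiv_class : equiv_class_of quot_equiv.
Proof.
have SN x : x \in S -> - x \in S by move=> xS; rewrite -scaleN1r rpredZ.
split=> [u|u v|v u w]; rewrite /quot_equiv ?subrr ?rpred0 //.
  by apply/idP/idP => /SN; rewrite opprB.
by move=> uv vw; rewrite -[u](subrK v) -addrA rpredD.
Qed.

Canonical quot_equivRel := EquivRelPack quot_equiv_class.

Definition quotmod : Type := {eq_quot quot_equiv}.
HB.instance Definition _ := Choice.on quotmod.

Definition quot_pi (v : V) : quotmod := \pi_({eq_quot quot_equiv}) v.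
Definition quot_repr (x : quotmod) : V := repr (x : {eq_quot quot_equiv}).

Lemma quot_reprK x : quot_pi (quot_repr x) = x.
Proof. exact: reprK. Qed.

Lemma quot_piP u v : quot_pi u = quot_pi v <-> u - v \in S.
Proof. by rewrite -[u - v \in S]/(quot_equiv u v); split=> /eqmodP. Qed.

Lemma quot_repr_pi v : quot_repr (quot_pi v) - v \in S.
Proof. by apply/quot_piP; rewrite quot_reprK. Qed.

Definition quot_add x y := quot_pi (quot_repr x + quot_repr y).
Definition quot_opp x := quot_pi (- quot_repr x).
Definition quot_scale c x := quot_pi (c *: quot_repr x).

Lemma quot_add_pi u v : quot_add (quot_pi u) (quot_pi v) = quot_pi (u + v).
Proof. by apply/quot_piP; rewrite opprD addrACA rpredD ?quot_repr_pi. Qed.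

Lemma quot_scale_pi c v : quot_scale c (quot_pi v) = quot_pi (c *: v).
Proof. by apply/quot_piP; rewrite -scalerBr rpredZ ?quot_repr_pi. Qed.

Lemma quot_opp_pi v : quot_opp (quot_pi v) = quot_pi (- v).
Proof. by rewrite -scaleN1r -quot_scale_pi /quot_scale scaleN1r. Qed.

Lemma quot_addA : associative quot_add.
Proof.
by move=> x y z; rewrite -[x]quot_reprK -[y]quot_reprK -[z]quot_reprK
  !quot_add_pi addrA.
Qed.

Lemma quot_addC : commutative quot_add.
Proof.
by move=> x y; rewrite -[x]quot_reprK -[y]quot_reprK !quot_add_pi addrC.
Qed.

Lemma quot_add0 : left_id (quot_pi 0) quot_add.
Proof. by move=> x; rewrite -[x]quot_reprK quot_add_pi add0r. Qed.

Lemma quot_addN : left_inverse (quot_pi 0) quot_opp quot_add.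
Proof.
by move=> x; rewrite -[x]quot_reprK quot_opp_pi quot_add_pi addNr.
Qed.

HB.instance Definition _ := GRing.isZmodule.Build quotmod
  quot_addA quot_addC quot_add0 quot_addN.

Lemma quot_piD : {morph quot_pi : u v / u + v}.
Proof. by move=> u v; rewrite -quot_add_pi. Qed.

Lemma quot_scaleA a b x :
  quot_scale a (quot_scale b x) = quot_scale (a * b) x.
Proof. by rewrite -[x]quot_reprK !quot_scale_pi scalerA. Qed.

Lemma quot_scale1 : left_id 1 quot_scale.
Proof. by move=> x; rewrite -[x]quot_reprK quot_scale_pi scale1r. Qed.

Lemma quot_scaleDr : right_distributive quot_scale +%R.
Proof.
move=> c x y; rewrite -[x]quot_reprK -[y]quot_reprK -quot_piD !quot_scale_pi.
by rewrite scalerDr quot_piD.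
Qed.

Lemma quot_scaleDl x : {morph quot_scale^~ x : a b / a + b}.
Proof.
by move=> a b; rewrite -[x]quot_reprK !quot_scale_pi scalerDl quot_piD.
Qed.

HB.instance Definition _ := GRing.Zmodule_isLmodule.Build k quotmod
  quot_scaleA quot_scale1 quot_scaleDr quot_scaleDl.

Lemma quot_pi_linear : linear quot_pi.
Proof.
by move=> c u v; rewrite quot_piD; congr (_ + _); rewrite -quot_scale_pi.
Qed.

HB.instance Definition _ :=
  GRing.isLinear.Build k V quotmod _ quot_pi quot_pi_linear.

Lemma quot_pi_eq0 v : quot_pi v = 0 <-> v \in S.
Proof. by rewrite -[v in v \in S]subr0 -quot_piP. Qed.

Variables (W : lmodType k) (f : {linear V -> W}).
Hypothesis fS : forall v, v \in S -> f v = 0.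

Definition quot_lift of (forall v, v \in S -> f v = 0) :=
  fun x : quotmod => f (quot_repr x).

Lemma quot_liftE v : quot_lift fS (quot_pi v) = f v.
Proof.
apply/eqP; rewrite -subr_eq0 -linearB; apply/eqP/fS/quot_piP.
exact: quot_reprK.
Qed.

Lemma quot_lift_linear : linear (quot_lift fS).
Proof.
move=> c x y; rewrite -[x]quot_reprK -[y]quot_reprK -linearP.
by rewrite !quot_liftE linearP.
Qed.

HB.instance Definition _ :=
  GRing.isLinear.Build k quotmod W _ (quot_lift fS) quot_lift_linear.

End Quotient.

Section Span.
Variables (k : nzRingType) (V : lmodType k) (X : V -> Prop).

Inductive in_span : V -> Prop :=
| in_span0 : in_span 0
| in_spanP c x v : X x -> in_span v -> in_span (c *: x + v).

Definition span_of : {pred V} := fun v => `[< in_span v >].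

Lemma span_ofP v : reflect (in_span v) (v \in span_of).
Proof. exact: asboolP. Qed.

Lemma span_of_closed : submod_closed span_of.
Proof.
split=> [|c u v]; first exact/span_ofP/in_span0.
move=> /span_ofP uS /span_ofP vS; apply/span_ofP.
elim: uS => [|a x w Xx _ IH]; first by rewrite scaler0 add0r.
by rewrite scalerDr scalerA -addrA; apply: in_spanP.
Qed.

HB.instance Definition _ := GRing.isSubmodClosed.Build k V span_of span_of_closed.

Lemma in_span_gen x : X x -> x \in span_of.
Proof.
by move=> Xx; apply/span_ofP; rewrite -[x]addr0 -[x]scale1r; apply/in_spanP/in_span0.
Qed.

End Span.

Section Homology.
Variables (k : nzRingType) (U V W : lmodType k).
Variables (f : {linear U -> V}) (g : {linear V -> W}).

Definition kernel : {pred V} := fun v => g v == 0.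

Lemma kernel_closed : submod_closed kernel.
Proof.
split=> [|c u v]; first by rewrite unfold_in linear0.
by rewrite !unfold_in linearP => /eqP -> /eqP ->; rewrite scaler0 addr0.
Qed.

HB.instance Definition _ := GRing.isSubmodClosed.Build k V kernel kernel_closed.

Record cycles := Cycle { cycle_val : V; _ : cycle_val \in kernel }.
HB.instance Definition _ := [isSub for cycle_val].
HB.instance Definition _ := [Choice of cycles by <:].
HB.instance Definition _ := [SubChoice_isSubLmodule of cycles by <:].

Definition boundaries : {pred cycles} :=
  fun z => `[< exists u, f u = val z >].

Lemma boundaries_closed : submod_closed boundaries.
Proof.
split=> [|c x y]; first by apply/asboolP; exists 0; rewrite !linear0.
move=> /asboolP [u fu] /asboolP [v fv]; apply/asboolP; exists (c *: u + v).
by rewrite linearP fu fv linearP.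
Qed.

HB.instance Definition _ :=
  GRing.isSubmodClosed.Build k cycles boundaries boundaries_closed.

(* [ker g / im f] when [g \o f = 0]. *)
Definition homology : lmodType k := quotmod boundaries.

End Homology.

Definition dual (k : comNzRingType) (V : lmodType k) : Type :=
  {linear V -> k^o}.

Section Dual.
Variables (k : comNzRingType) (V : lmodType k).
Local Notation dual := (dual V).

HB.instance Definition _ := gen_eqMixin dual.
HB.instance Definition _ := gen_choiceMixin dual.

Lemma dual_eq (f g : dual) : f =1 g -> f = g.
Proof.
case: f g => [f [[fA] [fB]]] [g [[gA] [gB]]] /= /funext fg.
by move: fA fB gA gB; rewrite fg => *; congr (GRing.Linear.Pack (GRing.Linear.Class _ _));
  [congr GRing.isNmodMorphism.Axioms_ | congr GRing.isScalable.Axioms_]; apply: Prop_irrelevance.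
Qed.

Definition dual_zero : dual := \0.
Definition dual_opp (f : dual) : dual := \- f.
Definition dual_add (f g : dual) : dual := f \+ g.
Definition dual_scale (c : k) (f : dual) : dual := c \*: f.

Lemma dual_addA : associative dual_add.
Proof. by move=> f g h; apply: dual_eq => v /=; rewrite addrA. Qed.

Lemma dual_addC : commutative dual_add.
Proof. by move=> f g; apply: dual_eq => v /=; rewrite addrC. Qed.

Lemma dual_add0 : left_id dual_zero dual_add.
Proof. by move=> f; apply: dual_eq => v /=; rewrite add0r. Qed.

Lemma dual_addN : left_inverse dual_zero dual_opp dual_add.
Proof. by move=> f; apply: dual_eq => v /=; rewrite addNr. Qed.

HB.instance Definition _ := GRing.isZmodule.Build dual
  dual_addA dual_addC dual_add0 dual_addN.

Lemma dual_scaleA a b f :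
  dual_scale a (dual_scale b f) = dual_scale (a * b) f.
Proof. by apply: dual_eq => v /=; rewrite scalerA. Qed.

Lemma dual_scale1 : left_id 1 dual_scale.
Proof. by move=> f; apply: dual_eq => v /=; rewrite scale1r. Qed.

Lemma dual_scaleDr : right_distributive dual_scale +%R.
Proof. by move=> c f g; apply: dual_eq => v /=; rewrite scalerDr. Qed.

Lemma dual_scaleDl f : {morph dual_scale^~ f : a b / a + b}.
Proof. by move=> a b; apply: dual_eq => v /=; rewrite scalerDl. Qed.

HB.instance Definition _ := GRing.Zmodule_isLmodule.Build k dual
  dual_scaleA dual_scale1 dual_scaleDr dual_scaleDl.

End Dual.

Section Presentation.
Variable I : choiceType.

(* Words in the generators; [(i, true)] stands for the inverse of [i]. *)
Definition word := seq (I * bool).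

Variable R : word -> word -> Prop.

Inductive word_eq : word -> word -> Prop :=
| word_eq_refl u : word_eq u u
| word_eq_sym u v : word_eq u v -> word_eq v u
| word_eq_trans v u w : word_eq u v -> word_eq v w -> word_eq u w
| word_eq_cat u u' v v' :
    word_eq u u' -> word_eq v v' -> word_eq (u ++ v) (u' ++ v')
| word_eq_cancel i b : word_eq [:: (i, b); (i, ~~ b)] [::]
| word_eq_rel u v : R u v -> word_eq u v.

Definition word_eqb (u v : word) := `[< word_eq u v >].

Lemma word_eqb_class : equiv_class_of word_eqb.
Proof.
split=> [u|u v|v u w]; first exact/asboolP/word_eq_refl.
  by apply/asboolP/asboolP => /word_eq_sym.
by move=> /asboolP uv /asboolP vw; apply/asboolP/(word_eq_trans uv vw).
Qed.

Canonical word_equivRel := EquivRelPack word_eqb_class.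

Definition presented_group : Type := {eq_quot word_eqb}.
HB.instance Definition _ := Choice.on presented_group.

Definition word_class (u : word) : presented_group := \pi_({eq_quot word_eqb}) u.
Definition word_repr (x : presented_group) : word :=
  repr (x : {eq_quot word_eqb}).

Lemma word_reprK x : word_class (word_repr x) = x.
Proof. exact: reprK. Qed.

Lemma word_classP u v : word_class u = word_class v <-> word_eq u v.
Proof. by split=> [/eqmodP/asboolP|uv]; last exact/eqmodP/asboolP. Qed.

Lemma word_repr_class u : word_eq (word_repr (word_class u)) u.
Proof. by apply/word_classP; rewrite word_reprK. Qed.

Definition word_inv (u : word) : word := rev [seq (x.1, ~~ x.2) | x <- u].

Lemma word_mulV u : word_eq (u ++ word_inv u) [::].
Proof.
elim: u => [|[i b] u IH]; first exact: word_eq_refl.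
have -> : ((i, b) :: u) ++ word_inv ((i, b) :: u) =
          [:: (i, b)] ++ (u ++ word_inv u) ++ [:: (i, ~~ b)].
  by rewrite /word_inv /= rev_cons -cats1 catA.
apply: word_eq_trans (word_eq_cancel i b).
apply: (word_eq_cat (u' := [:: (i, b)]) (v' := [:: (i, ~~ b)])).
  exact: word_eq_refl.
apply: (word_eq_cat (u' := [::]) (v' := [:: (i, ~~ b)])) => //.
exact: word_eq_refl.
Qed.

Lemma word_invK u : word_inv (word_inv u) = u.
Proof.
rewrite /word_inv map_rev revK -map_comp -[RHS]map_id.
by apply: eq_map => -[i b] /=; rewrite negbK.
Qed.

Lemma word_mulVg u : word_eq (word_inv u ++ u) [::].
Proof. by have := word_mulV (word_inv u); rewrite word_invK. Qed.

Definition pg_one := word_class [::].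
Definition pg_mul x y := word_class (word_repr x ++ word_repr y).
Definition pg_inv x := word_class (word_inv (word_repr x)).

Lemma pg_mul_class u v : pg_mul (word_class u) (word_class v) = word_class (u ++ v).
Proof. by apply/word_classP/word_eq_cat; apply: word_repr_class. Qed.

Lemma pg_mulA : associative pg_mul.
Proof.
by move=> x y z; rewrite -[x]word_reprK -[y]word_reprK -[z]word_reprK
  !pg_mul_class catA.
Qed.

Lemma pg_mul1 : left_id pg_one pg_mul.
Proof. by move=> x; rewrite -[x]word_reprK pg_mul_class. Qed.

Lemma pg_mulr1 : right_id pg_one pg_mul.
Proof. by move=> x; rewrite -[x]word_reprK pg_mul_class cats0. Qed.

Lemma pg_mulV : left_inverse pg_one pg_inv pg_mul.
Proof.
move=> x; rewrite -{2}[x]word_reprK pg_mul_class.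
exact/word_classP/word_mulVg.
Qed.

Lemma pg_mulrV : right_inverse pg_one pg_inv pg_mul.
Proof.
move=> x; rewrite -{1}[x]word_reprK pg_mul_class.
exact/word_classP/word_mulV.
Qed.

HB.instance Definition _ := isGroup.Build presented_group
  pg_mulA pg_mul1 pg_mulr1 pg_mulV pg_mulrV.

Definition pg_gen (i : I) : presented_group := word_class [:: (i, false)].

Section Lift.
Variables (H : groupType) (f : I -> H).

Definition word_eval (u : word) : H :=
  foldr (fun x h => (if x.2 then (f x.1)^-1 else f x.1) * h)%g 1%g u.

Lemma word_eval_cat u v : word_eval (u ++ v) = (word_eval u * word_eval v)%g.
Proof. by elim: u => [|x u IH] /=; rewrite ?mul1g // IH mulgA. Qed.

Hypothesis fR : forall u v, R u v -> word_eval u = word_eval v.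

Lemma word_eval_eq u v : word_eq u v -> word_eval u = word_eval v.
Proof.
elim=> // {u v} [v u w _ -> _ ->|u u' v v' _ IHu _ IHv|i b] //.
  by rewrite !word_eval_cat IHu IHv.
by case: b; rewrite /= mulg1 ?mulVg ?mulgV.
Qed.

Definition pg_lift of (forall u v, R u v -> word_eval u = word_eval v) :=
  fun x : presented_group => word_eval (word_repr x).

Lemma pg_lift_class u : pg_lift fR (word_class u) = word_eval u.
Proof. exact/word_eval_eq/word_repr_class. Qed.

Lemma pg_liftM : {morph pg_lift fR : x y / (x * y)%g}.
Proof.
move=> x y; rewrite -[x]word_reprK -[y]word_reprK.
rewrite -[(_ * _)%g]/(pg_mul _ _) pg_mul_class.
by rewrite !pg_lift_class word_eval_cat.
Qed.

Lemma pg_lift_gen i : pg_lift fR (pg_gen i) = f i.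
Proof. by rewrite pg_lift_class /= mulg1. Qed.

End Lift.
End Presentation.

Section Artin.
Variable (I : choiceType) (m : I -> I -> nat).

(* The alternating positive word [i j i ...] of length [l]. *)
Fixpoint alt_word (i j : I) (l : nat) : word I :=
  if l is l'.+1 then (i, false) :: alt_word j i l' else [::].

Definition artin_rel (u v : word I) : Prop :=
  exists i j, u = alt_word i j (m i j) /\ v = alt_word j i (m i j).

Lemma artin_gen_rel i j :
  word_eval (pg_gen artin_rel) (alt_word i j (m i j)) =
  word_eval (pg_gen artin_rel) (alt_word j i (m i j)).
Proof.
have E a b l : word_eval (pg_gen artin_rel) (alt_word a b l) =
    word_class artin_rel (alt_word a b l).
  elim: l a b => //= l IH a b; rewrite IH.
  by rewrite -[(_ * _)%g]/(pg_mul _ _) pg_mul_class.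
by rewrite !E; apply/word_classP/word_eq_rel; exists i, j.
Qed.

Definition artin_group := presented_group artin_rel.
HB.instance Definition _ := Group.on artin_group.

End Artin.

(* Generators are numbered from 0, so that [i : 'I_N.-1] stands for
   sigma_(i+1). *)
Definition coxeterA (N : nat) (i j : 'I_N.-1) : nat :=
  (if i == j then 1 else if (i.+1 == j) || (j.+1 == i) then 3 else 2)%N.

(* Here the last generator stands for tau_n, and [i < n.-1] for sigma_(i+1). *)
Definition coxeterB (n : nat) (i j : 'I_n) : nat :=
  (if i == j then 1
   else if (i.+1 == j) || (j.+1 == i) then
     if (i == n.-1 :> nat) || (j == n.-1 :> nat) then 4 else 3
   else 2)%N.

Definition braid_group (N : nat) := artin_group (@coxeterA N).
HB.instance Definition _ N := Group.on (braid_group N).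

Definition artinB (n : nat) := artin_group (@coxeterB n).
HB.instance Definition _ n := Group.on (artinB n).

(* The junk value 1 is used for indices out of range. *)
Definition sigma (N i : nat) : braid_group N :=
  if insub i is Some j then pg_gen _ (j : 'I_N.-1) else 1%g.

Section Embedding.
Variable n : nat.

Definition artinB_gen (i : 'I_n) : braid_group n.+1 :=
  (if i == n.-1 :> nat then sigma n.+1 i * sigma n.+1 i else sigma n.+1 i)%g.

Lemma sigmaE (i : 'I_n) : sigma n.+1 i = pg_gen _ i.
Proof. by rewrite /sigma insubT // => p; congr pg_gen; apply: val_inj. Qed.

Lemma braid4 (G : groupType) (s t : G) : (s * (t * s) = t * (s * t))%g ->
  (s * s * (t * (s * s * t)) = t * (s * s * (t * (s * s))))%g.
Proof.
rewrite !mulgA => E.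
transitivity (s * (s * t * s) * s * t)%g; first by rewrite !mulgA.
transitivity (t * s * (s * t * s) * s)%g; last by rewrite !mulgA.
by rewrite E !mulgA E -!mulgA; do 3![congr (_ * _)%g]; rewrite !mulgA.
Qed.

Lemma artinB_gen_rel u v : artin_rel (@coxeterB n) u v ->
  word_eval artinB_gen u = word_eval artinB_gen v.
Proof.
case=> i [j [-> ->]]; have := @artin_gen_rel _ (@coxeterA n.+1) i j.
have [] := (sigmaE i, sigmaE j).
move: (pg_gen (artin_rel _)) => g; set s := g i; set t := g j => si sj.
rewrite /coxeterA /coxeterB; case: eqVneq => [->//|neq_ij].
case: ifP => _ /=; rewrite !mulg1 -/s -/t => st.
  case: (boolP (i == n.-1 :> nat)) (boolP (j == n.-1 :> nat)) => [ei|ei];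
    case=> [ej|ej] /=;
    rewrite /artinB_gen /= si sj ?ei ?ej ?(negPf ei) ?(negPf ej) !mulg1.
  - by case/eqP: neq_ij; apply: val_inj; rewrite /= (eqP ei) (eqP ej).
  - exact: braid4.
  - by symmetry; apply: braid4.
  - exact: st.
have st' : commute s t by [].
rewrite /artinB_gen si sj.
by case: ifP => _; case: ifP => _; 
  do ?[exact: st'|apply: commuteM|apply/commute_sym; apply: commuteM].
Qed.

Definition artinB_embed : artinB n -> braid_group n.+1 :=
  pg_lift artinB_gen_rel.

Lemma artinB_embedM : {morph artinB_embed : x y / (x * y)%g}.
Proof. exact: pg_liftM. Qed.

HB.instance Definition _ :=
  isMultiplicative.Build (artinB n) (braid_group n.+1) artinB_embed
    artinB_embedM.

End Embedding.

Record representation (k : nzRingType) (G : groupType) (V : lmodType k) := Repr {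
  repr_act :> G -> {linear V -> V};
  repr_act1 : forall v, repr_act 1%g v = v;
  repr_actM : forall g h v, repr_act (g * h)%g v = repr_act g (repr_act h v)
}.

Section DualRepresentation.
Variables (k : comNzRingType) (G : groupType) (V : lmodType k).
Variable rho : representation G V.

Definition dual_act_fun (g : G) (f : dual V) : dual V := f \o rho g^-1%g.

Lemma dual_act_linear g : linear (dual_act_fun g).
Proof. by move=> c f h; apply: dual_eq. Qed.

HB.instance Definition _ g := GRing.isLinear.Build k (dual V) (dual V) _
  (dual_act_fun g) (dual_act_linear g).

Definition dual_act g : {linear dual V -> dual V} := dual_act_fun g.

Lemma dual_act1 f : dual_act 1%g f = f.
Proof. by apply: dual_eq => v /=; rewrite invg1 repr_act1. Qed.

Lemma dual_actM g h f : dual_act (g * h)%g f = dual_act g (dual_act h f).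
Proof. by apply: dual_eq => v /=; rewrite invgM repr_actM. Qed.

Definition dual_repr : representation G (dual V) := Repr dual_act1 dual_actM.

End DualRepresentation.

Section Induction.
Variables (k : nzRingType) (H G : groupType) (phi : {multiplicative H -> G}).
Variables (M : lmodType k) (rho : representation H M).

(* [k[G] (x)_k[H] M] as the quotient of [k[G] (x)_k M], which is the direct sum
   of copies of [M] indexed by [G], by the elements
   [g phi(h) (x) m - g (x) h m]. *)
Definition balanced (x : dsum G M) : Prop :=
  exists g h m, x = dsum_in (g * phi h)%g m - dsum_in g (rho h m).

Definition ind : lmodType k := quotmod (span_of balanced).

Definition translate (g : G) : {linear dsum G M -> dsum G M} :=
  dsum_ext (fun x => dsum_in (g * x)%g : {linear M -> dsum G M}).

Lemma translate_in g x m : translate g (dsum_in x m) = dsum_in (g * x)%g m.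
Proof. exact: dsum_ext_in. Qed.

Lemma translate_balanced g x :
  x \in span_of balanced -> quot_pi (span_of balanced) (translate g x) = 0.
Proof.
move=> xS; apply/quot_pi_eq0; move: xS => /span_ofP.
elim=> [|c {}x v [a [h [m ->]]] _ IH]; first by rewrite linear0 rpred0.
rewrite linearP; apply: rpredD => //; apply: rpredZ; rewrite linearB.
apply: in_span_gen; exists (g * a)%g, h, m.
by rewrite /= !translate_in mulgA.
Qed.

Definition ind_act (g : G) : {linear ind -> ind} :=
  quot_lift (f := quot_pi (span_of balanced) \o translate g)
    (@translate_balanced g).

Lemma ind_act_pi g x : ind_act g (quot_pi (span_of balanced) x) =
  quot_pi (span_of balanced) (translate g x).
Proof. exact: quot_liftE. Qed.

Lemma ind_act1 x : ind_act 1%g x = x.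
Proof.
rewrite -[x]quot_reprK ind_act_pi; congr quot_pi.
move: (quot_repr x) => y; apply: (dsum_eq_linear (g := idfun)) => t v.
by rewrite translate_in mul1g.
Qed.

Lemma ind_actM g h x : ind_act (g * h)%g x = ind_act g (ind_act h x).
Proof.
rewrite -[x]quot_reprK !ind_act_pi; congr quot_pi.
move: (quot_repr x) => y.
apply: (dsum_eq_linear (g := translate g \o translate h)) => t v.
by rewrite /= !translate_in mulgA.
Qed.

Definition ind_repr : representation G ind := Repr ind_act1 ind_actM.

End Induction.

Section GroupHomology.
Variables (k : nzRingType) (G : groupType) (V : lmodType k).
Variable rho : representation G V.

Definition bar_chain (q : nat) : lmodType k := dsum (q.-tuple G) V.

(* The [j]-th face of [g_1 | ... | g_(q+1)]: it drops [g_1] if [j = 0], drops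
   [g_(q+1)] if [j = q + 1], and multiplies [g_j] and [g_(j+1)] otherwise. *)
Definition bar_face q (j : nat) (g : q.+1.-tuple G) : q.-tuple G :=
  [tuple if (i.+1 < j)%N then tnth g (widen_ord (leqnSn q) i)
         else if (i.+1 == j)%N
              then (tnth g (widen_ord (leqnSn q) i) * tnth g (lift ord0 i))%g
              else tnth g (lift ord0 i) | i < q].

(* The group element dropped by the last face acts on the coefficients. *)
Definition bar_dterm_fun q (g : q.+1.-tuple G) (v : V) : bar_chain q :=
  \sum_(j < q.+2) (-1) ^+ j *:
     dsum_in (bar_face j g) (if j == ord_max then rho (tnth g ord_max) v else v).

Lemma bar_dterm_linear q g : linear (@bar_dterm_fun q g).
Proof.
move=> c u v; rewrite /bar_dterm_fun scaler_sumr -big_split /=.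
apply: eq_bigr => j _; case: ifP => _; rewrite !linearP scalerDr !scalerA;
by rewrite commr_sign.
Qed.

HB.instance Definition _ q g := GRing.isLinear.Build k V (bar_chain q) _
  (@bar_dterm_fun q g) (@bar_dterm_linear q g).

Definition bar_d q : {linear bar_chain q.+1 -> bar_chain q} :=
  dsum_ext (fun g => @bar_dterm_fun q g : {linear V -> bar_chain q}).

Definition bar_out q : {linear bar_chain q -> bar_chain q.-1} :=
  if q is q'.+1 then bar_d q' else \0.

Definition group_homology (q : nat) : lmodType k :=
  homology (bar_d q) (bar_out q).

End GroupHomology.

Section Shuffles.
Variable m : nat.

Lemma adj_lo_proof (j : 'I_m.-1) : (j < m)%N.
Proof. by apply: leq_trans (ltn_ord j) _; apply: leq_pred. Qed.

Lemma adj_hi_proof (j : 'I_m.-1) : (j.+1 < m)%N.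
Proof. by rewrite -ltn_predRL. Qed.

Definition adj_tperm (j : 'I_m.-1) : 'S_m :=
  tperm (Ordinal (adj_lo_proof j)) (Ordinal (adj_hi_proof j)).

(* [(s * t)%g] is [s] followed by [t], so this is the product of [w] read as a
   composition of functions, from right to left. *)
Definition word_perm (w : seq 'I_m.-1) : 'S_m :=
  foldr (fun j s => s * adj_tperm j)%g 1%g w.

Definition is_reduced (s : 'S_m) (w : seq 'I_m.-1) : Prop :=
  word_perm w = s /\ forall w', word_perm w' = s -> (size w <= size w')%N.

Lemma word_perm_cat u v : word_perm (u ++ v) = (word_perm v * word_perm u)%g.
Proof. by elim: u => [|j u IH] /=; rewrite ?mulg1 // IH mulgA. Qed.

Lemma word_perm_tperm (a b : 'I_m) : (a < b)%N ->
  exists w, word_perm w = tperm a b.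
Proof.
move: {2}(b - a)%N (erefl (b - a)%N) => d.
elim: d a b => [|d IH] a b; first by move=> /eqP; rewrite subn_eq0 leqNgt => /negPf ->.
move=> ba ab; have am : (a < m.-1)%N by rewrite ltn_predRL (leq_ltn_trans ab).
have lo : Ordinal (adj_lo_proof (Ordinal am)) = a by apply: val_inj.
set c := Ordinal (adj_hi_proof (Ordinal am)).
have E : adj_tperm (Ordinal am) = tperm a c by rewrite /adj_tperm lo.
have [bc|bc] := eqVneq b c.
  by exists [:: Ordinal am]; rewrite /= mul1g E bc.
have cb : (c < b)%N.
  rewrite ltn_neqAle ab andbT; apply: contraNneq bc => cb.
  exact/eqP/val_inj.
have [|w wE] := IH c b _ cb; first by rewrite subnS ba.
exists ([:: Ordinal am] ++ w ++ [:: Ordinal am]).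
rewrite !word_perm_cat /= !mul1g wE E.
rewrite (_ : _ * _ = tperm c b ^ tperm a c)%g; last first.
  by rewrite /conjg tpermV mulgA.
rewrite tpermJ tpermR tpermD // neq_ltn; first by rewrite ab.
by rewrite cb.
Qed.

Lemma reduced_exists (s : 'S_m) : exists w, is_reduced s w.
Proof.
have [w ws] : exists w, word_perm w = s.
  have [ts -> /allP nd] := prod_tpermP s.
  elim: ts nd => [|[a b] ts IH] nd; first by exists [::]; rewrite big_nil.
  have [|w wE] := IH; first by move=> t tts; apply: nd; rewrite inE tts orbT.
  have [v vE] : exists v, word_perm v = tperm a b.
    have := nd (a, b); rewrite inE eqxx => /(_ isT); rewrite /dpair /= neq_ltn.
    by case/orP=> /word_perm_tperm // [v vE]; exists v; rewrite tpermC.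
  by exists (w ++ v); rewrite word_perm_cat big_cons wE vE.
pose P l := `[< exists w, word_perm w = s /\ size w = l >].
have exP : exists l, P l by exists (size w); apply/asboolP; exists w.
case: (ex_minnP exP) => l /asboolP [u [us ul]] lmin.
by exists u; split=> // w' w's; rewrite ul; apply: lmin; apply/asboolP; exists w'.
Qed.

Definition reduced_word (s : 'S_m) : seq 'I_m.-1 := sval (cid (reduced_exists s)).

End Shuffles.

(* The positive permutation braid of [s] on the strands numbered
   [off + 1, ..., off + m]; it does not depend on the choice of the reduced
   expression. *)
Definition perm_braid (N off m : nat) (s : 'S_m) : braid_group N :=
  foldr (fun (j : 'I_m.-1) b => sigma N (off + j) * b)%g 1%g (reduced_word s).

Definition is_shuffle (p q : nat) (s : 'S_(p + q)) : bool :=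
  [forall a : 'I_(p + q), forall b : 'I_(p + q),
     (a < b)%N && ((b < p)%N || (p <= a)%N) ==> (s a < s b)%N].

Definition parts N (l : {bseq N of 'I_N.+1}) : seq nat := map val l.

(* A composition of [N] has at most [N] parts, each of them at most [N]. *)
Definition is_composition N (q : int) (l : {bseq N of 'I_N.+1}) : bool :=
  [&& all (leq 1) (parts l), sumn (parts l) == N
    & (size l)%:Z == q - N%:Z].

Definition composition N (q : int) : Type :=
  {l : {bseq N of 'I_N.+1} | is_composition q l}.
HB.instance Definition _ N q := Finite.on (composition N q).

(* Positions in compositions are numbered from 0. *)
Definition merge_parts (i : nat) (l : seq nat) : seq nat :=
  take i l ++ (nth 0%N l i + nth 0%N l i.+1)%N :: drop i.+2 l.

Section FoxNeuwirth.
Variables (k : nzRingType) (N : nat) (T : lmodType k).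
Variable rho : representation (braid_group N) T.

(* [C(N)_q (x) T]. *)
Definition fn_chain (q : int) : lmodType k := {ffun composition N q -> T}.

Definition shuffle_sum (l : seq nat) (i : nat) (t : T) : T :=
  \sum_(s : 'S_(nth 0%N l i + nth 0%N l i.+1) | is_shuffle s)
     (-1) ^+ s *: rho (perm_braid N (sumn (take i l)) s) t.

(* The differential, for [q' = q - 1]; the target degree is left free to avoid
   casts between [q] and [q + 1 - 1]. *)
Definition fn_d_fun (q q' : int) (x : fn_chain q) : fn_chain q' :=
  [ffun m : composition N q' =>
     \sum_(l : composition N q)
       \sum_(i < (size (val l)).-1 | merge_parts i (parts (val l)) == parts (val m))
         (-1) ^+ i *: shuffle_sum (parts (val l)) i (x l)].

Lemma shuffle_sum_linear l i : linear (shuffle_sum l i).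
Proof.
move=> c u v; rewrite /shuffle_sum scaler_sumr -big_split.
by apply: eq_bigr => s _ /=; rewrite linearP scalerDr !scalerA commr_sign.
Qed.

Lemma fn_d_linear q q' : linear (@fn_d_fun q q').
Proof.
move=> c x y; apply/ffunP => m; rewrite !ffunE scaler_sumr -big_split /=.
apply: eq_bigr => l _; rewrite scaler_sumr -big_split.
apply: eq_bigr => i _ /=.
by rewrite !ffunE shuffle_sum_linear scalerDr !scalerA commr_sign.
Qed.

HB.instance Definition _ q q' :=
  GRing.isLinear.Build k (fn_chain q) (fn_chain q') _ (@fn_d_fun q q')
    (@fn_d_linear q q').

Definition fn_d (q q' : int) : {linear fn_chain q -> fn_chain q'} :=
  @fn_d_fun q q'.

Definition fn_homology (q : int) : lmodType k :=
  homology (fn_d (q + 1) q) (fn_d q (q - 1)).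

End FoxNeuwirth.

(* Main.v *)
From HB Require Import structures.
From Stdlib Require Import Setoid Morphisms.
Require Import Defs.
From mathcomp Require Import monalg.
From mathcomp Require Import all_boot all_order all_algebra all_fingroup.
From mathcomp Require Import generic_quotient finmap boolp.
From mathcomp Require Import zify ring.

(** Put N = n + 1, G = A_N and H = B_n.  The chains computing the homology of
    H with coefficients in L come from any free resolution of the trivial
    H-module; the theorem compares two of them, the bar resolution and a
    finite one whose L-coefficient complex is the k-linear dual of the
    Fox-Neuwirth complex with coefficients in the induced representation.

    The finite resolution is the Salvetti complex of the braid group.  Its
    cells are the pairs (m, g) of a composition m of N and a position g in G,
    and its differential [sal_d] sends (m, g) to the signed sum of the
    (l, g c), where merging two consecutive parts of l gives m and c runs over
    the positive braids of the shuffles of these two parts.  The square of the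
    differential vanishes because right multiplication by the signed sum of
    all permutation braids of a parabolic subgroup turns the shuffle sums into
    plain incidence coefficients ([coef_sym]), and this multiplication is
    injective, its leading term for the length of braids being 1
    ([unipotent_regular]).

    The complex is exact ([sal_exact], [sal_exact0]).  Translating by a power
    of the central full twist makes finitely many positions positive.  Among
    the cells with a positive position, filter by the length of the top
    h = g Delta_m, where Delta_m is the product of the half twists on the
    parts of m.  The part of the differential that preserves h sends (m, h) to
    the sum of the (l, h) with the simplicial incidence coefficients
    ([sal_d_top]).  The compositions that occur with a given top h are those
    for which h Delta_m^-1 is positive, and this condition only depends on
    the right descents of h.  If s is the smallest of these descents, merging
    a part 1 at place s with the next part is a contracting homotopy
    ([cone_homotopy]), and an induction on the length of h concludes.  That
    merging preserves positivity ([merge_is_positive]) is a property of the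
    monoid of positive braids: it embeds in the group ([ev_inj]), and an
    element divisible by two generators is divisible by their lcm
    ([is_positive_lcm]).

    As a right H-module this resolution is free on the pairs of a composition
    and a coset representative t_i of H in G; the decomposition of G into
    cosets comes from an explicit action of G on pairs (i, h)
    ([coset_decomposition]).  Its coefficient complex is paired with the
    Fox-Neuwirth complex by evaluating an element of the induced
    representation at t_i and the resulting functional on L at a vector.  The
    pairing is perfect and the two differentials are transposed to each other
    ([pairing_transpose]): moving a permutation braid across the pairing
    inverts it, as in the position of a cell.  Since L is finite dimensional,
    the homology of one complex is the dual of that of the other
    ([homology_duality]), and composing with the comparison of the two
    resolutions ([resolution_compare]) gives the isomorphism. *)

Set Implicit Arguments.
Unset Strict Implicit.
Unset Printing Implicit Defensive.

Local Open Scope nat_scope.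

(** * Positive words and Garside's lemma *)

Definition far (i j : nat) := (i.+1 < j) || (j.+1 < i).
Definition adj (i j : nat) := (i.+1 == j) || (j.+1 == i).

Inductive braid_step : seq nat -> seq nat -> Prop :=
| step_far i j u : far i j -> braid_step [:: i, j & u] [:: j, i & u]
| step_adj i j u : adj i j -> braid_step [:: i, j, i & u] [:: j, i, j & u]
| step_cons i u v : braid_step u v -> braid_step (i :: u) (i :: v).

(** Equality in the monoid of positive braids.  Words carry letters in nat rather than
    in an ordinal, so that shifting a word to other strands is a mere [map]. *)
Inductive beq : seq nat -> seq nat -> Prop :=
| beq_refl u : beq u u
| beq_step u v w : braid_step u v -> beq v w -> beq u w.

#[local] Hint Resolve beq_refl : core.

Lemma far_sym i j : far i j = far j i. Proof. by rewrite /far orbC. Qed.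
Lemma adj_sym i j : adj i j = adj j i. Proof. by rewrite /adj orbC. Qed.

Lemma braid_step_sym u v : braid_step u v -> braid_step v u.
Proof.
elim=> [i j w|i j w|i {}u {}v _ IH]; last exact: step_cons.
  by rewrite far_sym; apply: step_far.
by rewrite adj_sym; apply: step_adj.
Qed.

Lemma beq_trans u v w : beq u v -> beq v w -> beq u w.
Proof. by elim=> // {}u v' {}v uv' _ IH /IH; apply: beq_step. Qed.

Lemma beq_sym u v : beq u v -> beq v u.
Proof.
elim=> [{}u|{}u v' {}v uv' _ IH]; first exact: beq_refl.
by apply: beq_trans IH (beq_step (braid_step_sym uv') (beq_refl _)).
Qed.

#[local] Instance beq_equiv : Equivalence beq.
Proof.
split; [exact: beq_refl | exact: beq_sym | exact: beq_trans].
Qed.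

Lemma beq_cons i u v : beq u v -> beq (i :: u) (i :: v).
Proof.
elim=> [{}u|{}u v' {}v uv' _ IH]; first exact: beq_refl.
exact: beq_step (step_cons i uv') IH.
Qed.

#[local] Instance cons_beq : Proper (eq ==> beq ==> beq) (@cons nat).
Proof. by move=> i _ <- u v; apply: beq_cons. Qed.

Lemma braid_step_cat u v w : braid_step u v -> braid_step (u ++ w) (v ++ w).
Proof.
elim=> [i j x|i j x|i {}u {}v _ IH] /=; [exact: step_far|exact: step_adj|].
exact: step_cons.
Qed.

Lemma beq_cat u u' v v' : beq u u' -> beq v v' -> beq (u ++ v) (u' ++ v').
Proof.
move=> uu' vv'; transitivity (u ++ v').
  by elim: u {uu'} => //= i u IH; apply: beq_cons.
elim: uu' => [w|{}u w {}u' uw _ IH]; first exact: beq_refl.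
exact: beq_step (braid_step_cat _ uw) IH.
Qed.

#[local] Instance cat_beq : Proper (beq ==> beq ==> beq) (@cat nat).
Proof. by move=> u u' uu' v v' vv'; apply: beq_cat. Qed.

Lemma beq_far i j u : far i j -> beq [:: i, j & u] [:: j, i & u].
Proof. by move=> ij; apply: beq_step (step_far u ij) (beq_refl _). Qed.

Lemma beq_adj i j u : adj i j -> beq [:: i, j, i & u] [:: j, i, j & u].
Proof. by move=> ij; apply: beq_step (step_adj u ij) (beq_refl _). Qed.

Lemma beq_size u v : beq u v -> size u = size v.
Proof.
elim=> // {}u v' {}v uv' _ <-.
by elim: uv' => //= i x y _ ->.
Qed.

Lemma beq_perm u v : beq u v -> u =i v.
Proof.
elim=> // {}u v' {}v uv' _ IH x; rewrite -{}IH.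
elim: uv' => [i j w _|i j w _|i w w' _ IH]; rewrite !inE ?IH //.
  by rewrite orbCA.
by case: (x == i); case: (x == j).
Qed.

Lemma beq_rev u v : beq u v -> beq (rev u) (rev v).
Proof.
have st x y : braid_step x y -> beq (rev x) (rev y).
  elim=> [i j w ij|i j w ij|i w w' _ IH]; rewrite !rev_cons -!cats1 -?catA /=.
  - by apply: beq_cat (beq_refl _) _; apply: beq_far; rewrite far_sym.
  - by apply: beq_cat (beq_refl _) _; apply: beq_adj.
  - exact: beq_cat IH (beq_refl _).
elim=> [{}u|{}u v' {}v uv' _ IH]; first exact: beq_refl.
exact: beq_trans (st _ _ uv') IH.
Qed.

Lemma beq_shift k u v : beq u v -> beq [seq (k + i)%N | i <- u] [seq (k + i)%N | i <- v].
Proof.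
have farD i j : far (k + i) (k + j) = far i j by rewrite /far; lia.
have adjD i j : adj (k + i) (k + j) = adj i j by rewrite /adj; lia.
elim=> [{}u|{}u v' {}v uv' _ IH]; first exact: beq_refl.
apply: beq_trans IH; elim: uv' => [i j w ij|i j w ij|i w w' _ IH] /=.
- by apply: beq_far; rewrite farD.
- by apply: beq_adj; rewrite adjD.
- exact: beq_cons.
Qed.

(** The word [s :: lcm_tail s t] represents the least common right multiple of the
    letters s and t. *)
Definition lcm_tail (s t : nat) : seq nat :=
  if s == t then [::] else if adj s t then [:: t; s] else [:: t].

Lemma lcm_tailxx s : lcm_tail s s = [::]. Proof. by rewrite /lcm_tail eqxx. Qed.
Lemma lcm_tail_adj s t : adj s t -> lcm_tail s t = [:: t; s].
Proof. by rewrite /lcm_tail => st; rewrite st; case: eqP st => // ->; rewrite /adj; lia. Qed.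
Lemma lcm_tail_far s t : far s t -> lcm_tail s t = [:: t].
Proof. by rewrite /lcm_tail /far /adj => st; do 2?case: ifP => //; lia. Qed.

Variant letters_spec (s t : nat) : Prop :=
| letters_eq of s = t
| letters_adj of adj s t & adj t s
| letters_far of far s t & far t s.

Lemma compare_lettersP s t : letters_spec s t.
Proof.
rewrite /adj; case: (ltngtP s t) => st; last exact: letters_eq.
  case: (ltngtP s.+1 t) => st'; first 1 last.
  - by lia.
  - by apply: letters_adj; rewrite /adj st' eqxx ?orbT.
  - by apply: letters_far; rewrite /far st' ?orbT.
case: (ltngtP t.+1 s) => st'; first 1 last.
- by lia.
- by apply: letters_adj; rewrite /adj st' eqxx ?orbT.
- by apply: letters_far; rewrite /far st' ?orbT.
Qed.

(** Stated for words with given first letters, so that it can be proved one braid move at a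
    time. *)
Definition has_lcm (u v : seq nat) : Prop := forall s x t y, u = s :: x -> v = t :: y ->
  exists z, beq x (lcm_tail s t ++ z) /\ beq y (lcm_tail t s ++ z).

Lemma has_lcm_step u v : braid_step u v -> has_lcm u v.
Proof.
case=> [i j w ij|i j w ij|i w w' ww'] s x t y [<- <-] [<- <-].
- have ji : far j i by rewrite far_sym.
  by exists w; rewrite !lcm_tail_far //; split; apply: beq_refl.
- have ji : adj j i by rewrite adj_sym.
  by exists w; rewrite !lcm_tail_adj //; split; apply: beq_refl.
- by exists w'; rewrite lcm_tailxx; split; [apply: beq_step ww' _|]; apply: beq_refl.
Qed.

Section LcmTrans.
Variable L : nat.
Hypothesis IH : forall u v, (size u <= L)%N -> beq u v -> has_lcm u v.

Lemma ih_lcm s x t y : (size x < L)%N -> beq (s :: x) (t :: y) ->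
  exists z, beq x (lcm_tail s t ++ z) /\ beq y (lcm_tail t s ++ z).
Proof. by move=> xL e; apply: (IH _ e). Qed.

Lemma ih_cancel s x y : (size x < L)%N -> beq (s :: x) (s :: y) -> beq x y.
Proof.
by move=> xL e; have [z []] := ih_lcm xL e; rewrite lcm_tailxx /= => -> ->.
Qed.

Lemma ih_adj s x t y : adj s t -> (size x < L)%N -> beq (s :: x) (t :: y) ->
  exists z, beq x [:: t, s & z] /\ beq y [:: s, t & z].
Proof.
move=> st xL /(ih_lcm xL) [z]; have ts : adj t s by rewrite adj_sym.
by rewrite !lcm_tail_adj //; exists z.
Qed.

Lemma ih_far s x t y : far s t -> (size x < L)%N -> beq (s :: x) (t :: y) ->
  exists z, beq x (t :: z) /\ beq y (s :: z).
Proof.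
move=> st xL /(ih_lcm xL) [z]; have ts : far t s by rewrite far_sym.
by rewrite !lcm_tail_far //; exists z.
Qed.

(** The inductive step of Garside's lemma: words beginning with s and with t that agree
    with the same word beginning with u are compared by the property for the shorter words
    behind u.  The cases are the relative positions of the three letters; when s, u, t
    are consecutive the common multiple is that of a braid group on four strands. *)
Lemma lcm_trans_step s x u v t y z1 z2 : size v = L ->
  beq x (lcm_tail s u ++ z1) -> beq v (lcm_tail u s ++ z1) ->
  beq v (lcm_tail u t ++ z2) -> beq y (lcm_tail t u ++ z2) ->
  exists z, beq x (lcm_tail s t ++ z) /\ beq y (lcm_tail t s ++ z).
Proof.
move=> vL.
case: (compare_lettersP s u) => [->|su us|su us].
- by rewrite lcm_tailxx /= => e1 e2 e3 e4; exists z2; rewrite e1 -e2.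
- case: (compare_lettersP u t) => [<-|ut tu|ut tu].
  + by rewrite lcm_tailxx /= => e1 e2 e3 e4; exists z1; rewrite e4 -e3.
  + case: (compare_lettersP s t) => [st|st|st ts]; last first.
    * rewrite (lcm_tail_far st) (lcm_tail_far ts) (lcm_tail_adj su) (lcm_tail_adj us) (lcm_tail_adj ut) (lcm_tail_adj tu) /= => e1 e2 e3 e4.
      have := beq_size e2; have := beq_size e3; rewrite vL /= => L1 L2.
      move: e2; rewrite e3 => /(ih_far ts) => /(_ ltac:(rewrite /=; lia)) [z3 [e5 e6]].
      have /= L3 := beq_size e5; have /= L4 := beq_size e6.
      have [|z4 [e7 e8]] := ih_adj us _ e5; first lia.
      have [|z5 [e9 e10]] := ih_adj ut _ e6; first lia.
      have /= L5 := beq_size e7; have /= L6 := beq_size e9.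
      move: e10; rewrite e8 => /ih_cancel => /(_ ltac:(rewrite /=; lia)) e10.
      have [|z6 [e11 e12]] := ih_far st _ e10; first lia.
      exists [:: u, t, s, u & z6]; split.
        rewrite e1 e9 e12 (beq_far _ st) (beq_adj _ su).
        by rewrite (beq_adj (s :: u :: z6) ut).
      rewrite e4 e7 e11 (beq_far _ ts) (beq_adj _ tu).
      by rewrite (beq_adj (t :: u :: z6) us) (beq_far _ st).
    * by move: su ut st; rewrite /adj; lia.
    * move: st ut tu => <- _ _; rewrite lcm_tailxx !lcm_tail_adj //= => e1 e2 e3 e4.
      have := beq_size e2; have := beq_size e3; rewrite vL /= => L1 L2.
      move: e2; rewrite e3 => /ih_cancel => /(_ ltac:(rewrite /=; lia)).
      move=> /ih_cancel => /(_ ltac:(lia)) e; exists (u :: s :: z1).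
      by rewrite e4 e; split.
  + rewrite (lcm_tail_far ut) (lcm_tail_far tu) (lcm_tail_adj su) (lcm_tail_adj us) /= => e1 e2 e3 e4.
    have := beq_size e2; have := beq_size e3; rewrite vL /= => L1 L2.
    move: e2; rewrite e3.
    case: (compare_lettersP s t) => [st|st ts|st ts] e2.
    * by move: su ut; rewrite st /adj /far; lia.
    * (* s u z1 ~ t z2 *)
      have [|z3 [e5 e6]] := ih_adj ts _ e2; first lia.
      have /= L3 := beq_size e5; have /= L4 := beq_size e6.
      have [|z4 [e7 e8]] := ih_far ut _ e6; first lia.
      have /= L5 := beq_size e7; have /= L6 := beq_size e8.
      have [|z5 [e9 e10]] := ih_adj su _ e8; first lia.
      exists [:: u, s, t & z5]; rewrite !lcm_tail_adj //=; split.
        rewrite e1 e7 e10 (beq_adj _ st) (beq_far _ ut).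
        by rewrite (beq_far z5 tu) (beq_adj (t :: z5) us).
      rewrite e4 e5 e9 (beq_far _ tu) (beq_adj (t :: s :: z5) us).
      by rewrite (beq_adj _ st) (beq_far _ ut).
    * have [|z3 [e5 e6]] := ih_far ts _ e2; first lia.
      have /= L3 := beq_size e5; have /= L4 := beq_size e6.
      have [|z4 [e7 e8]] := ih_far ut _ e6; first lia.
      exists [:: u, s & z4]; rewrite !lcm_tail_far //=; split.
        by rewrite e1 e7 (beq_far _ st) (beq_far _ ut).
      by rewrite e4 e5 e8 (beq_adj _ us).
- case: (compare_lettersP u t) => [<-|ut tu|ut tu].
  + by rewrite lcm_tailxx /= => e1 e2 e3 e4; exists z1; rewrite e4 -e3.
  + rewrite (lcm_tail_far us) (lcm_tail_far su) (lcm_tail_adj ut) (lcm_tail_adj tu) /= => e1 e2 e3 e4.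
    have := beq_size e2; have := beq_size e3; rewrite vL /= => L1 L2.
    move: e2; rewrite e3 => /beq_sym.
    case: (compare_lettersP t s) => [st|st ts|st ts] e2.
    * by move: su ut; rewrite st /adj /far; lia.
    * have [|z3 [e5 e6]] := ih_adj ts _ e2; first by rewrite /=; lia.
      have /= L3 := beq_size e5; have /= L4 := beq_size e6.
      have [|z4 [e7 e8]] := ih_far us _ e6; first lia.
      have /= L5 := beq_size e7; have /= L6 := beq_size e8.
      have [|z5 [e9 e10]] := ih_adj tu _ e8; first lia.
      exists [:: u, t, s & z5]; rewrite !lcm_tail_adj //=; split.
        rewrite e1 e5 e9 (beq_far _ su) (beq_adj (s :: t :: z5) ut).
        by rewrite (beq_adj _ st) (beq_far _ us).
      rewrite e4 e7 e10 (beq_adj _ st) (beq_far _ us).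
      by rewrite (beq_far z5 su) (beq_adj (s :: z5) ut).
    * have [|z3 [e5 e6]] := ih_far ts _ e2; first by rewrite /=; lia.
      have /= L3 := beq_size e5; have /= L4 := beq_size e6.
      have [|z4 [e7 e8]] := ih_far us _ e6; first lia.
      exists [:: u, t & z4]; rewrite !lcm_tail_far //=; split.
        by rewrite e1 e5 e8 (beq_adj _ ut).
      by rewrite e4 e7 (beq_far _ st) (beq_far _ us).
  + rewrite (lcm_tail_far us) (lcm_tail_far su) (lcm_tail_far ut) (lcm_tail_far tu) /= => e1 e2 e3 e4.
    have := beq_size e2; have := beq_size e3; rewrite vL /= => L1 L2.
    move: e2; rewrite e3 => /beq_sym.
    case: (compare_lettersP s t) => [->|st ts|st ts] e2.
    * by exists (u :: z1); rewrite lcm_tailxx e1 e4 (ih_cancel _ e2) //; lia.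
    * have [|z3 [e5 e6]] := ih_adj st _ e2; first lia.
      exists (u :: z3); rewrite !lcm_tail_adj //=; split.
        by rewrite e1 e5 (beq_far _ ut) (beq_far _ us).
      by rewrite e4 e6 (beq_far _ us) (beq_far _ ut).
    * have [|z3 [e5 e6]] := ih_far st _ e2; first lia.
      exists (u :: z3); rewrite !lcm_tail_far //=; split.
        by rewrite e1 e5 (beq_far _ ut).
      by rewrite e4 e6 (beq_far _ us).
Qed.
End LcmTrans.

(** Garside's lemma: an element of the positive monoid divisible by two letters is
    divisible by their lcm.  Cancellation is the case of equal letters. *)
Lemma beq_has_lcm u v : beq u v -> has_lcm u v.
Proof.
move: {2}(size u) (leqnn (size u)) => L; elim: L u v => [|L IH] u v.
  by case: u => // _ e s x t y.
move=> uL e; elim: e uL => [{}u|{}u v' {}v uv' v'v IHe] uL.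
  move=> s x t y -> [<- <-]; exists x; rewrite lcm_tailxx; split; exact: beq_refl.
move=> s x t y uE vE.
have e1 := beq_step uv' (beq_refl _); have L1 := beq_size e1.
case: v' uv' v'v {e1} IHe L1 => [|a v'] uv' v'v IHe L1; first by rewrite uE in L1.
have [z1 [e2 e3]] := has_lcm_step uv' uE erefl.
have [|z2 [e4 e5]] := IHe _ _ _ _ _ erefl vE; first by rewrite -L1.
apply: (@lcm_trans_step (size v') _ _ _ _ _ _ _ _ _ _ e2 e3 e4 e5) => // w w' wL.
apply: IH; apply: leq_trans wL _; move: uL; rewrite L1 /=; lia.
Qed.

(** * Half twists and the full twist *)

Lemma beq_cancell w u v : beq (w ++ u) (w ++ v) -> beq u v.
Proof.
elim: w => //= i w IH /beq_has_lcm /(_ _ _ _ _ erefl erefl) [z []].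
by rewrite lcm_tailxx /= => e1 e2; apply: IH; rewrite e1 e2.
Qed.

Lemma beq_cancelr w u v : beq (u ++ w) (v ++ w) -> beq u v.
Proof.
move=> /beq_rev; rewrite !rev_cat => /beq_cancell /beq_rev.
by rewrite !revK.
Qed.

Lemma beq_far_cat i u : all (far i) u -> beq (u ++ [:: i]) (i :: u).
Proof.
elim: u => //= j u IH /andP [ij /IH e]; rewrite e.
by apply: beq_far; rewrite far_sym.
Qed.

(** The braid sigma_(off+m-1) ... sigma_off, which carries one strand across m others. *)
Definition drun (off m : nat) : seq nat := rev (iota off m).

Lemma drunS off m : drun off m.+1 = (off + m)%N :: drun off m.
Proof. by rewrite /drun -addn1 iotaD /= cats1 rev_rcons. Qed.

Lemma drunSr off m : drun off m.+1 = drun off.+1 m ++ [:: off].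
Proof. by rewrite /drun /= rev_cons cats1. Qed.

Lemma mem_drun off m i : (i \in drun off m) = (off <= i < off + m).
Proof. by rewrite /drun mem_rev mem_iota. Qed.

Lemma drun_slide off m i : off <= i -> i.+1 < off + m ->
  beq (drun off m ++ [:: i.+1]) (i :: drun off m).
Proof.
elim: m => [|m IH] oi im; first by lia.
have [e|ne] := eqVneq i.+1 (off + m)%N; last first.
  rewrite drunS /= IH; [|lia..].
  by apply: beq_far; rewrite /far; lia.
case: m e IH im => [|m] e _ im; first by lia.
have -> : i = (off + m)%N by lia.
rewrite !drunS /= -addnS beq_far_cat; last first.
  by apply/allP => j; rewrite mem_drun /far; lia.
by apply: beq_adj; rewrite /adj; lia.
Qed.

(** Carrying a strand across m others shifts by one the indices of the braids on these. *)
Lemma drun_slides off m u : all (fun i => (off <= i) && (i.+1 < off + m)) u ->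
  beq (drun off m ++ [seq i.+1 | i <- u]) (u ++ drun off m).
Proof.
elim: u => [|i u IH] /=; first by rewrite cats0.
case/andP=> /andP [oi im] /IH e.
by rewrite -cat1s catA drun_slide //= e.
Qed.

Lemma drun_succ off m : drun off.+1 m = [seq i.+1 | i <- drun off m].
Proof. by rewrite /drun map_rev -[off.+1]add1n iotaDl. Qed.

(** Garside's element Delta of the m strands starting at strand number off, as a word. *)
Fixpoint half_twist (off m : nat) : seq nat :=
  if m is m'.+1 then drun off m' ++ half_twist off.+1 m' else [::].

Lemma mem_half_twist off m i :
  i \in half_twist off m -> (off <= i) && (i.+1 < off + m).
Proof.
elim: m off => //= m IH off; rewrite mem_cat mem_drun => /orP [|/IH]; lia.
Qed.

(** The definition with its first two runs in the other order.  The letter off commutes with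
    the remaining half twist and turns one factorization into the other, which moves it
    across. *)
Lemma half_twist_two_runs off m :
  beq (half_twist off m.+2) (drun off m ++ drun off m.+1 ++ half_twist off.+2 m).
Proof.
rewrite /= drun_succ catA drun_slides ?catA //.
by apply/allP => i; rewrite mem_drun; lia.
Qed.

Lemma half_twist_conj off m j : off <= j -> j.+1 < off + m ->
  beq (half_twist off m ++ [:: j]) (2 * off + m - 2 - j :: half_twist off m).
Proof.
elim: m off => [|m IH] off oj jm; first by lia.
have [e|ne] := eqVneq off j; last first.
  rewrite /= -catA IH; [|lia..].
  rewrite -cat1s catA.
  have -> : 2 * off.+1 + m - 2 - j = (2 * off + m.+1 - 2 - j).+1 by lia.
  by rewrite drun_slide //; lia.
case: m IH jm => [|m] IH jm; first by lia.
subst j; rewrite {2}half_twist_two_runs.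
have -> : 2 * off + m.+2 - 2 - off = off + m by lia.
have fw : all (far off) (half_twist off.+2 m).
  by apply/allP => i /mem_half_twist; rewrite /far; lia.
rewrite -(cat_cons _ (drun off m)) -drunS /= -!catA (beq_far_cat fw).
by rewrite {3}drunSr -!catA /=.
Qed.

(** Hence the inverse of a letter is a positive word up to a full twist. *)
Lemma half_twist_end off m j : off <= j -> j.+1 < off + m ->
  exists z, beq (half_twist off m) (z ++ [:: j]) /\
    all (fun i => (off <= i) && (i.+1 < off + m)) z.
Proof.
elim: m off => [|m IH] off oj jm; first by lia.
have [e|ne] := eqVneq off j; last first.
  have [||z [ze /allP zP]] := IH off.+1; [lia..|].
  exists (drun off m ++ z); rewrite /= ze catA; split=> //.
  by apply/allP => i; rewrite mem_cat mem_drun => /orP [|/zP]; lia.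
case: m IH jm => [|m] IH jm; first by lia.
subst j; exists (drun off m ++ drun off.+1 m ++ half_twist off.+2 m); split.
  have fw : all (far off) (half_twist off.+2 m).
    by apply/allP => i /mem_half_twist; rewrite /far; lia.
  by rewrite half_twist_two_runs drunSr -!catA (beq_far_cat fw).
apply/allP => i; rewrite !mem_cat !mem_drun => /or3P [||/mem_half_twist]; lia.
Qed.

Definition full_twist (m : nat) := half_twist 0 m ++ half_twist 0 m.

(** Delta sends the letter j to its mirror image, and hence Delta^2 fixes it. *)
Lemma full_twist_central m j : j.+1 < m ->
  beq (full_twist m ++ [:: j]) (j :: full_twist m).
Proof.
move=> jm; rewrite /full_twist -catA half_twist_conj // -cat1s catA.
rewrite half_twist_conj //; last by lia.
by have -> : 2 * 0 + m - 2 - (2 * 0 + m - 2 - j) = j by lia.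
Qed.

Lemma full_twist_central_word m u : all (fun i => i.+1 < m) u ->
  beq (full_twist m ++ u) (u ++ full_twist m).
Proof.
elim: u => [|i u IH] /=; first by rewrite cats0.
case/andP=> im /IH e; rewrite -cat1s catA full_twist_central //=.
by rewrite e.
Qed.

(** * The monoid of positive braids inside the braid group *)

Section Positive.
Variable N : nat.
Local Notation G := (braid_group N).
Implicit Types (u v w : seq nat) (g h p : G).

Definition letters (u : seq nat) := all (fun i => i.+1 < N) u.

Lemma letters_cat u v : letters (u ++ v) = letters u && letters v.
Proof. exact: all_cat. Qed.

Lemma letters_beq u v : beq u v -> letters u = letters v.
Proof. by move=> e; apply/eq_all_r/beq_perm. Qed.

Definition positive_braid (u : seq nat) : G :=
  foldr (fun j b => (sigma N j * b)%g) 1%g u.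
Local Notation ev := positive_braid.

Lemma ev_cat u v : ev (u ++ v) = (ev u * ev v)%g.
Proof. by elim: u => [|i u IH] /=; rewrite ?mul1g // IH mulgA. Qed.

Lemma sigma_gen (i : 'I_N.-1) : sigma N i = pg_gen _ i.
Proof. by rewrite /sigma insubT // => p; congr pg_gen; apply: val_inj. Qed.

Lemma sigma_far i j : far i j -> i.+1 < N -> j.+1 < N ->
  (sigma N i * sigma N j = sigma N j * sigma N i)%g.
Proof.
rewrite -!ltn_predRL => ij iN jN.
have := @artin_gen_rel _ (@coxeterA N) (Ordinal iN) (Ordinal jN).
have -> : coxeterA (Ordinal iN) (Ordinal jN) = 2.
  rewrite /coxeterA -val_eqE /=; move: ij; rewrite /far.
  by do 2?case: ifP => //; lia.
by rewrite /= !mulg1 -(sigma_gen (Ordinal iN)) -(sigma_gen (Ordinal jN)).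
Qed.

Lemma sigma_adj i j : adj i j -> i.+1 < N -> j.+1 < N ->
  (sigma N i * (sigma N j * sigma N i) = sigma N j * (sigma N i * sigma N j))%g.
Proof.
rewrite -!ltn_predRL => ij iN jN.
have := @artin_gen_rel _ (@coxeterA N) (Ordinal iN) (Ordinal jN).
have -> : coxeterA (Ordinal iN) (Ordinal jN) = 3.
  rewrite /coxeterA -val_eqE /=; move: ij; rewrite /adj.
  by do 2?case: ifP => //; lia.
by rewrite /= !mulg1 -(sigma_gen (Ordinal iN)) -(sigma_gen (Ordinal jN)).
Qed.

Lemma ev_beq u v : letters u -> beq u v -> ev u = ev v.
Proof.
move=> uN uv; elim: uv uN => // {}u v' {}v uv' _ IH uN.
rewrite -IH; last first.
  by rewrite -(letters_beq (beq_step uv' (beq_refl _))).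
elim: uv' uN => [i j w ij|i j w ij|i w w' _ IHs] /=.
- by case/and3P=> iN jN _; rewrite !mulgA sigma_far.
- by case/and4P=> iN jN _ _; rewrite !mulgA -(mulgA (sigma N i)) sigma_adj ?mulgA.
- by case/andP=> _ /IHs ->.
Qed.

Lemma ev_class (w : seq 'I_N.-1) :
  ev (map val w) = word_class _ [seq (j, false) | j <- w].
Proof.
elim: w => //= j w ->; rewrite sigma_gen.
by rewrite -[(_ * _)%g]/(pg_mul _ _) pg_mul_class.
Qed.

Lemma lettersP u : letters u -> exists w : seq 'I_N.-1, u = map val w.
Proof.
elim: u => [|i u IH]; first by exists [::].
case/andP; rewrite -ltn_predRL => iN /IH [w ->].
by exists (Ordinal iN :: w).
Qed.

Local Notation c := (full_twist N).

Lemma letters_full_twist : letters c.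
Proof. by apply/allP => i; rewrite mem_cat => /orP [] /mem_half_twist. Qed.

(** Inverses of the letters up to the central full twist; they let a word with inverses
    be rewritten as a positive word divided by a power of the full twist. *)
Lemma co_letter : exists d : nat -> seq nat, forall j, j.+1 < N ->
  [/\ letters (d j), beq (d j ++ [:: j]) c & beq (j :: d j) c].
Proof.
suff /boolp.choice [d dP] : forall j, exists d, j.+1 < N ->
    [/\ letters d, beq (d ++ [:: j]) c & beq (j :: d) c] by exists d.
move=> j.
have [jN|] := boolP (j.+1 < N); last by exists [::].
have [z [ze zN]] := @half_twist_end 0 N j (leq0n _) jN.
(* Delta = z sigma_j, so that Delta z is an inverse of sigma_j up to Delta^2. *)
exists (half_twist 0 N ++ z) => _.
have e : beq ((half_twist 0 N ++ z) ++ [:: j]) c by rewrite -catA -ze.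
split=> //.
  rewrite letters_cat (_ : letters z) ?andbT; last exact: zN.
  by apply/allP => i /mem_half_twist.
apply: (@beq_cancelr [:: j]); rewrite full_twist_central //=.
by rewrite -catA in e *; rewrite e.
Qed.

(** The positive monoid embeds in the braid group.  A word with p inverse letters is sent
    to a positive word standing for its product with the p-th power of the full twist.
    The defining relations of the group preserve this positive word up to a power of the
    full twist, which is central and cancellable. *)
Lemma ev_inj u v : letters u -> letters v -> ev u = ev v -> beq u v.
Proof.
have [d dP] := co_letter.
pose pos (w : word 'I_N.-1) :=
  flatten [seq (if x.2 then d (val x.1) else [:: val x.1]) | x <- w].
pose cs k := flatten (nseq k c).
pose ni (w : word 'I_N.-1) := count (fun x => x.2) w.
have csD k l : cs (k + l) = cs k ++ cs l by rewrite /cs nseqD flatten_cat.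
have csN k : letters (cs k) by elim: k => //= k IH; rewrite letters_cat letters_full_twist.
have posN (w : word 'I_N.-1) : letters (pos w).
  elim: w => //= -[j b] w IH; rewrite letters_cat IH andbT.
  have jN : (val j).+1 < N by rewrite -ltn_predRL ltn_ord.
  by case: b => /=; [have [] := dP _ jN|rewrite jN].
have csC k w : letters w -> beq (cs k ++ w) (w ++ cs k).
  move=> wN; elim: k => /= [|k IH]; first by rewrite cats0.
  by rewrite -catA IH catA full_twist_central_word // -catA.
have pos_cat (w w' : word 'I_N.-1) : pos (w ++ w') = pos w ++ pos w'.
  by rewrite /pos map_cat flatten_cat.
have ni_cat (w w' : word 'I_N.-1) : ni (w ++ w') = ni w + ni w' by rewrite /ni count_cat.
(* Multiplying each side by the power of the full twist of the other side clears both
   denominators. *)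
have E (w w' : word 'I_N.-1) : word_eq (artin_rel (@coxeterA N)) w w' ->
    beq (pos w ++ cs (ni w')) (pos w' ++ cs (ni w)).
  elim=> {w w'} [w|w w' _ IH|w w' w'' _ IH1 _ IH2|w w1 w' w1' _ IH1 _ IH2|j b|w w'].
  - by [].
  - exact: beq_sym.
  - apply: (@beq_cancelr (cs (ni w))).
    rewrite -[in X in beq X _]catA -csD addnC csD catA IH1 -catA -csD addnC csD catA IH2.
    by rewrite -!catA -!csD addnC.
  - rewrite !pos_cat !ni_cat !csD -!catA.
    rewrite (catA (pos w')) -(csC _ (pos w')) // -catA catA IH1.
    rewrite IH2 -catA (catA _ (pos w1')) csC // -!catA.
    by rewrite -!csD [ni w + ni w']addnC [ni w' + _]addnC.
  - have jN : (val j).+1 < N by rewrite -ltn_predRL ltn_ord.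
    have [_ e1 e2] := dP _ jN.
    by case: b; rewrite /pos /cs /= !cats0.
  - case=> i [j [-> ->]].
    have nif a b l : ni (alt_word a b l) = 0.
      by elim: l a b => //= l IH a b; rewrite IH.
    rewrite !nif /= !cats0.
    have [->//|ne] := eqVneq i j.
    have ne' : val i <> val j by move=> e; case/eqP: ne; apply: val_inj.
    rewrite /coxeterA (negPf ne); case: ifP => ij; rewrite /pos /=.
      exact: beq_adj.
    by apply: beq_far; rewrite /far; move: ij ne' => /=; lia.
move=> /lettersP [w ->] /lettersP [w' ->]; rewrite !ev_class.
move=> /word_classP /E.
have posE (x : seq 'I_N.-1) : pos [seq (j, false) | j <- x] = map val x.
  by rewrite /pos -map_comp; elim: x => //= j x ->.
have ni0 (x : seq 'I_N.-1) : ni [seq (j, false) | j <- x] = 0 by elim: x.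
by rewrite !posE !ni0 /= !cats0.
Qed.

Definition is_positive (g : G) := exists2 u, letters u & g = ev u.

Lemma is_positive1 : is_positive 1%g. Proof. by exists [::]. Qed.

Lemma is_positiveM g h : is_positive g -> is_positive h -> is_positive (g * h)%g.
Proof.
move=> [u uN ->] [v vN ->]; exists (u ++ v); last by rewrite ev_cat.
by rewrite letters_cat uN.
Qed.

Lemma is_positive_ev u : letters u -> is_positive (ev u). Proof. by exists u. Qed.

Lemma is_positive_sigma j : j.+1 < N -> is_positive (sigma N j).
Proof. by move=> jN; exists [:: j]; rewrite /letters /= ?jN ?mulg1. Qed.

Lemma is_positive_lcm x y s t : s.+1 < N -> t.+1 < N -> is_positive x -> is_positive y ->
  (x * sigma N s = y * sigma N t)%g ->
  exists2 z, is_positive z & x = (z * ev (rev (lcm_tail s t)))%g.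
Proof.
move=> sN tN [u uN ->] [v vN ->] e.
have {}e : beq (u ++ [:: s]) (v ++ [:: t]).
  apply: ev_inj; rewrite ?letters_cat ?uN ?vN /letters /= ?sN ?tN //.
  by rewrite !ev_cat /= !mulg1.
have /beq_rev := e; rewrite !rev_cat /= => /beq_has_lcm /(_ _ _ _ _ erefl erefl).
move=> [z [/beq_rev + _]]; rewrite revK rev_cat => e1.
have := letters_beq e1; rewrite uN letters_cat => /esym /andP [zN _].
by exists (ev (rev z)); [apply: is_positive_ev | rewrite (ev_beq uN e1) ev_cat].
Qed.

(** The braid x sigma_s is divisible by sigma_s and sigma_t, hence by their lcm, which is
    their product. *)
Lemma is_positive_far x y s t : far s t -> s.+1 < N -> t.+1 < N -> is_positive x -> is_positive y ->
  (x * sigma N s = y * sigma N t)%g -> is_positive (x * (sigma N t)^-1)%g.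
Proof.
move=> st sN tN xP yP e; have [z zP ->] := is_positive_lcm sN tN xP yP e.
by rewrite lcm_tail_far //= mulg1 mulgK.
Qed.

Lemma is_positive_adj x y s t : adj s t -> s.+1 < N -> t.+1 < N -> is_positive x -> is_positive y ->
  (x * sigma N s = y * sigma N t)%g ->
  exists2 z, is_positive z & x = (z * sigma N s * sigma N t)%g.
Proof.
move=> st sN tN xP yP e; have [z zP ->] := is_positive_lcm sN tN xP yP e.
by exists z; rewrite // lcm_tail_adj //= mulg1 mulgA.
Qed.

Lemma ev_far t u : t.+1 < N -> letters u -> all (far t) u ->
  (ev u * sigma N t = sigma N t * ev u)%g.
Proof.
move=> tN uN ut; have := ev_beq _ (beq_far_cat ut).
rewrite ev_cat /= mulg1; apply.
by rewrite letters_cat uN /letters /= tN.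
Qed.

Lemma strip_far t u y : t.+1 < N -> letters u -> all (far t) u -> is_positive y ->
  is_positive (y * ev u * (sigma N t)^-1)%g -> is_positive (y * (sigma N t)^-1)%g.
Proof.
move=> tN; elim: u y => [|j u IH] y /=; first by rewrite mulg1.
case/andP=> jN uN /andP [tj ut] yP xP.
have {}xP : is_positive (y * sigma N j * (sigma N t)^-1)%g.
  by apply: IH => //; [apply: is_positiveM => //; apply: is_positive_sigma|rewrite -(mulgA y)].
apply: (is_positive_far (s := j) (y := (y * sigma N j * (sigma N t)^-1)%g)) => //.
  by rewrite far_sym.
by rewrite mulgKV.
Qed.

(** If y sigma_(j+m-1) ... sigma_(j+1) is divisible by sigma_j, then y is divisible by the
    longer run that ends with sigma_j.  The last letter sigma_(j+1) of the given product and
    sigma_j have an lcm, which provides one more letter, and the induction moves up. *)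
Lemma strip_drun j m y : j + m < N -> 0 < m -> is_positive y ->
  is_positive (y * ev (drun j.+1 m.-1) * (sigma N j)^-1)%g ->
  is_positive (y * (ev (drun j m))^-1)%g.
Proof.
case: m => // m; elim: m j y => [|m IH] j y jN _ yP /=.
  by rewrite /= !mulg1.
have lr : letters (drun j.+2 m).
  by apply/allP => i; rewrite mem_drun; lia.
have fr : all (far j) (drun j.+2 m).
  by apply/allP => i; rewrite mem_drun /far; lia.
rewrite [drun j.+1 m.+1]drunSr ev_cat /= mulg1 => xP.
have sj : adj j.+1 j by rewrite /adj eqxx orbT.
have eP : (y * ev (drun j.+2 m) * sigma N j.+1 =
    y * (ev (drun j.+2 m) * sigma N j.+1) * (sigma N j)^-1 * sigma N j)%g.
  by rewrite mulgKV mulgA.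
have [|||z zP e] := is_positive_adj sj _ _ _ xP eP; [lia|lia| |].
  by apply: is_positiveM => //; apply: is_positive_ev.
have y'P : is_positive (y * (sigma N j)^-1)%g.
  apply: (strip_far (u := drun j.+2 m)) => //; first by lia.
  by rewrite e mulgK; apply: is_positiveM => //; apply: is_positive_sigma; lia.
have /IH : j.+1 + m.+1 < N by lia.
move=> /(_ _ isT y'P) /=; rewrite -(mulgA y).
have -> : ((sigma N j)^-1 * ev (drun j.+2 m) = ev (drun j.+2 m) * (sigma N j)^-1)%g.
  apply: (mulIg (sigma N j)); rewrite mulgKV -mulgA ev_far //; last by lia.
  by rewrite mulKg.
rewrite mulgA e !mulgK => /(_ zP).
by rewrite [drun j m.+2]drunSr ev_cat /= mulg1 invgM mulgA.
Qed.

(** A half twist begins with a run; its other letters and those of w commute with sigma_j and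
    can be ignored for the divisibility by sigma_j. *)
Lemma strip_half_twist j m w p : j + m < N -> 0 < m -> letters w -> all (far j) w ->
  is_positive p -> is_positive (p * ev (half_twist j.+1 m) * ev w * (sigma N j)^-1)%g ->
  is_positive (p * (ev (drun j m))^-1)%g.
Proof.
case: m => // m jN _ wN jw pP xP; apply: strip_drun => //.
have lr : letters (drun j.+1 m).
  by apply/allP => i; rewrite mem_drun; lia.
have lh : letters (half_twist j.+2 m).
  by apply/allP => i /mem_half_twist; lia.
have fh : all (far j) (half_twist j.+2 m).
  by apply/allP => i /mem_half_twist; rewrite /far; lia.
have jN' : j.+1 < N by lia.
have pdP : is_positive (p * ev (drun j.+1 m))%g by apply: is_positiveM => //; apply: is_positive_ev.
apply: (strip_far jN' lh fh) => //.
apply: (strip_far jN' wN jw); first by apply: is_positiveM => //; apply: is_positive_ev.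
by move: xP; rewrite /= ev_cat !mulgA.
Qed.

Lemma is_positive_half_twist_end j m w : letters w -> all (far j) w -> 1 < m -> j + m <= N ->
  is_positive (ev (half_twist j m) * ev w * (sigma N j)^-1)%g.
Proof.
move=> wN jw m1 jmN; have jN : j.+1 < N by lia.
have [|z [ze zN]] := @half_twist_end j m j (leqnn _); first by lia.
have hN : letters (half_twist j m) by apply/allP => i /mem_half_twist; lia.
have zN' : letters z by apply/allP => i /(allP zN); lia.
rewrite (ev_beq hN ze) ev_cat /= mulg1 -(mulgA (ev z)) -ev_far //.
by rewrite mulgA mulgK; apply: is_positiveM; apply: is_positive_ev.
Qed.

(** Multiplying by a full twist turns one inverse letter into a positive word. *)
Lemma full_twist_positive g : exists m, is_positive (ev c ^+ m * g)%g.
Proof.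
have [d dP] := co_letter.
rewrite -[g]word_reprK; elim: (word_repr g) => [|[j b] w [m IH]].
  by exists 0; rewrite expg0 mul1g; apply: is_positive1.
have jN : (val j).+1 < N by rewrite -ltn_predRL ltn_ord.
have [dN e1 e2] := dP _ jN.
have cC : commute (ev c) (sigma N j).
  have := ev_beq _ (full_twist_central jN); rewrite ev_cat /= mulg1; apply.
  by rewrite letters_cat letters_full_twist /letters /= jN.
have -> : word_class (artin_rel (@coxeterA N)) ((j, b) :: w) =
  ((if b then (sigma N j)^-1 else sigma N j) * word_class _ w)%g.
  rewrite sigma_gen; case: b; last first.
    by rewrite -[(_ * _)%g]/(pg_mul _ _) pg_mul_class.
  apply: (mulgI (pg_gen _ j)); rewrite mulKVg -[LHS]/(pg_mul _ _) pg_mul_class.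
  by apply/word_classP; apply: (word_eq_cat (u' := [::]) (word_eq_cancel _ j false) (word_eq_refl _ _)).
case: b.
  exists m.+1; rewrite expgSr -(mulgA _ (ev c)) (mulgA (ev c)).
  have -> : (ev c * (sigma N j)^-1 = ev (d j))%g.
    apply: (mulIg (sigma N j)); rewrite mulgKV.
    rewrite -(ev_beq _ e1) ?ev_cat /= ?mulg1 //.
    by rewrite letters_cat dN /letters /= jN.
  have dC : commute (ev c) (ev (d j)).
    have := ev_beq _ (full_twist_central_word dN); rewrite !ev_cat; apply.
    by rewrite letters_cat letters_full_twist dN.
  rewrite mulgA (commute_sym (commuteX m (commute_sym dC))) -mulgA.
  by apply: is_positiveM => //; apply: is_positive_ev.
exists m; rewrite mulgA (commute_sym (commuteX m (commute_sym cC))) -mulgA.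
by apply: is_positiveM => //; apply: is_positive_sigma.
Qed.

End Positive.

(** * Inversions and reduced words *)

(** The transposition of j and j + 1 acting on nat, so that relations between adjacent
    transpositions can be checked without ordinals. *)
Definition swap (j x : nat) := if x == j then j.+1 else if x == j.+1 then j else x.

Lemma swapL j : swap j j = j.+1.
Proof. by rewrite /swap eqxx. Qed.

Lemma swapR j : swap j j.+1 = j.
Proof. by rewrite /swap eqxx; case: eqP => //; lia. Qed.

Lemma swapD j x : x != j -> x != j.+1 -> swap j x = x.
Proof. by rewrite /swap; do 2!case: eqP. Qed.

Lemma swap_far i j x : far i j -> swap i (swap j x) = swap j (swap i x).
Proof. by rewrite /far /swap; do !case: eqP; lia. Qed.

Lemma swap_adj i j x : adj i j ->
  swap i (swap j (swap i x)) = swap j (swap i (swap j x)).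
Proof.
suff H k : swap k (swap k.+1 (swap k x)) = swap k.+1 (swap k (swap k.+1 x)).
  by case/orP=> /eqP <-; rewrite H.
have E : ((k == k.+1) = false) * ((k.+1 == k) = false) * ((k.+2 == k) = false) *
  ((k == k.+2) = false) * ((k.+2 == k.+1) = false) * ((k.+1 == k.+2) = false).
  by do !split; lia.
rewrite /swap; have [e|x0] := eqVneq x k; first by rewrite ?e !(eqxx, E).
have [e|x1] := eqVneq x k.+1; first by rewrite ?e !(eqxx, E).
have [e|x2] := eqVneq x k.+2; first by rewrite ?e !(eqxx, E).
by rewrite !(negPf x0, negPf x1, negPf x2).
Qed.

Section Inversions.
Variable m : nat.
Implicit Types (s x y : 'S_m) (a b : 'I_m).

Definition inversions s : {set 'I_m * 'I_m} :=
  [set ab : 'I_m * 'I_m | (ab.1 < ab.2) && (s ab.2 < s ab.1)].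
Definition inv s := #|inversions s|.

Lemma inv1 : inv 1%g = 0.
Proof.
apply/eqP; rewrite cards_eq0; apply/eqP/setP => -[a b].
by rewrite !inE !perm1 /=; case: ltngtP.
Qed.

Lemma ltn_perm s a b : (s a < s b) = (s a <= s b) && (a != b).
Proof. by rewrite ltn_neqAle val_eqE (inj_eq perm_inj) andbC. Qed.

(** No inversion of y is undone by x, so the inversions of the product are those of y and
    those pulled back from x. *)
Lemma invM x y : (forall a b, a < b -> y b < y a -> x (y b) < x (y a)) ->
  inv (y * x)%g = inv x + inv y.
Proof.
move=> xy; pose f (ab : 'I_m * 'I_m) := ((y^-1)%g ab.1, (y^-1)%g ab.2).
have f_inj : injective f.
  by move=> [a b] [c d] [] /perm_inj -> /perm_inj ->.
have E : inversions (y * x)%g = inversions y :|: f @: inversions x.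
  apply/setP => -[a b]; apply/idP/idP; rewrite !inE !permM /=.
    case/andP=> ab xab; rewrite ab /=; case: ltnP => //= yab.
    apply/imsetP; exists (y a, y b); last by rewrite /f /= !permK.
    rewrite inE /= xab andbT ltn_neqAle yab andbT val_eqE.
    by rewrite (inj_eq perm_inj); apply: contraTneq ab => ->; rewrite ltnn.
  case/orP=> [/andP [ab yab]|/imsetP [[c d]]]; first by rewrite ab xy.
  rewrite inE /= => /andP [cd xdc] [-> ->]; rewrite !permKV xdc andbT.
  rewrite ltnNge; apply/negP => le.
  have lt : (y^-1)%g d < (y^-1)%g c.
    by rewrite ltn_perm le /=; apply: contraTneq cd => ->; rewrite ltnn.
  have := xy _ _ lt; rewrite !permKV => /(_ cd).
  by rewrite ltnNge (ltnW xdc).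
rewrite /inv E cardsU card_imset // addnC.
rewrite (_ : _ :&: _ = set0) ?cards0 ?subn0 //.
apply/setP => -[a b]; rewrite !inE /=; apply/negP => /andP [/andP [ab yab]].
case/imsetP=> -[c d]; rewrite inE /= => /andP [cd xdc] [ea eb].
by move: yab; rewrite ea eb !permKV ltnNge (ltnW cd).
Qed.

Lemma inv_eq0 s : inv s = 0 -> s = 1%g.
Proof.
move/eqP; rewrite cards_eq0 => /eqP s0.
have mono a b : a < b -> s a < s b.
  move=> ab; move/setP/(_ (a, b)): s0; rewrite !inE ab /= => /negbT.
  rewrite -leqNgt => le; rewrite ltn_perm le /=.
  by apply: contraTneq ab => ->; rewrite ltnn.
have lo t a : (forall b c : 'I_m, b < c -> (t : 'S_m) b < t c) -> a <= t a.
  move=> tmono; have [k] := ubnP a; elim: k a => // k IH a ak.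
  case: (posnP a) => [->//|a0]; have pm : a.-1 < m.
    by apply: leq_ltn_trans (leq_pred _) (ltn_ord a).
  have /tmono : Ordinal pm < a by rewrite /= prednK.
  have /IH : Ordinal pm < k by rewrite /=; lia.
  by rewrite /=; lia.
have hi a : s a <= a.
  rewrite -{2}[a](permK s); apply: lo => b c bc.
  rewrite ltnNge leq_eqVlt val_eqE (inj_eq perm_inj) -val_eqE gtn_eqF //=.
  by apply/negP => /mono; rewrite !permKV ltnNge (ltnW bc).
by apply/permP => a; apply: val_inj; apply/eqP; rewrite perm1 eqn_leq hi lo.
Qed.

Lemma adj_tpermE (j : 'I_m.-1) a : adj_tperm j a = swap j a :> nat.
Proof.
rewrite /adj_tperm /swap permE /= -!val_eqE /=.
by case: eqP => // _; case: eqP.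
Qed.

Lemma inv_adj (j : 'I_m.-1) : inv (adj_tperm j) = 1.
Proof.
rewrite /inv (_ : inversions _ =
  [set (Ordinal (adj_lo_proof j), Ordinal (adj_hi_proof j))]) ?cards1 //.
apply/setP => -[a b]; rewrite !inE /= xpair_eqE -!val_eqE /= !adj_tpermE /swap.
by move: (nat_of_ord a) (nat_of_ord b) => x y; do !case: eqP; lia.
Qed.

Lemma inv_ascent (j : 'I_m.-1) s a b : a = j :> nat -> b = j.+1 :> nat ->
  (s^-1)%g a < (s^-1)%g b -> inv (s * adj_tperm j)%g = (inv s).+1.
Proof.
move=> ea eb lt; rewrite invM ?inv_adj // => c d cd sdc.
rewrite !adj_tpermE /swap.
have ne : ~ (s d = j :> nat /\ s c = j.+1 :> nat).
  case=> ed ec.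
  have dE : d = (s^-1)%g a.
    by apply: (canRL (permK s)); apply: val_inj; rewrite /= ed ea.
  have cE : c = (s^-1)%g b.
    by apply: (canRL (permK s)); apply: val_inj; rewrite /= ec eb.
  by move: cd; rewrite dE cE => /(ltn_trans lt); rewrite ltnn.
by move: (nat_of_ord (s c)) (nat_of_ord (s d)) sdc ne => x y; do !case: eqP; lia.
Qed.

Lemma adj_tpermK (j : 'I_m.-1) : (adj_tperm j * adj_tperm j = 1)%g.
Proof. exact: tperm2. Qed.

Lemma inv_descent (j : 'I_m.-1) s a b : a = j :> nat -> b = j.+1 :> nat ->
  (s^-1)%g b < (s^-1)%g a -> inv s = (inv (s * adj_tperm j)%g).+1.
Proof.
move=> ea eb lt; rewrite -(inv_ascent (j := j) (a := a) (b := b)) //.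
  by rewrite -mulgA adj_tpermK mulg1.
rewrite invMg !permM tpermV.
have -> : adj_tperm j a = b by apply: val_inj; rewrite /= adj_tpermE /swap ea eqxx eb.
have -> // : adj_tperm j b = a.
by apply: val_inj; rewrite /= adj_tpermE /swap eb eqxx ea; case: eqP => //; lia.
Qed.

Lemma inv_descentr (j : 'I_m.-1) s a b : a = j :> nat -> b = j.+1 :> nat ->
  s b < s a -> inv s = (inv (adj_tperm j * s)%g).+1.
Proof.
move=> ea eb lt.
have tE : (forall c, adj_tperm j c = swap j c :> nat) by exact: adj_tpermE.
have ta : adj_tperm j a = b by apply: val_inj; rewrite /= adj_tpermE /swap ea eqxx eb.
have tb : adj_tperm j b = a.
  by apply: val_inj; rewrite /= adj_tpermE /swap eb eqxx ea; case: eqP => //; lia.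
have -> : inv s = inv (adj_tperm j * (adj_tperm j * s))%g.
  by rewrite mulgA adj_tpermK mul1g.
rewrite (@invM (adj_tperm j * s)%g) ?inv_adj ?addn1 // => c d cd.
rewrite !adj_tpermE /swap => lt'; rewrite !permM.
have [ec ed] : c = j :> nat /\ d = j.+1 :> nat.
  by move: (nat_of_ord c) (nat_of_ord d) cd lt' => x y; do !case: eqP; lia.
have -> : c = a by apply: val_inj; rewrite /= ec ea.
have -> : d = b by apply: val_inj; rewrite /= ed eb.
by rewrite ta tb ta.
Qed.

Lemma inv_adj_cases (j : 'I_m.-1) s :
  inv s = (inv (s * adj_tperm j)%g).+1 /\
    (s^-1)%g (Ordinal (adj_hi_proof j)) < (s^-1)%g (Ordinal (adj_lo_proof j)) \/
  inv (s * adj_tperm j)%g = (inv s).+1.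
Proof.
case: (ltngtP ((s^-1)%g (Ordinal (adj_lo_proof j)))
              ((s^-1)%g (Ordinal (adj_hi_proof j)))) => [lt|lt|/val_inj/perm_inj].
- by right; apply: inv_ascent lt.
- by left; split=> //; apply: inv_descent lt.
- by move/(congr1 val) => /=; lia.
Qed.

Lemma inv_word (w : seq 'I_m.-1) : inv (word_perm w) <= size w.
Proof.
elim: w => [|j w IH] /=; first by rewrite inv1.
by have [[]|] := inv_adj_cases j (word_perm w); lia.
Qed.

(** A permutation other than the identity has a descent, and removing it lowers the number
    of inversions by one. *)
Lemma exists_word s : exists2 w, word_perm w = s & size w = inv s.
Proof.
have [k] := ubnP (inv s); elim: k s => // k IH s sk.
have [s0|s0] := posnP (inv s); first by exists [::]; rewrite ?s0 // (inv_eq0 s0).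
have [[j jP]|no] := EM (exists j : 'I_m.-1, inv s = (inv (s * adj_tperm j)%g).+1).
  have [|w wE wS] := IH (s * adj_tperm j)%g; first by lia.
  by exists (j :: w); rewrite /= ?wE ?wS // -mulgA adj_tpermK mulg1.
suff : inv (s^-1)%g = 0.
  by move/inv_eq0/(congr1 invg); rewrite invgK invg1 => s1; rewrite s1 inv1 in s0.
have step a b : b = a.+1 :> nat -> (s^-1)%g a < (s^-1)%g b.
  move=> ba; have jm : a < m.-1 by rewrite ltn_predRL -ba.
  rewrite ltnNge; apply/negP => le; case: no; exists (Ordinal jm).
  apply: (inv_descent (a := a) (b := b)) => //.
  by rewrite ltn_perm le -val_eqE /= ba; lia.
apply/eqP; rewrite cards_eq0; apply/eqP/setP => -[a b]; rewrite !inE /=.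
apply/negP => /andP [ab]; apply/negP; rewrite -leqNgt.
have [d] := ubnP (b - a); elim: d b ab => // d IHd b ab bd.
have pm : b.-1 < m by apply: leq_ltn_trans (leq_pred _) (ltn_ord b).
have st : (s^-1)%g (Ordinal pm) < (s^-1)%g b by apply: step => /=; lia.
have [e|ne] := eqVneq (a : nat) b.-1.
  by rewrite (_ : a = Ordinal pm); [apply: ltnW st | apply: val_inj].
by apply: leq_trans (ltnW st); apply: IHd => /=; lia.
Qed.

Lemma is_reducedP s w : is_reduced s w -> word_perm w = s /\ size w = inv s.
Proof.
case=> ws min; split=> //; have [w' w's w'S] := exists_word s.
by apply/eqP; rewrite eqn_leq -{1}w'S min //= -ws inv_word.
Qed.

(** Matsumoto's theorem.  If the first letters j and i of the two words are different, the
    permutation is divisible by the longest element of the dihedral group they generate, and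
    both words are compared with words beginning with the two sides of the braid relation. *)
Lemma reduced_beq (u v : seq 'I_m.-1) : word_perm u = word_perm v ->
  size u = inv (word_perm u) -> size v = inv (word_perm v) ->
  beq (map val u) (map val v).
Proof.
have [k] := ubnP (size u); elim: k u v => // k IH [|j u] [|i v] uk // e us vs.
- by rewrite -e -us in vs.
- by rewrite e -vs in us.
set s := word_perm (j :: u) in e us.
have tl l w : size (l :: w) = inv (word_perm (l :: w)) ->
    [/\ size w = inv (word_perm w), word_perm w = (word_perm (l :: w) * adj_tperm l)%g &
    ((word_perm (l :: w))^-1)%g (Ordinal (adj_hi_proof l)) <
    ((word_perm (l :: w))^-1)%g (Ordinal (adj_lo_proof l))].
  move=> ws; have wE : word_perm w = (word_perm (l :: w) * adj_tperm l)%g.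
    by rewrite /= -mulgA adj_tpermK mulg1.
  have := inv_word w; have := inv_adj_cases l (word_perm (l :: w)).
  by rewrite -wE; move: ws => /= <-; case=> [[[ws lt]]|]; [split|lia].
have [us' uE ud] := tl _ _ us; have [vs' vE vd] := tl _ _ vs.
rewrite -/s in uE ud; rewrite -e -/s in vE vd.
have [ji|ji] := eqVneq j i.
  move: vE; rewrite -ji -uE => vE /=; apply: beq_cons; apply: IH => //.
have ji' : val j <> val i by move=> eji; case/eqP: ji; apply: val_inj.
have usz : inv s = (inv (s * adj_tperm j)%g).+1 by exact: inv_descent ud.
have vsz : inv s = (inv (s * adj_tperm i)%g).+1 by exact: inv_descent vd.
have st1 l (x : 'I_m) : ((s * adj_tperm l)^-1)%g x = (s^-1)%g (adj_tperm l x).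
  by rewrite invMg permM tpermV.
have uk' : size u < k by [].
have vk' : size v < k.
  suff -> : size v = size u by [].
  by rewrite vs' us' uE vE; apply/eqP; rewrite -eqSS -usz -vsz.
have [fji|fji] := boolP (far (val j) (val i)).
  pose s' := (s * adj_tperm j * adj_tperm i)%g.
  have [w ws' wS] := exists_word s'.
  have C : (adj_tperm j * adj_tperm i = adj_tperm i * adj_tperm j)%g.
    apply/permP => a; apply: val_inj; rewrite /= !permM !adj_tpermE.
    by apply: swap_far; rewrite far_sym.
  have us2 : inv (s * adj_tperm j)%g = (inv s').+1.
    apply: (inv_descent (a := Ordinal (adj_lo_proof i)) (b := Ordinal (adj_hi_proof i)));
      [by []|by []|rewrite !st1].
    rewrite (_ : adj_tperm j (Ordinal (adj_hi_proof i)) = Ordinal (adj_hi_proof i)); last first.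
      apply: val_inj; rewrite /= adj_tpermE /swap /=.
      by move: fji; rewrite /far /=; do !case: eqP => /=; lia.
    rewrite (_ : adj_tperm j _ = Ordinal (adj_lo_proof i)); first exact: vd.
    apply: val_inj; rewrite /= adj_tpermE /swap /=.
    by move: fji; rewrite /far /=; do !case: eqP => /=; lia.
  have wi : word_perm (i :: w) = word_perm u.
    by rewrite uE [LHS]/= ws' /s' -(mulgA (s * adj_tperm j)%g) adj_tpermK mulg1.
  have wj : word_perm (j :: w) = word_perm v.
    by rewrite vE [LHS]/= ws' /s' -(mulgA s) C mulgA -(mulgA (s * adj_tperm i)%g) adj_tpermK mulg1.
  have e1 : beq (map val u) (map val (i :: w)).
    by apply: IH; rewrite ?wi // [LHS]/= wS -us2 -uE.
  have e2 : beq (map val v) (map val (j :: w)).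
    apply: IH; rewrite ?wj // [LHS]/= wS -us2 vE.
    by apply/eqP; rewrite -eqSS -usz -vsz.
  by rewrite /= e1 e2 /=; apply: beq_far.
(* The letters are adjacent: the permutation has three more inversions than the one obtained
   by stripping the longest element of their dihedral group. *)
have [w [wi wj wS]] : exists w, [/\ word_perm [:: i, j & w] = word_perm u,
    word_perm [:: j, i & w] = word_perm v & (size w).+3 = inv s].
  have adjC : (adj_tperm j * adj_tperm i * adj_tperm j =
               adj_tperm i * adj_tperm j * adj_tperm i)%g.
    apply/permP => a; apply: val_inj; rewrite /= !permM !adj_tpermE.
    by apply: swap_adj; move: fji ji'; rewrite /far /adj /=; lia.
  have st2 l l' (x : 'I_m) : ((s * adj_tperm l * adj_tperm l')^-1)%g x =
      (s^-1)%g (adj_tperm l (adj_tperm l' x)).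
    by rewrite !invgM !permM !tpermV.
  have inv3 : inv s = (inv (s * adj_tperm j * adj_tperm i * adj_tperm j)%g).+3.
    have tE (l : 'I_m.-1) (x y : 'I_m) : swap l x = y -> adj_tperm l x = y.
      by move=> xy; apply: val_inj; rewrite /= adj_tpermE xy.
    have d2 : inv (s * adj_tperm j)%g = (inv (s * adj_tperm j * adj_tperm i)%g).+1.
      apply: (inv_descent (a := Ordinal (adj_lo_proof i)) (b := Ordinal (adj_hi_proof i))) => //.
      rewrite !st1; case: (ltngtP (val j) (val i)) => [lt|lt|//].
        have ei : val i = (val j).+1 by move: fji ji' lt; rewrite /far /=; lia.
        have eo : Ordinal (adj_hi_proof j) = Ordinal (adj_lo_proof i) by apply: val_inj.
        rewrite (tE _ _ (Ordinal (adj_hi_proof i))); last first.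
          by rewrite /swap /= -/(val i) ei; do !case: eqP => /=; lia.
        rewrite (tE _ _ (Ordinal (adj_lo_proof j))); last first.
          by rewrite /swap /= -/(val i) ei; do !case: eqP => /=; lia.
        by apply: ltn_trans ud; rewrite eo.
      have ej : val j = (val i).+1 by move: fji ji' lt; rewrite /far /=; lia.
      have eo : Ordinal (adj_hi_proof i) = Ordinal (adj_lo_proof j) by apply: val_inj.
      rewrite (tE _ _ (Ordinal (adj_hi_proof j))); last first.
        by rewrite /swap /= -/(val j) ej; do !case: eqP => /=; lia.
      rewrite (tE _ _ (Ordinal (adj_lo_proof i))); last first.
        by rewrite /swap /= -/(val j) ej; do !case: eqP => /=; lia.
      by apply: ltn_trans vd; rewrite eo.
    rewrite usz d2; congr _.+2.
    apply: (inv_descent (a := Ordinal (adj_lo_proof j)) (b := Ordinal (adj_hi_proof j))) => //.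
    have swE (x : 'I_m) (y : 'I_m) : swap j (swap i x) = y ->
        adj_tperm j (adj_tperm i x) = y.
      by move=> xy; apply: tE; rewrite adj_tpermE.
    rewrite !st2 (swE _ (Ordinal (adj_hi_proof i))); last first.
      by move: fji ji'; rewrite /far /swap /=; do !case: eqP => /=; lia.
    rewrite (swE _ (Ordinal (adj_lo_proof i))) //.
    by move: fji ji'; rewrite /far /swap /=; do !case: eqP => /=; lia.
  have [w ws' wS] := exists_word (s * adj_tperm j * adj_tperm i * adj_tperm j)%g.
  exists w; split.
  - rewrite uE [LHS]/= ws' -(mulgA _ (adj_tperm j) (adj_tperm j)) adj_tpermK mulg1.
    by rewrite -mulgA adj_tpermK mulg1.
  - rewrite vE [LHS]/= ws'.
    have -> : (s * adj_tperm j * adj_tperm i * adj_tperm j =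
               s * adj_tperm i * adj_tperm j * adj_tperm i)%g.
      by rewrite -!(mulgA s) adjC.
    rewrite -(mulgA _ (adj_tperm i) (adj_tperm i)) adj_tpermK mulg1.
    by rewrite -mulgA adj_tpermK mulg1.
  - by rewrite wS -inv3.
have aji : adj (val j) (val i) by move: fji ji'; rewrite /far /adj /=; lia.
have e1 : beq (map val u) (map val [:: i, j & w]).
  apply: IH; rewrite ?wi //; apply/eqP; rewrite -eqSS uE -usz -wS //.
have e2 : beq (map val v) (map val [:: j, i & w]).
  apply: IH; rewrite ?wj //; apply/eqP; rewrite -eqSS vE -vsz -wS //.
by rewrite /= e1 e2 /=; apply: beq_adj.
Qed.
End Inversions.

(** * Permutation braids of shuffles *)

(** The action of a word of adjacent transpositions on nat; it does not depend on the number
    of strands. *)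
Definition wact (w : seq nat) (x : nat) : nat := foldr swap x w.

Lemma wact_cat u v x : wact (u ++ v) x = wact u (wact v x).
Proof. exact: foldr_cat. Qed.

Lemma wact_word m (w : seq 'I_m.-1) (x : 'I_m) :
  word_perm w x = wact (map val w) x :> nat.
Proof.
by elim: w x => [|j w IH] x /=; rewrite ?perm1 // permM adj_tpermE IH.
Qed.

(** Reduced words, with letters in nat. *)
Definition word_of m (s : 'S_m) (w : seq nat) : Prop :=
  [/\ letters m w, forall x : 'I_m, s x = wact w x :> nat & size w = inv s].

Lemma word_ofP m (s : 'S_m) w : word_of s w ->
  exists2 u : seq 'I_m.-1, w = map val u & word_perm u = s.
Proof.
case=> /lettersP [u ->] us _; exists u => //.
by apply/permP => x; apply: val_inj; rewrite /= wact_word us.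
Qed.

Lemma word_of_reduced m (s : 'S_m) : word_of s (map val (reduced_word s)).
Proof.
have [ws wS] := is_reducedP (svalP (cid (reduced_exists s))).
split=> [|x|]; last by rewrite size_map.
- by apply/allP => _ /mapP [j _ ->]; rewrite -ltn_predRL ltn_ord.
- by rewrite -wact_word ws.
Qed.

Lemma odd_inv m (s : 'S_m) : odd_perm s = odd (inv s).
Proof.
have [w <- <-] := exists_word s; elim: w => [|j w IH] /=; first by rewrite odd_perm1.
rewrite odd_permM IH odd_tperm -val_eqE /= (_ : _ != _); first by rewrite addbT.
by rewrite neq_ltn ltnSn.
Qed.

Section PermBraid.
Variable N : nat.
Local Notation ev := (positive_braid N).

Lemma perm_braid_word off m (s : 'S_m) w : off + m <= N -> word_of s w ->
  perm_braid N off s = ev (map (addn off) w).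
Proof.
move=> mN ws; have ws' := word_of_reduced s.
have -> : perm_braid N off s = ev (map (addn off) (map val (reduced_word s))).
  rewrite /perm_braid; elim: (reduced_word s) => //= j u ->.
  by [].
apply: ev_beq.
  case: ws' => uN _ _; apply/allP => _ /mapP [j /(allP uN) jm ->].
  by move: jm; lia.
apply: beq_shift; case: (ws) (ws') => _ _ wS [_ _ wS'].
have [u uE us] := word_ofP ws; have [u' uE' us'] := word_ofP ws'.
rewrite uE size_map in wS; rewrite uE' size_map in wS'; rewrite uE uE'.
by apply: reduced_beq; rewrite ?us ?us'.
Qed.

Lemma is_positive_perm_braid off m (s : 'S_m) : off + m <= N -> 
  exists2 w, letters N w & perm_braid N off s = ev w /\ size w = inv s.
Proof.
move=> mN; have := word_of_reduced s.
set w := map val _ => ws; exists (map (addn off) w); last first.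
  by rewrite size_map (perm_braid_word mN ws); case: ws.
case: ws => uN _ _; apply/allP => _ /mapP [j /(allP uN) jm ->].
by move: jm; lia.
Qed.

End PermBraid.

Section Block.
Variables p q : nat.
Local Notation m := (p + q).
Implicit Types (s : 'S_p) (t : 'S_q).

Definition block_fun s t (x : 'I_m) : 'I_m :=
  match split x with inl i => lshift q (s i) | inr i => rshift p (t i) end.

Lemma block_fun_inj s t : injective (block_fun s t).
Proof.
apply: (can_inj (g := block_fun s^-1%g t^-1%g)) => x; rewrite /block_fun.
case: (splitP x) => i xi.
  rewrite -[lshift q (s i)]/(unsplit (inl (s i))) unsplitK permK.
  by apply: val_inj.
rewrite -[rshift p (t i)]/(unsplit (inr (t i))) unsplitK permK.
by apply: val_inj.
Qed.

Definition block s t : 'S_m := perm (@block_fun_inj s t).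

Lemma block_lshift s t i : block s t (lshift q i) = lshift q (s i).
Proof. by rewrite permE /block_fun -[lshift q i]/(unsplit (inl i)) unsplitK. Qed.

Lemma block_rshift s t i : block s t (rshift p i) = rshift p (t i).
Proof. by rewrite permE /block_fun -[rshift p i]/(unsplit (inr i)) unsplitK. Qed.

Lemma blockM s t s' t' : (block s t * block s' t')%g = block (s * s')%g (t * t')%g.
Proof.
apply/permP => x; rewrite permM -[x]splitK.
by case: (split x) => i; rewrite /= ?block_lshift ?block_rshift permM.
Qed.

Lemma block1 : block 1 1 = 1%g.
Proof.
apply/permP => x; rewrite perm1 -[x]splitK.
by case: (split x) => i; rewrite /= ?block_lshift ?block_rshift perm1.
Qed.

Lemma blockV s t : (block s t)^-1%g = block s^-1 t^-1.
Proof.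
by apply: (mulgI (block s t)); rewrite mulgV blockM !mulgV block1.
Qed.

Lemma inv_block s t : inv (block s t) = inv s + inv t.
Proof.
pose fl (ab : 'I_p * 'I_p) := (lshift q ab.1, lshift q ab.2).
pose fr (ab : 'I_q * 'I_q) := (rshift p ab.1, rshift p ab.2).
have fl_inj : injective fl by move=> [a b] [c d] [] /val_inj -> /val_inj ->.
have fr_inj : injective fr by move=> [a b] [c d] [] /addnI/val_inj -> /addnI/val_inj ->.
have E : inversions (block s t) = fl @: inversions s :|: fr @: inversions t.
  apply/setP => -[a b]; apply/idP/idP; last first.
    rewrite inE => /orP [] /imsetP [[c d]]; rewrite inE /= => /andP [cd e] [-> ->];
    by rewrite inE /= ?block_lshift ?block_rshift /= ?ltn_add2l cd e.
  rewrite -[a]splitK -[b]splitK inE /=.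
  case: (split a) (split b) => c [] d /=; rewrite ?block_lshift ?block_rshift /=.
  - by move=> e; rewrite inE; apply/orP; left; apply/imsetP; exists (c, d); rewrite ?inE.
  - by have := ltn_ord c; have := ltn_ord (s c); lia.
  - by have := ltn_ord d; have := ltn_ord (s d); lia.
  - rewrite !ltn_add2l => e; rewrite inE; apply/orP; right.
    by apply/imsetP; exists (c, d); rewrite ?inE.
rewrite /inv E cardsU !card_imset // (_ : _ :&: _ = set0) ?cards0 ?subn0 //.
apply/setP => -[a b]; rewrite !inE; apply/negP => /andP [].
case/imsetP=> -[c d] _ [-> _] /imsetP [[c' d'] _ [e _]].
by have := ltn_ord c; lia.
Qed.

Lemma wact_shift k v x : wact (map (addn k) v) x =
  if x < k then x else k + wact v (x - k).
Proof.
elim: v => [|j v IH] /=; first by case: ltnP => //; lia.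
rewrite IH; case: ltnP => kx; first by rewrite swapD //; lia.
by rewrite /swap -addnS !eqn_add2l -!(fun_if (addn k)).
Qed.

Lemma wact_small k v x : letters k v -> k <= x -> wact v x = x.
Proof.
by elim: v => //= j v IH /andP [jk /IH e] kx; rewrite e // swapD //; lia.
Qed.

Lemma word_of_block s t u v : word_of s u -> word_of t v ->
  word_of (block s t) (u ++ map (addn p) v).
Proof.
move=> [ul us uS] [vl vt vS]; split=> [|x|].
- rewrite letters_cat; apply/andP; split; first by apply/allP => i /(allP ul); lia.
  by apply/allP => _ /mapP [i /(allP vl) iq ->]; lia.
- rewrite wact_cat wact_shift -[x]splitK; case: (split x) => i /=.
    by rewrite block_lshift /= ltn_ord us.
  rewrite block_rshift /= ltnNge leq_addr /= addKn (wact_small ul) ?leq_addr //.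
  by rewrite vt.
- by rewrite size_cat size_map uS vS inv_block.
Qed.

Lemma shuffle_ascent (g : 'S_m) (a b : 'I_m) : is_shuffle g -> a < b ->
  (b < p) || (p <= a) -> g a < g b.
Proof. by move=> /forallP /(_ a) /forallP /(_ b) /implyP + ab bl; apply; rewrite ab. Qed.

(** A shuffle undoes no inversion inside the two blocks. *)
Lemma inv_shuffle_block (g : 'S_m) s t : is_shuffle g ->
  inv (block s t * g)%g = inv g + (inv s + inv t).
Proof.
move=> gS; rewrite invM ?inv_block // => a b.
rewrite -[a]splitK -[b]splitK.
case: (split a) (split b) => c [] d /=; rewrite ?block_lshift ?block_rshift /= => cd dc.
- by apply: shuffle_ascent => //=; rewrite ltn_ord.
- by move: dc; have := ltn_ord (s c); lia.
- by move: cd; have := ltn_ord d; lia.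
- by apply: shuffle_ascent => //=; rewrite leq_addr orbT.
Qed.

(** The lengths add up, so that reduced words of the factors concatenate to a reduced word. *)
Lemma perm_braid_shuffle_block N off (g : 'S_m) s t : off + m <= N -> is_shuffle g ->
  perm_braid N off (block s t * g)%g =
  (perm_braid N off g * (perm_braid N off s * perm_braid N (off + p) t))%g.
Proof.
move=> mN gS; have [[ws wt] wg] := (word_of_reduced s, word_of_reduced t, word_of_reduced g).
have wb := word_of_block ws wt.
have w : word_of (block s t * g)%g (map val (reduced_word g) ++
   (map val (reduced_word s) ++ map (addn p) (map val (reduced_word t)))).
  case: wg wb => gl gw gs [bl bw bs]; split=> [|x|].
  - by rewrite letters_cat gl.
  - by rewrite wact_cat -bw -gw permM.
  - by rewrite size_cat gs bs inv_shuffle_block // inv_block.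
have pN : off + p <= N by lia.
have qN : off + p + q <= N by lia.
rewrite (perm_braid_word mN w) (perm_braid_word mN wg).
rewrite (perm_braid_word pN ws) (perm_braid_word qN wt) -!ev_cat.
rewrite !map_cat -!map_comp; congr (positive_braid _ (_ ++ (_ ++ _))).
by apply: eq_map => j /=; rewrite addnA.
Qed.

Lemma shuffle_block_inj (g g' : 'S_m) s t s' t' : is_shuffle g -> is_shuffle g' ->
  (block s t * g = block s' t' * g')%g -> [/\ g = g', s = s' & t = t'].
Proof.
move=> gS gS' e; have e1 : g = (block (s^-1 * s') (t^-1 * t') * g')%g.
  by rewrite -blockM -mulgA -e -blockV mulKg.
have e2 : g' = (block (s'^-1 * s) (t'^-1 * t) * g)%g.
  by rewrite -blockM -mulgA e -blockV mulKg.
have i1 := inv_shuffle_block (s^-1 * s')%g (t^-1 * t')%g gS'; rewrite -e1 in i1.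
have i2 := inv_shuffle_block (s'^-1 * s)%g (t'^-1 * t)%g gS; rewrite -e2 in i2.
have /inv_eq0 s1 : inv (s^-1 * s')%g = 0 by lia.
have /inv_eq0 t1 : inv (t^-1 * t')%g = 0 by lia.
have ss' : s = s' by apply: (mulgI s^-1%g); rewrite s1 mulVg.
have tt' : t = t' by apply: (mulgI t^-1%g); rewrite t1 mulVg.
by split=> //; rewrite e1 s1 t1 block1 mul1g.
Qed.

Lemma adj_block (j : 'I_m.-1) : j.+1 < p \/ p <= j ->
  exists s t, adj_tperm j = block s t.
Proof.
case=> jp.
  have jp' : j < p.-1 by rewrite ltn_predRL.
  exists (adj_tperm (Ordinal jp')), 1%g; apply/permP => x; apply: val_inj.
  rewrite /= adj_tpermE -[x]splitK; case: (split x) => i /=.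
    by rewrite block_lshift /= adj_tpermE.
  by rewrite block_rshift perm1 /= /swap; do !case: eqP => /=; lia.
have jq : j - p < q.-1 by have := ltn_ord j; lia.
exists 1%g, (adj_tperm (Ordinal jq)); apply/permP => x; apply: val_inj.
rewrite /= adj_tpermE -[x]splitK; case: (split x) => i /=.
  rewrite block_lshift perm1 /= /swap; have := ltn_ord i.
  by do !case: eqP => /=; lia.
by rewrite block_rshift /= adj_tpermE /= /swap; do !case: eqP => /=; lia.
Qed.

(** Shuffles represent the cosets of the parabolic subgroup of the two blocks: a word with
    the fewest inversions in its coset increases on each block. *)
Lemma exists_shuffle_block (w : 'S_m) : exists g s t,
  is_shuffle g /\ w = (block s t * g)%g.
Proof.
pose P := fun st : 'S_p * 'S_q => inv (block st.1 st.2 * w)%g.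
pose st := [arg min_(st < (1, 1)%g : 'S_p * 'S_q) P st].
have min (st' : 'S_p * 'S_q) : P st <= P st'.
  by rewrite /st; case: arg_minnP => // i _ /(_ st'); apply.
exists (block st.1 st.2 * w)%g, (st.1^-1)%g, (st.2^-1)%g.
rewrite -blockV mulKg; split=> //.
set g := (_ * w)%g.
have step (a b : 'I_m) : b = a.+1 :> nat -> (b < p) || (p <= a) -> g a < g b.
  move=> ba bl; have jm : a < m.-1 by rewrite ltn_predRL -ba.
  rewrite ltnNge; apply/negP => le.
  have lt : g b < g a by rewrite ltn_perm le -val_eqE /= ba; lia.
  have [|s [t e]] := @adj_block (Ordinal jm).
    by move: bl => /= /orP [?|?]; [left|right] => //; rewrite -ba.
  have := inv_descentr (j := Ordinal jm) (s := g) (a := a) (b := b) erefl ba lt.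
  rewrite e /g mulgA blockM => eP.
  by have := min (s * st.1, t * st.2)%g; rewrite /P /= eP ltnn.
apply/forallP => a; apply/forallP => b; apply/implyP => /andP [].
have [d] := ubnP (b - a); elim: d b => // d IHd b bd ab bl.
have pm : b.-1 < m by apply: leq_ltn_trans (leq_pred _) (ltn_ord b).
have st' : g (Ordinal pm) < g b by apply: step => /=; lia.
have [e|ne] := eqVneq (a : nat) b.-1.
  by rewrite (_ : a = Ordinal pm) //; apply: val_inj.
by apply: ltn_trans st'; apply: IHd => /=; lia.
Qed.

Lemma big_shuffle_block (R : Type) (idx : R) (op : Monoid.com_law idx) (F : 'S_m -> R) :
  \big[op/idx]_w F w =
  \big[op/idx]_(g | is_shuffle g) \big[op/idx]_s \big[op/idx]_t F (block s t * g)%g.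
Proof.
pose A := [set x : 'S_m * ('S_p * 'S_q) | is_shuffle x.1].
pose h (x : 'S_m * ('S_p * 'S_q)) := (block x.2.1 x.2.2 * x.1)%g.
have hA : h @: A = setT.
  apply/setP => w; rewrite inE; have [g [s [t [gS ->]]]] := exists_shuffle_block w.
  by apply/imsetP; exists (g, (s, t)); rewrite ?inE.
have h_inj : {in A &, injective h}.
  move=> [g [s t]] [g' [s' t']]; rewrite !inE /= => gS gS'.
  by rewrite /h /= => /(shuffle_block_inj gS gS') [-> -> ->].
transitivity (\big[op/idx]_(w in h @: A) F w).
  by apply: eq_bigl => w; rewrite hA inE.
rewrite big_imset //=.
under [RHS]eq_bigr do rewrite pair_big /=.
rewrite pair_big_dep /=; apply: eq_bigl => -[g st]; by rewrite inE andbT.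
Qed.

End Block.

Section HalfTwist.

Definition rev_perm m : 'S_m := perm (@rev_ord_inj m).

Lemma rev_permE m (x : 'I_m) : rev_perm m x = m - x.+1 :> nat.
Proof. by rewrite permE. Qed.

Lemma inv_rev_max m (s : 'S_m) : inv s <= inv (rev_perm m).
Proof.
apply/subset_leq_card/subsetP => -[a b]; rewrite !inE /= => /andP [ab _].
by rewrite ab !rev_permE; have := ltn_ord b; lia.
Qed.

(** Only the order-reversing permutation inverts all pairs. *)
Lemma inv_rev_eq m (s : 'S_m) : inv s = inv (rev_perm m) -> s = rev_perm m.
Proof.
move=> e; have sub : inversions s \subset inversions (rev_perm m).
  apply/subsetP => -[a b]; rewrite !inE /= => /andP [ab _].
  by rewrite ab !rev_permE; have := ltn_ord b; lia.
have E : inversions s = inversions (rev_perm m).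
  by apply/eqP; rewrite eqEcard sub; apply/eq_leq/esym.
have K : (rev_perm m * rev_perm m = 1)%g.
  by apply/permP => x; rewrite permM perm1 !permE rev_ordK.
suff /inv_eq0 s1 : inv (s * rev_perm m)%g = 0.
  by apply: (mulIg (rev_perm m)); rewrite s1 K.
apply/eqP; rewrite cards_eq0; apply/eqP/setP => -[a b]; rewrite !inE !permM !rev_permE /=.
apply/negP => /andP [ab]; move/setP/(_ (a, b)): E; rewrite !inE /= ab /= !rev_permE.
have := ltn_ord b; have := ltn_ord (s a); have := ltn_ord (s b).
by case: ltnP; lia.
Qed.

Lemma inv_rev m : inv (rev_perm m) = 'C(m, 2).
Proof.
rewrite -bin2_sum big_mkord.
have -> : inv (rev_perm m) = \sum_(ab : 'I_m * 'I_m | ab.1 < ab.2) 1.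
  rewrite sum1dep_card; apply: eq_card => -[a b]; rewrite !inE /= !rev_permE.
  by case: (ltnP a b) => //= ab; have := ltn_ord b; lia.
rewrite -(pair_big_dep predT (fun a b : 'I_m => a < b) (fun _ _ => 1)) /=.
rewrite (exchange_big_dep predT) //=; apply: eq_bigr => b _.
by rewrite -(big_ord_widen m (fun _ => 1) (ltnW (ltn_ord b))) sum1_card card_ord.
Qed.

Lemma wact_drun off k x : wact (drun off k) x =
  if x == off then off + k else if off < x <= off + k then x.-1 else x.
Proof.
elim: k => [|k IH].
  by rewrite /= addn0; case: eqP => [->|_] //; case: ifP => //; lia.
rewrite drunS /= IH; have [e|x0] := eqVneq x off; first by rewrite swapL addnS.
have [e|x1] := eqVneq x (off + k).+1.
  by rewrite e ltnn andbF swapR ltnS leq_addr addnS leqnn.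
have -> : (off < x <= off + k.+1) = (off < x <= off + k) by lia.
by case: ifP => xk; rewrite swapD //; lia.
Qed.

Lemma wact_half_twist off m x : wact (half_twist off m) x =
  if off <= x < off + m then off + m - (x - off).+1 else x.
Proof.
elim: m off x => [|m IH] off x /=; first by case: ifP; lia.
rewrite wact_cat IH wact_drun.
by case: (boolP (off < x < off.+1 + m)) => xm; do !(case: ifP => ?); lia.
Qed.

Lemma size_half_twist off m : size (half_twist off m) = 'C(m, 2).
Proof.
elim: m off => //= m IH off.
by rewrite size_cat IH size_rev size_iota binS bin1 addnC.
Qed.

Lemma half_twist_shift off k m : half_twist (k + off) m = map (addn k) (half_twist off m).
Proof.
elim: m off => //= m IH off.
by rewrite map_cat -IH addnS /drun map_rev iotaDl.
Qed.

Lemma word_of_half_twist m : word_of (rev_perm m) (half_twist 0 m).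
Proof.
split=> [|x|].
- by apply/allP => i /mem_half_twist.
- by rewrite rev_permE wact_half_twist /= ltn_ord; lia.
- by rewrite size_half_twist inv_rev.
Qed.

Lemma perm_braid_rev N off m : off + m <= N ->
  perm_braid N off (rev_perm m) = positive_braid N (half_twist off m).
Proof.
move=> mN; rewrite (perm_braid_word mN (word_of_half_twist m)).
by rewrite -half_twist_shift addn0.
Qed.

Variables (p q : nat).
Local Notation m := (p + q).

(** The shuffle that moves the last q points in front of the first p; its braid is the
    quotient of the half twist on all strands by the half twists on the two blocks. *)
Definition max_shuffle : 'S_m := (block (rev_perm p) (rev_perm q) * rev_perm m)%g.

Lemma rev_block_max : rev_perm m = (block (rev_perm p) (rev_perm q) * max_shuffle)%g.
Proof.
rewrite /max_shuffle mulgA blockM.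
have K l : (rev_perm l * rev_perm l = 1)%g.
  by apply/permP => x; rewrite permM perm1 !permE rev_ordK.
by rewrite !K block1 mul1g.
Qed.

Lemma max_shuffle_shuffle : is_shuffle max_shuffle.
Proof.
apply/forallP => a; apply/forallP => b; apply/implyP => /andP [].
rewrite /max_shuffle !permM !rev_permE.
rewrite -[a]splitK -[b]splitK.
by case: (split a) (split b) => c [] d /=;
  rewrite ?block_lshift ?block_rshift /= ?rev_permE;
  have := ltn_ord c; have := ltn_ord d; lia.
Qed.

(** Preceded by the reversals of the two blocks, a shuffle has this number of inversions, and
    only the reversal of all points reaches the maximum. *)
Lemma inv_shuffle (g : 'S_m) : is_shuffle g ->
  inv g + ('C(p, 2) + 'C(q, 2)) <= 'C(m, 2) /\
  (inv g + ('C(p, 2) + 'C(q, 2)) = 'C(m, 2) <-> g = max_shuffle).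
Proof.
move=> gS; rewrite -!inv_rev -inv_shuffle_block //; split; first exact: inv_rev_max.
split=> [/inv_rev_eq|->]; last by rewrite -rev_block_max.
by rewrite rev_block_max => /mulgI.
Qed.

Lemma perm_braid_max_shuffle N off : off + m <= N ->
  (perm_braid N off max_shuffle * (positive_braid N (half_twist off p) *
    positive_braid N (half_twist (off + p) q)) =
   positive_braid N (half_twist off m))%g.
Proof.
move=> mN; rewrite -!perm_braid_rev; [|lia..].
by rewrite rev_block_max perm_braid_shuffle_block // max_shuffle_shuffle.
Qed.

End HalfTwist.

(** * Coset representatives of the Artin group of type B *)

Section Words.
Local Open Scope group_scope.
Variables (I : choiceType) (R : word I -> word I -> Prop).

Lemma word_class_cons x w : word_class R (x :: w) = word_class R [:: x] * word_class R w.
Proof. by rewrite -[_ * _]/(pg_mul _ _) pg_mul_class. Qed.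

(** This turns statements on elements of a presented group into inductions on words. *)
Lemma word_class_eval w : word_class R w = word_eval (pg_gen R) w.
Proof.
elim: w => [//|[i b] w IH]; rewrite word_class_cons IH /=; congr (_ * _).
case: b => //=; apply: (mulgI (pg_gen R i)); rewrite mulgV -word_class_cons.
exact/word_classP/word_eq_cancel.
Qed.

End Words.

Section Cosets.
Variable n : nat.
Hypothesis n_gt0 : 0 < n.
Local Notation G := (braid_group n.+1).
Local Notation H := (artinB n).
Local Notation phi := (@artinB_embed n).

Local Open Scope group_scope.

Definition genB (j : nat) : H := if insub j is Some i then pg_gen _ (i : 'I_n) else 1.

Lemma genB_ord (i : 'I_n) : genB i = pg_gen _ i.
Proof. by rewrite /genB insubT // => p; congr pg_gen; apply: val_inj. Qed.

Lemma genB_rel (i j : 'I_n) l : coxeterB i j = l ->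
  word_eval (fun i : 'I_n => genB i) (alt_word i j l) =
  word_eval (fun i : 'I_n => genB i) (alt_word j i l).
Proof.
move=> <-; have := @artin_gen_rel _ (@coxeterB n) i j.
have E w : word_eval (fun i : 'I_n => genB i) w = word_eval (pg_gen (artin_rel (@coxeterB n))) w.
  by elim: w => //= -[a b] w ->; rewrite /= genB_ord.
by rewrite !E.
Qed.

Lemma genB_far i j : i < n -> j < n -> far i j -> commute (genB i) (genB j).
Proof.
move=> iN jN ij; have := @genB_rel (Ordinal iN) (Ordinal jN) 2; rewrite /= !mulg1; apply.
rewrite /coxeterB -val_eqE /=; move: ij; rewrite /far.
by do 3?case: ifP => //; lia.
Qed.

Lemma genB_adj i : i.+2 < n -> genB i * genB i.+1 * genB i = genB i.+1 * genB i * genB i.+1.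
Proof.
move=> iN; have iN1 : i < n by lia.
have iN2 : i.+1 < n by lia.
have := @genB_rel (Ordinal iN1) (Ordinal iN2) 3; rewrite /= !mulg1 !mulgA; apply.
rewrite /coxeterB -val_eqE /= eqxx.
by do 3?case: ifP => //; lia.
Qed.

Lemma genB_four i : i.+2 = n ->
  genB i * genB i.+1 * genB i * genB i.+1 = genB i.+1 * genB i * genB i.+1 * genB i.
Proof.
move=> iN; have iN1 : i < n by lia.
have iN2 : i.+1 < n by lia.
have := @genB_rel (Ordinal iN1) (Ordinal iN2) 4; rewrite /= !mulg1 !mulgA; apply.
rewrite /coxeterB -val_eqE /= eqxx.
by do 3?case: ifP => //; lia.
Qed.

(** The conjugates of tau_n by the sigma_i; the one at i is the element b for which
    sigma_i t_i = t_(i+1) phi(b). *)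
Fixpoint tau_conj (d : nat) : H :=
  if d is d'.+1 then
    genB (n.-1 - d) * tau_conj d' * (genB (n.-1 - d))^-1
  else genB n.-1.

Definition tau_at (i : nat) : H := tau_conj (n.-1 - i).

Lemma tau_at_last : tau_at n.-1 = genB n.-1.
Proof. by rewrite /tau_at subnn. Qed.

Lemma tau_at_rec i : i.+1 < n -> tau_at i = genB i * tau_at i.+1 * (genB i)^-1.
Proof.
move=> iN; rewrite /tau_at; have -> : n.-1 - i = (n.-1 - i.+1).+1 by lia.
rewrite /=; have -> // : n.-1 - (n.-1 - i.+1).+1 = i by lia.
Qed.

Lemma tau_at_ind (P : nat -> Prop) : P n.-1 -> (forall i, i.+1 < n -> P i.+1 -> P i) ->
  forall i, i < n -> P i.
Proof.
move=> Pn PS i iN; have [d] := ubnP (n.-1 - i); elim: d i iN => // d IH i iN dN.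
have [->//|ne] := eqVneq i n.-1.
by apply: PS; [lia | apply: IH; lia].
Qed.

Lemma tau_at_far_lo i k : i < n -> k.+1 < i -> commute (tau_at i) (genB k).
Proof.
move=> iN; move: i iN k; apply: tau_at_ind => [k kn|i iN IH k ki].
  by rewrite tau_at_last; apply: genB_far; rewrite /far; lia.
have C : commute (genB k) (genB i) by apply: genB_far; rewrite /far; lia.
rewrite tau_at_rec //; apply: commute_sym; apply: commuteM; last exact: commuteV.
by apply: commuteM => //; apply: commute_sym; apply: IH; lia.
Qed.

Lemma conj_mul (gT : groupType) (z x y : gT) :
  z * x * z^-1 * (z * y * z^-1) = z * (x * y) * z^-1.
Proof. by rewrite !mulgA mulgKV. Qed.

Lemma commute_conj (gT : groupType) (z x y : gT) : commute x y ->
  commute (z * x * z^-1) (z * y * z^-1).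
Proof. by move=> xy; rewrite /commute !conj_mul xy. Qed.

Lemma four_conj (gT : groupType) (z s b : gT) : s * b * s * b = b * s * b * s ->
  let s' := z * s * z^-1 in let b' := z * b * z^-1 in
  s' * b' * s' * b' = b' * s' * b' * s'.
Proof. by move=> sb /=; rewrite !conj_mul sb. Qed.

(** A braid relation says that st conjugates s to t. *)
Lemma conj_braidE (gT : groupType) (s t : gT) : s * t * s = t * s * t ->
  s * t * s * (s * t)^-1 = t.
Proof. by move=> ->; rewrite invgM !mulgA mulgK mulgK. Qed.

Lemma conj_braid (gT : groupType) (s t b : gT) : s * t * s = t * s * t -> commute s b ->
  commute t (s * (t * b * t^-1) * s^-1).
Proof.
move=> st sb; rewrite -{1}(conj_braidE st).
have -> : s * (t * b * t^-1) * s^-1 = s * t * b * (s * t)^-1 by rewrite invgM !mulgA.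
exact: commute_conj.
Qed.

(** The conjugate at i is sigma_i sigma_(i+1) b sigma_(i+1)^-1 sigma_i^-1 with b commuting
    with sigma_i, hence it commutes with sigma_(i+1); the letters further up reduce to this. *)
Lemma tau_at_far_hi i k : i < n -> i < k -> k.+1 < n -> commute (tau_at i) (genB k).
Proof.
move=> iN; move: i iN k; apply: tau_at_ind => [k kn|i iN IH k ik kN]; first by lia.
apply: commute_sym; rewrite tau_at_rec //.
have [e|ne] := eqVneq k i.+1; last first.
  have C : commute (genB k) (genB i) by apply: genB_far; rewrite /far; lia.
  apply: commuteM; last exact: commuteV.
  by apply: commuteM => //; apply: commute_sym; apply: IH; lia.
rewrite e (tau_at_rec (i := i.+1)); last by lia.
apply: conj_braid; first by rewrite genB_adj //; lia.
by apply: commute_sym; apply: tau_at_far_lo; lia.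
Qed.

(** The relation of length four between sigma_i and the next conjugate of tau_n is the
    defining one at the end of the diagram, transported by conjugation. *)
Lemma tau_at_four i : i.+1 < n ->
  genB i * tau_at i.+1 * genB i * tau_at i.+1 = tau_at i.+1 * genB i * tau_at i.+1 * genB i.
Proof.
move=> iN; have [d] := ubnP (n - i); elim: d i iN => // d IH i iN dN.
have [e|ne] := eqVneq i.+2 n.
  by have := tau_at_last; rewrite (_ : n.-1 = i.+1) => [->|]; [exact: genB_four | lia].
rewrite (tau_at_rec (i := i.+1)); last by lia.
have st : genB i.+1 * genB i * genB i.+1 = genB i * genB i.+1 * genB i by rewrite genB_adj //; lia.
have C : commute (genB i) (tau_at i.+2) by apply: commute_sym; apply: tau_at_far_lo; lia.
have e2 : genB i.+1 * tau_at i.+2 * (genB i.+1)^-1 =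
    genB i.+1 * genB i * tau_at i.+2 * (genB i.+1 * genB i)^-1.
  by rewrite invgM !mulgA -(mulgA _ (genB i)) C !mulgA mulgK.
have F := four_conj (genB i.+1 * genB i) (IH i.+1 ltac:(lia) ltac:(lia)).
by move: F => /=; rewrite conj_braidE // -e2.
Qed.

Local Notation X := (nat * H)%type.

(** The left multiplication by sigma_j on the elements t_i phi(h), where t_i is the braid
    sigma_i ... sigma_(n-1), written on the pairs (i, h). *)
Definition gen_act (j : nat) (x : X) : X :=
  if j.+1 < x.1 then (x.1, genB j * x.2)
  else if j.+1 == x.1 then (j, x.2)
  else if j == x.1 then (j.+1, tau_at j * x.2)
  else (x.1, genB j.-1 * x.2).

Definition gen_act_inv (j : nat) (x : X) : X :=
  if j.+1 < x.1 then (x.1, (genB j)^-1 * x.2)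
  else if j.+1 == x.1 then (j, (tau_at j)^-1 * x.2)
  else if j == x.1 then (j.+1, x.2)
  else (x.1, (genB j.-1)^-1 * x.2).

Variant act_spec (j i : nat) (h : H) : X -> Prop :=
| act_above of j.+1 < i : act_spec j i h (i, genB j * h)
| act_down of j.+1 = i : act_spec j i h (j, h)
| act_up of j = i : act_spec j i h (j.+1, tau_at j * h)
| act_below of i < j : act_spec j i h (i, genB j.-1 * h).

Lemma gen_actP j i h : act_spec j i h (gen_act j (i, h)).
Proof.
rewrite /gen_act /=; case: ifP => [|H1]; first exact: act_above.
case: eqP => [|H2]; first exact: act_down.
by case: eqP => [|H3]; [exact: act_up | apply: act_below; lia].
Qed.

Lemma gen_actK j : cancel (gen_act j) (gen_act_inv j).
Proof.
case=> i h; case: gen_actP => ij; rewrite /gen_act_inv /=.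
- by rewrite ij mulKg.
- by do 3?case: ifP; rewrite ?ij ?eqxx //; lia.
- by do 3?case: ifP; rewrite ?ij ?eqxx ?mulKg //; lia.
- by do 3?case: ifP; rewrite ?ij ?eqxx ?mulKg //; lia.
Qed.

Lemma gen_act_invK j : cancel (gen_act_inv j) (gen_act j).
Proof.
case=> i h; rewrite /gen_act_inv /=; case: ifP => [H1|H1].
  by rewrite /gen_act /= H1 mulKVg.
case: eqP => [H2|H2]; first by rewrite /gen_act /= ltnNge leqnSn -H2 /= ?eqxx mulKVg; case: eqP => //; lia.
case: eqP => [H3|H3]; first by rewrite /gen_act /= ltnn eqxx H3.
by rewrite /gen_act /= H1; do 2!case: eqP => //; rewrite mulKVg.
Qed.

Lemma gen_act_ub j x : j < n -> x.1 <= n -> (gen_act j x).1 <= n.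
Proof. by case: x => i h; case: gen_actP => /=; lia. Qed.

Lemma gen_act_inv_ub j x : j < n -> x.1 <= n -> (gen_act_inv j x).1 <= n.
Proof.
by case: x => i h; rewrite /gen_act_inv /=; do 3?case: ifP => ? /=; lia.
Qed.

Lemma gen_act_lt j i h : j.+1 < i -> gen_act j (i, h) = (i, genB j * h).
Proof. by case: gen_actP => //; lia. Qed.
Lemma gen_act_down j h : gen_act j (j.+1, h) = (j, h).
Proof. by case: gen_actP => //; lia. Qed.
Lemma gen_act_up j h : gen_act j (j, h) = (j.+1, tau_at j * h).
Proof. by case: gen_actP => //; lia. Qed.
Lemma gen_act_gt j i h : i < j -> gen_act j (i, h) = (i, genB j.-1 * h).
Proof. by case: gen_actP => //; lia. Qed.

Lemma gen_act_far j j' x : j.+1 < j' -> j' < n -> x.1 <= n ->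
  gen_act j (gen_act j' x) = gen_act j' (gen_act j x).
Proof.
case: x => i h jj' j'n /= iN.
have comm (a b : nat) : a < n -> b < n -> far a b -> genB a * (genB b * h) = genB b * (genB a * h).
  by move=> an bn ab; rewrite !mulgA (genB_far an bn ab).
case: (gen_actP j' i h) => ij'.
- rewrite !gen_act_lt ?gen_act_lt //; try lia.
  by rewrite comm //; rewrite /far; lia.
- rewrite -ij' gen_act_lt; last lia.
  by rewrite gen_act_lt ?gen_act_down //; lia.
- rewrite -ij' !(@gen_act_lt j); try lia.
  rewrite gen_act_up; congr (_, _); rewrite !mulgA; congr (_ * h).
  by apply: commute_sym; apply: tau_at_far_lo; lia.
case: (gen_actP j i h) => ij.
- rewrite gen_act_lt // gen_act_gt //; congr (_, _).
  by rewrite comm //; rewrite /far; lia.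
- by rewrite -ij gen_act_down gen_act_gt //; lia.
- rewrite -ij gen_act_up gen_act_gt; last lia.
  congr (_, _); rewrite !mulgA; congr (_ * h); apply: tau_at_far_hi; lia.
- rewrite (gen_act_gt _ ij) (gen_act_gt _ ij'); congr (_, _).
  by apply: comm; rewrite /far; lia.
Qed.

(** The five positions of i with respect to j; the case i = j is where the relation of
    length four is needed. *)
Lemma gen_act_adj j x : j.+1 < n -> x.1 <= n ->
  gen_act j (gen_act j.+1 (gen_act j x)) = gen_act j.+1 (gen_act j (gen_act j.+1 x)).
Proof.
case: x => i h jn /= iN.
have [ij|ij] := ltnP i j.
  rewrite !gen_act_gt //; try lia.
  have e := @genB_adj j.-1; rewrite (ltn_predK ij) in e.
  by congr (_, _); rewrite !mulgA /= e.
have [e|ne] := eqVneq i j.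
  rewrite e (gen_act_up j) (gen_act_up j.+1) (@gen_act_lt j j.+2) //.
  rewrite (@gen_act_gt j.+1 j) // (gen_act_up j) (gen_act_up j.+1) /=.
  congr (_, _); rewrite !mulgA; congr (_ * h).
  rewrite (tau_at_rec jn) !mulgA mulgKV.
  by rewrite tau_at_four // mulgK.
have [e|ne1] := eqVneq i j.+1.
  rewrite e (gen_act_down j) (@gen_act_gt j.+1 j) // (gen_act_up j) (gen_act_up j.+1).
  rewrite (@gen_act_lt j j.+2) // (gen_act_down j.+1) /=.
  congr (_, _); rewrite !mulgA; congr (_ * h).
  by rewrite (tau_at_rec jn) mulgKV.
have [e|ne2] := eqVneq i j.+2.
  rewrite e (@gen_act_lt j j.+2) // !(gen_act_down j.+1) !(gen_act_down j).
  by rewrite (@gen_act_gt j.+1 j).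
have ij2 : j.+2 < i by lia.
have ij1 : j.+1 < i by lia.
rewrite !(gen_act_lt _ ij1, gen_act_lt _ ij2).
by congr (_, _); rewrite !mulgA; congr (_ * h); apply: genB_adj; lia.
Qed.

Definition word_act (w : word 'I_n) (x : X) : X :=
  foldr (fun (l : 'I_n * bool) x => if l.2 then gen_act_inv l.1 x else gen_act l.1 x) x w.

Lemma word_act_ub w x : x.1 <= n -> (word_act w x).1 <= n.
Proof.
move=> xn; elim: w => //= -[j b] w IH /=.
by case: b; [apply: gen_act_inv_ub | apply: gen_act_ub].
Qed.

(** The formulas of [gen_act] satisfy the relations of the braid group, so that they define
    an action of G on pairs. *)
Lemma word_act_eq (w w' : word 'I_n) x : x.1 <= n ->
  word_eq (artin_rel (@coxeterA n.+1)) w w' -> word_act w x = word_act w' x.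
Proof.
move=> xn e; elim: e x xn => // {w w'} [u v _ IH|u v w _ IH1 _ IH2|u u' v v' _ IHu _ IHv|j b|u v [i [j [-> ->]]]] x xn.
- by rewrite IH.
- by rewrite IH1 // IH2.
- by rewrite /word_act !foldr_cat -!/(word_act _ _) IHv // IHu // word_act_ub.
- by case: b; rewrite /= ?gen_actK ?gen_act_invK.
have [->//|ne] := eqVneq i j.
have ne' : i <> j :> nat by move=> e; case/eqP: ne; apply: val_inj.
rewrite /coxeterA (negPf ne); case: ifP => ij /=.
  case/orP: ij => /eqP e.
    by rewrite -e; apply: gen_act_adj; rewrite // e.
  by rewrite -e; symmetry; apply: gen_act_adj; rewrite // e.
have [iN jN] := (ltn_ord i, ltn_ord j).
have /negbT := ij; rewrite negb_or => /andP [/eqP n1 /eqP n2].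
case: (ltngtP i j) => [lt|lt|//]; [|symmetry];
  by apply: gen_act_far => //; rewrite ltn_neqAle lt andbT; apply/eqP.
Qed.

Definition coset_act (g : G) (x : X) : X := word_act (word_repr g) x.

Lemma coset_act_class w x : x.1 <= n -> coset_act (word_class _ w) x = word_act w x.
Proof. by move=> xn; apply: word_act_eq => //; apply: word_repr_class. Qed.

Lemma coset_act_ub g x : x.1 <= n -> (coset_act g x).1 <= n.
Proof. exact: word_act_ub. Qed.

Lemma coset_actM g g' x : x.1 <= n -> coset_act (g * g') x = coset_act g (coset_act g' x).
Proof.
move=> xn; rewrite -[g]word_reprK -[g']word_reprK -[_ * _]/(pg_mul _ _) pg_mul_class.
rewrite !coset_act_class //; first by rewrite /word_act foldr_cat.
exact: word_act_ub.
Qed.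

Lemma coset_act1 x : x.1 <= n -> coset_act 1 x = x.
Proof. by move=> xn; rewrite -[1]/(word_class _ [::]) coset_act_class. Qed.

Lemma coset_act_sigma j x : j < n -> x.1 <= n -> coset_act (sigma n.+1 j) x = gen_act j x.
Proof.
move=> jn xn; have := sigmaE (Ordinal jn); rewrite /= => ->.
by rewrite coset_act_class.
Qed.

Definition transversal (i : nat) : G := positive_braid n.+1 (iota i (n - i)).

Lemma transversalS i : i < n -> transversal i = sigma n.+1 i * transversal i.+1.
Proof. by move=> iN; rewrite /transversal; have -> : (n - i = (n - i.+1).+1)%N by lia. Qed.

Lemma transversal_last : transversal n = 1.
Proof. by rewrite /transversal subnn. Qed.

Lemma transversal_far i j : j.+1 < i -> i <= n ->
  sigma n.+1 j * transversal i = transversal i * sigma n.+1 j.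
Proof.
move=> ji iN; symmetry; apply: ev_far; first by lia.
  by apply/allP => k; rewrite mem_iota; lia.
by apply/allP => k; rewrite mem_iota /far; lia.
Qed.

(** A letter crosses a run at the cost of a shift of its index. *)
Lemma transversal_slide i j : i < j -> j < n ->
  sigma n.+1 j * transversal i = transversal i * sigma n.+1 j.-1.
Proof.
move=> ij jN; have [d] := ubnP (j - i); elim: d i ij => // d IH i ij dj.
have iN : i < n by lia.
rewrite (transversalS iN).
have [e|ne] := eqVneq j i.+1.
  rewrite e (@transversalS i.+1); last by lia.
  have A : sigma n.+1 i.+1 * (sigma n.+1 i * sigma n.+1 i.+1) =
      sigma n.+1 i * (sigma n.+1 i.+1 * sigma n.+1 i).
    by apply: sigma_adj; rewrite ?/adj ?eqxx ?orbT //; lia.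
  rewrite (mulgA (sigma n.+1 i)) mulgA A /= -!mulgA.
  by rewrite transversal_far //; lia.
have F : sigma n.+1 j * sigma n.+1 i = sigma n.+1 i * sigma n.+1 j.
  by apply: sigma_far; rewrite /far; lia.
by rewrite mulgA F -!mulgA IH //; lia.
Qed.

Lemma artinB_embed1 : phi 1 = 1.
Proof. exact: (pg_lift_class (@artinB_gen_rel n) [::]). Qed.

Lemma artinB_embedV h : phi h^-1 = (phi h)^-1.
Proof. by apply: (mulgI (phi h)); rewrite -artinB_embedM !mulgV artinB_embed1. Qed.

Lemma artinB_embed_gen j : j.+1 < n -> phi (genB j) = sigma n.+1 j.
Proof.
move=> jn; have jN : j < n by lia.
rewrite -[j]/(val (Ordinal jN)) genB_ord /artinB_embed /= pg_lift_gen /artinB_gen /=.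
by case: eqP => //; lia.
Qed.

Lemma artinB_embed_gen_last : phi (genB n.-1) = sigma n.+1 n.-1 * sigma n.+1 n.-1.
Proof.
have jN : n.-1 < n by lia.
by rewrite -[n.-1]/(val (Ordinal jN)) genB_ord /artinB_embed /= pg_lift_gen /artinB_gen /= eqxx.
Qed.

(** The image of the conjugate of tau_n at i is determined by descending induction, moving
    sigma_i across the representative t_(i+2), which commutes with it. *)
Lemma transversal_tau i : i < n ->
  sigma n.+1 i * transversal i = transversal i.+1 * phi (tau_at i).
Proof.
move: i; apply: tau_at_ind => [|i iN IH].
  rewrite tau_at_last artinB_embed_gen_last transversalS; last by lia.
  by rewrite prednK // transversal_last mul1g mulg1.
rewrite (tau_at_rec iN) !artinB_embedM artinB_embedV /= (artinB_embed_gen iN).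
have iN' : i < n by lia.
have C := @transversal_far i.+2 i (ltnSn _) iN.
rewrite (transversalS iN') (transversalS iN).
rewrite (transversalS iN) in IH.
have A : sigma n.+1 i * sigma n.+1 i.+1 * sigma n.+1 i =
    sigma n.+1 i.+1 * sigma n.+1 i * sigma n.+1 i.+1.
  by rewrite -!mulgA; apply: sigma_adj; rewrite ?/adj ?eqxx //; lia.
move: (sigma n.+1 i) (sigma n.+1 i.+1) (transversal i.+2) (phi _) C A IH.
move=> s u t b st su ub; apply: (mulIg s); rewrite !mulgA mulgVK.
have -> : s * s * u * t * s = s * (s * u * s) * t by rewrite -(mulgA _ t s) -st !mulgA.
have -> : u * t * s * b = u * s * (t * b) by rewrite -(mulgA u) -st !mulgA.
by rewrite -ub su !mulgA su.
Qed.

(** The map from pairs to G that [coset_act] makes equivariant. *)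
Definition coset_elt (x : X) : G := transversal x.1 * phi x.2.

Lemma coset_elt_gen j x : j < n -> x.1 <= n ->
  coset_elt (gen_act j x) = sigma n.+1 j * coset_elt x.
Proof.
case: x => i h /= jn iN; rewrite /coset_elt /=; case: gen_actP => ij /=.
- by rewrite artinB_embedM artinB_embed_gen ?mulgA; [rewrite transversal_far //; lia | lia].
- by rewrite transversalS // -ij mulgA.
- by rewrite -ij artinB_embedM mulgA -transversal_tau // mulgA.
- by rewrite artinB_embedM artinB_embed_gen; [rewrite !mulgA transversal_slide | lia].
Qed.

Lemma coset_elt_act g x : x.1 <= n -> coset_elt (coset_act g x) = g * coset_elt x.
Proof.
move=> xn; rewrite -{2}[g]word_reprK word_class_eval /coset_act.
elim: (word_repr g) => [|[j b] w IH] /=; first by rewrite mul1g.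
have wn := word_act_ub w xn; rewrite -(sigmaE j); case: b; rewrite /= -?mulgA -IH.
  apply: (mulgI (sigma n.+1 j)); rewrite mulVKg -coset_elt_gen ?gen_act_invK //.
  exact: gen_act_inv_ub.
exact: coset_elt_gen.
Qed.

Lemma gen_act_phi (j : nat) h : j < n -> coset_act (phi (genB j)) (n, h) = (n, genB j * h).
Proof.
move=> jn; have [e|ne] := eqVneq j n.-1.
  have jn' : n.-1 < n by lia.
  rewrite e artinB_embed_gen_last coset_actM // !coset_act_sigma ?gen_act_ub //.
  have d := gen_act_down n.-1 h; have u := gen_act_up n.-1 h.
  rewrite prednK // tau_at_last in d u.
  by rewrite d u.
by rewrite artinB_embed_gen ?coset_act_sigma ?gen_act_lt //; lia.
Qed.

Lemma coset_act_phi h h' : coset_act (phi h) (n, h') = (n, h * h').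
Proof.
rewrite -[h]word_reprK word_class_eval.
elim: (word_repr h) h' => [|[j b] w IH] h' /=; first by rewrite artinB_embed1 coset_act1 // mul1g.
rewrite artinB_embedM coset_actM // IH -mulgA -genB_ord; case: b; last by rewrite gen_act_phi.
rewrite -[X in coset_act _ (n, X)](mulVKg (genB j)) -gen_act_phi // -coset_actM //.
by rewrite -artinB_embedM mulVg artinB_embed1 coset_act1.
Qed.

Lemma coset_act_transversal i h : i <= n -> coset_act (transversal i) (n, h) = (i, h).
Proof.
move=> iN; have [d] := ubnP (n - i); elim: d i iN => // d IH i iN dN.
have [->|ne] := eqVneq i n; first by rewrite transversal_last coset_act1.
have lt : i < n by lia.
rewrite transversalS // coset_actM // IH //; last by lia.
by rewrite coset_act_sigma // gen_act_down.
Qed.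

(** Each element of G is t_i phi(h) for exactly one pair (i, h).  Uniqueness holds because the
    action on pairs recovers (i, h) from the element; in particular phi is injective. *)
Lemma coset_decomposition : exists (t : 'I_n.+1 -> G) (dec : G -> 'I_n.+1 * H),
  [/\ forall g, t (dec g).1 * phi (dec g).2 = g,
      forall i h, dec (t i * phi h) = (i, h) & t ord_max = 1].
Proof.
exists (fun i => transversal i), (fun g => (inord (coset_act g (n, 1)).1, (coset_act g (n, 1)).2)).
split=> [g|i h|] /=; last exact: transversal_last.
  rewrite inordK; last exact: coset_act_ub.
  rewrite -/(coset_elt _) coset_elt_act // /coset_elt transversal_last /= artinB_embed1.
  by rewrite !mulg1.
rewrite coset_actM // coset_act_phi mulg1 coset_act_transversal /=; last by rewrite -ltnS ltn_ord.
by rewrite inord_val.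
Qed.

End Cosets.

Import GRing.Theory Num.Theory Order.TTheory.
Local Open Scope ring_scope.

Arguments merge_parts : simpl never.

(** * The simplex of compositions *)

Section Incidence.
Variable k : comNzRingType.
Implicit Types (m l r : seq nat).

Lemma merge_parts0 a b l : merge_parts 0 [:: a, b & l] = (a + b)%N :: l.
Proof. by rewrite /merge_parts /= drop0. Qed.

Lemma merge_partsS i a l : merge_parts i.+1 (a :: l) = a :: merge_parts i l.
Proof. by []. Qed.

Lemma size_merge i l : (i.+1 < size l)%N -> size (merge_parts i l) = (size l).-1.
Proof.
by move=> il; rewrite /merge_parts size_cat /= size_take size_drop; case: ifP; lia.
Qed.

Lemma sumn_merge i l : (i.+1 < size l)%N -> sumn (merge_parts i l) = sumn l.
Proof.
elim: i l => [|i IH] [|a [|b l]] // il.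
  by rewrite merge_parts0 /= addnA.
by rewrite merge_partsS -[LHS]/(a + sumn (merge_parts i (b :: l)))%N IH.
Qed.

Lemma pos_merge i l : (i.+1 < size l)%N -> all (leq 1) l -> all (leq 1) (merge_parts i l).
Proof.
elim: i l => [|i IH] [|a [|b l]] // il.
  by rewrite merge_parts0 /= => /and3P [a0 b0 ->]; rewrite addn_gt0 a0.
by rewrite merge_partsS => /andP [a0 bl]; apply/andP; split=> //; apply: IH.
Qed.

(** Incidence coefficients of the simplex whose faces are the compositions: merging two
    consecutive parts removes a vertex. *)
Definition inc m l : k :=
  \sum_(i < (size l).-1 | merge_parts i l == m) (-1) ^+ i.

Lemma inc_nil m : inc m [::] = 0.
Proof. by rewrite /inc big_ord0. Qed.

Lemma inc1 m a : inc m [:: a] = 0.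
Proof. by rewrite /inc big_ord0. Qed.

Lemma inc_cons x m y z l : inc (x :: m) [:: y, z & l] =
  (x :: m == (y + z)%N :: l)%:R - (x == y)%:R * inc m (z :: l).
Proof.
rewrite /inc big_mkcond big_ord_recl /= merge_parts0 expr0 eq_sym; congr (_ + _).
  by case: eqP.
rewrite [in RHS]big_mkcond mulr_sumr -sumrN /=; apply: eq_bigr => i _.
rewrite eqseq_cons (eq_sym y); case: (x == y) => /=; last by rewrite mul0r oppr0.
by case: eqP => _; rewrite ?mulr0 ?oppr0 // exprS mulN1r mul1r.
Qed.

Lemma inc_nil_l l : all (leq 1) l -> inc [::] l = 0.
Proof.
move=> l0; rewrite /inc big1 // => i /eqP.
by rewrite /merge_parts; case: (take i l).
Qed.

Lemma inc_ones m l : all (leq 1) l -> inc (1%N :: m) (1%N :: l) = - inc m l.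
Proof.
case: l => [|z l]; first by rewrite inc1 inc_nil oppr0.
move=> /andP [z0 _]; rewrite inc_cons eqseq_cons mul1r (_ : (1 == 1 + z)%N = false) ?sub0r //.
by lia.
Qed.

Lemma inc_head m y l : (1 < y)%N -> inc (1%N :: m) (y :: l) = 0.
Proof.
case: l => [|z l] y1; first by rewrite inc1.
rewrite inc_cons eqseq_cons (_ : (1 == y + z)%N = false); last by lia.
by rewrite (_ : (1 == y)%N = false) ?mul0r ?subr0 //; lia.
Qed.

(** The simplicial identities in the form of the square of the boundary of one composition. *)
Lemma inc_sq m r : all (leq 1) r ->
  \sum_(j < (size r).-1) (-1) ^+ j * inc m (merge_parts j r) = 0 :> k.
Proof.
elim: r m => [|a [|b r] IH] m r0; rewrite ?big_ord0 //.
rewrite big_ord_recl /= merge_parts0 expr0 mul1r.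
under eq_bigr => j _ do rewrite /bump /= add1n merge_partsS exprS mulN1r mulNr.
rewrite sumrN; apply/eqP; rewrite subr_eq0; apply/eqP.
have /= r0' : all (leq 1) (b :: r) by case/andP: r0.
case: m => [|x m].
  rewrite inc_nil_l; last by case/and3P: r0 => a0 b0 rr /=; rewrite addn_gt0 a0.
  rewrite big1 // => j _; rewrite inc_nil_l ?mulr0 //=.
  by case/andP: r0 => -> _; apply: pos_merge => //=; rewrite ltnS; case: j.
case: r IH r0 r0' => [|c r] IH r0 r0'; first by rewrite inc1 big_ord0.
rewrite big_ord_recl /= merge_parts0 expr0 mul1r !inc_cons.
under eq_bigr => j _ do
  rewrite /bump /= add1n merge_partsS exprS mulN1r inc_cons mulrBr !mulNr.
rewrite sumrB.
have IHm := IH m r0'; move: IHm; rewrite big_ord_recl /= merge_parts0 expr0 mul1r.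
under eq_bigr => j _ do rewrite /bump /= add1n merge_partsS exprS mulN1r mulNr.
rewrite sumrN => /eqP; rewrite subr_eq0 => /eqP e.
rewrite [X in _ = _ + (_ - X)](_ : _ = - ((x == a)%:R * inc m ((b + c)%N :: r))); last first.
  by rewrite e mulr_sumr -sumrN; apply: eq_bigr => j _; rewrite mulrCA.
rewrite [X in _ = _ + (X - _)](_ : _ = - ((x == (a + b)%N)%:R * inc m (c :: r))); last first.
  rewrite sumrN; congr (- _); rewrite /inc mulr_sumr [in RHS]big_mkcond /=; apply: eq_bigr => j _.
  rewrite eqseq_cons (eq_sym m); case: (x == _) => /=; last by rewrite mulr0 mul0r; case: ifP.
  by case: eqP => _; rewrite ?mulr1 ?mulr0 // mul1r.
by rewrite addnA opprK; ring.
Qed.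

(** The inverse of merging a part 1 at place s with the next part. *)
Definition split_off (s : nat) l : seq nat :=
  take s l ++ [:: 1%N, (nth 0%N l s).-1 & drop s.+1 l].

Arguments split_off : simpl never.

Lemma split_offS s a l : split_off s.+1 (a :: l) = a :: split_off s l.
Proof. by []. Qed.

Lemma split_off0 a l : split_off 0 (a :: l) = [:: 1%N, a.-1 & l].
Proof. by rewrite /split_off /= drop0. Qed.

Lemma merge_split_off s l : (0 < nth 0%N l s)%N -> merge_parts s (split_off s l) = l.
Proof.
elim: s l => [|s IH] [|a l] // l0.
  by rewrite split_off0 merge_parts0 add1n prednK.
by rewrite split_offS merge_partsS IH.
Qed.

Lemma split_off_merge s l : (s.+1 < size l)%N -> nth 0%N l s = 1%N ->
  split_off s (merge_parts s l) = l.
Proof.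
elim: s l => [|s IH] [|a [|b l]] // sl.
  by move=> /= ->; rewrite merge_parts0 split_off0.
by move=> e; rewrite merge_partsS split_offS IH.
Qed.

Lemma pos_split_off s l : all (leq 1) l -> (1 < nth 0%N l s)%N -> all (leq 1) (split_off s l).
Proof.
elim: s l => [|s IH] [|a l] // /andP [a0 l0] al.
  rewrite split_off0; apply/and3P; split=> //.
  by move: al => /=; lia.
by rewrite split_offS; apply/andP; split=> //; apply: IH.
Qed.

Lemma sumn_split_off s l : (0 < nth 0%N l s)%N -> sumn (split_off s l) = sumn l.
Proof.
elim: s l => [|s IH] [|a l] // al.
  by rewrite split_off0 /=; move: al => /=; lia.
by rewrite split_offS -[LHS]/(a + sumn (split_off s l))%N IH.
Qed.

Lemma size_split_off s l : (0 < nth 0%N l s)%N -> size (split_off s l) = (size l).+1.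
Proof.
elim: s l => [|s IH] [|a l] // al; first by rewrite split_off0.
by rewrite split_offS -[LHS]/(size (split_off s l)).+1 IH.
Qed.

(** The simplex is a cone over the break after the first s + 1 points.  For compositions m
    beginning with s parts equal to 1, merging the part 1 at place s and splitting it off
    are the two summands of the contracting homotopy. *)
Lemma cone_identity s m l : all (leq 1) m -> all (leq 1) l ->
  sumn m = sumn l -> (s.+1 < sumn m)%N -> take s m = nseq s 1%N ->
  (nth 0%N m s == 1%N)%:R * inc (merge_parts s m) l +
  (1 < nth 0%N l s)%N%:R * inc m (split_off s l) = (-1) ^+ s * (m == l)%:R.
Proof.
elim: s m l => [|s IH] [|x m] l m0 l0 e sm //; (case: l l0 e => [|y l] l0 e;
  first by move: e sm => /= ->); case/andP: m0 => x0 m0; case/andP: l0 => y0 l0.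
- rewrite split_off0 expr0 mul1r inc_cons => _.
  rewrite -[nth _ _ _]/x -[nth _ (y :: l) _]/y.
  have [x1|x1] := eqVneq x 1%N; last first.
    rewrite mul0r add0r mul0r subr0.
    have [y1|y1] := ltnP 1 y; first by rewrite mul1r add1n prednK.
    by rewrite mul0r; case: eqP => // -[xy _]; move/eqP: x1; lia.
  subst x; case: m m0 e sm => [|x m]; first by rewrite /=; lia.
  move=> /andP [x0' m0] e sm; rewrite merge_parts0 add1n !mul1r.
  case: l l0 e => [|z l] l0 e.
    have y1 : (1 < y)%N by move: e => /=; lia.
    by rewrite y1 !inc1 add1n prednK // subr0 add0r mul1r.
  move: l0 => /andP [z0 l0]; rewrite !inc_cons.
  have [y1|y1] := ltnP 1 y.
    rewrite mul1r add1n prednK // !eqseq_cons.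
    have -> : (x == (y.-1 + z)%N) = (x.+1 == (y + z)%N) by lia.
    have -> : (x == y.-1) = (x.+1 == y) by lia.
    have -> : (1 == y)%N = false by lia.
    by rewrite addrC subrK.
  have -> : y = 1%N by lia.
  rewrite !eqseq_cons eqxx add1n eqSS.
  have -> : (x.+1 == 1)%N = false by lia.
  by rewrite !mul0r subr0 addr0.
- move=> /= [x1 mE]; subst x; rewrite merge_partsS split_offS.
  have sm' : (s.+1 < sumn m)%N by move: sm => /=; lia.
  have [y1|y1] := eqVneq y 1%N; last first.
    have y2 : (1 < y)%N by move: y0 y1; case: (y) => [|[]].
    rewrite !inc_head // !mulr0 addr0 eqseq_cons eq_sym (negPf y1) /=.
    by rewrite mulr0.
  subst y; have e' : sumn m = sumn l by move: e => /= [].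
  have [l1|l1] := ltnP 1 (nth 0%N l s).
    rewrite !inc_ones //; last exact: pos_split_off.
    have := IH m l m0 l0 e' sm' mE; rewrite l1 => E.
    by rewrite !mulrN -opprD E eqseq_cons eqxx /= exprS mulN1r mulNr.
  have := IH m l m0 l0 e' sm' mE; rewrite ltnNge l1 /= !mul0r !addr0 => E.
  by rewrite inc_ones // mulrN E eqseq_cons eqxx /= exprS mulN1r mulNr.
Qed.
End Incidence.

(** * Free modules *)

Section ScaleBy.
Variables (k : comNzRingType) (W : lmodType k).

Definition scale_by (w : W) (c : k^o) : W := (c : k) *: w.

Lemma scale_by_linear w : linear (scale_by w).
Proof. by move=> a c d; rewrite /scale_by scalerDl scalerA. Qed.

HB.instance Definition _ w :=
  GRing.isLinear.Build k k^o W _ (scale_by w) (scale_by_linear w).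
End ScaleBy.

Section FreeModule.
Variables (k : comNzRingType).

(** The free k-module on T; [lin] is its universal property and [span A] the submodule
    generated by the basis vectors in A. *)
Definition free (T : choiceType) : lmodType k := dsum T k^o.

Section Basis.
Variable T : choiceType.

Definition bas (t : T) : free T := dsum_in t (1 : k^o).

Lemma dsum_in_bas (t : T) (c : k^o) : dsum_in t c = (c : k) *: bas t.
Proof. by rewrite /bas -linearZ /= [_ *: 1]mulr1. Qed.

Lemma free_ind (P : free T -> Prop) : P 0 ->
  (forall c t x, P x -> P (c *: bas t + x)) -> forall x, P x.
Proof.
move=> P0 Pin; elim/dsum_ind => // t v x Px.
by rewrite dsum_in_bas; apply: Pin.
Qed.

Lemma coeff_bas t s : (bas t)@_s = (t == s)%:R.
Proof. by rewrite mcoeffU. Qed.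

Lemma free_eq (W : lmodType k) (f g : {linear free T -> W}) :
  (forall t, f (bas t) = g (bas t)) -> f =1 g.
Proof.
by move=> fg; elim/free_ind => [|c t x IH]; rewrite ?linear0 // !linearP fg IH.
Qed.

Definition lin (W : lmodType k) (u : T -> W) : {linear free T -> W} :=
  dsum_ext (fun t => scale_by (u t)).

Lemma lin_bas (W : lmodType k) (u : T -> W) t : lin u (bas t) = u t.
Proof. by rewrite /lin /bas /= dsum_ext_in /= /scale_by scale1r. Qed.

Definition span (A : T -> Prop) : {pred free T} :=
  span_of (fun x : free T => exists2 t, A t & x = bas t).
HB.instance Definition _ A := GRing.SubmodClosed.on (span A).

Lemma span_bas (A : T -> Prop) t : A t -> bas t \in span A.
Proof. by move=> At; apply: in_span_gen; exists t. Qed.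

Lemma span_lin (A : T -> Prop) (W : lmodType k) (f : {linear free T -> W})
  (S : submodClosed W) : (forall t, A t -> f (bas t) \in S) ->
  forall x, x \in span A -> f x \in S.
Proof.
move=> fA x /span_ofP; elim=> [|c {}x v [t At ->] _ IH]; first by rewrite linear0 rpred0.
by rewrite linearP rpredD // rpredZ // fA.
Qed.

Lemma span_eq (A : T -> Prop) (W : lmodType k) (f g : {linear free T -> W}) :
  (forall t, A t -> f (bas t) = g (bas t)) -> {in span A, f =1 g}.
Proof.
move=> fg x /span_ofP; elim=> [|c {}x v [t At ->] _ IH]; first by rewrite !linear0.
by rewrite !linearP fg // IH.
Qed.

Lemma span_mono (A B : T -> Prop) : (forall t, A t -> B t) ->
  forall x, x \in span A -> x \in span B.
Proof. by move=> AB; apply: (span_lin (f := idfun)) => t /AB; apply: span_bas. Qed.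

Lemma span_supp (A : T -> Prop) x t : x \in span A -> x@_t != 0 -> A t.
Proof.
move=> /span_ofP xA; have [//|nA] := EM (A t); case/eqP.
elim: xA => [|c {}x v [s As ->] _ IH]; first exact: mcoeff0.
rewrite mcoeffD IH [in LHS]/GRing.scale /= dsum_scaleE coeff_bas addr0.
by case: eqP => [e|_]; rewrite ?scaler0 //; case: nA; rewrite -e.
Qed.

Lemma span_none x : x \in span (fun _ => False) -> x = 0.
Proof. by move=> /span_ofP; elim=> // c y v []. Qed.

End Basis.
End FreeModule.

#[global] Opaque bas lin span.

Section Augmentation.
Variables (k : comNzRingType).
Definition aug (T : choiceType) : {linear free k T -> k^o} := lin (fun _ : T => (1 : k^o)).

Lemma aug_bas (T : choiceType) (t : T) : aug T (bas k t) = 1.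
Proof. exact: lin_bas. Qed.
End Augmentation.
#[global] Opaque aug.

(** * The group algebra of the braid group *)

Section BraidLength.
Variable N : nat.
Local Notation G := (braid_group N).

Definition word_len (I : Type) (w : seq (I * bool)) : int :=
  \sum_(x <- w) (if x.2 then -1 else 1).

Lemma word_len_eq (w w' : word 'I_N.-1) :
  word_eq (artin_rel (@coxeterA N)) w w' -> word_len w = word_len w'.
Proof.
elim=> // {w w'} [w w' w'' _ -> _ ->|u u' v v' _ IHu _ IHv|j b|u v] //.
- by rewrite /word_len !big_cat /= -![\sum_(x <- _) _]/(word_len _) IHu IHv.
- by rewrite /word_len !big_cons big_nil; case: b.
case=> i [j [-> ->]].
have E a b l : word_len (alt_word a b l) = l%:Z :> int.
  elim: l a b => [|l IH] a b; rewrite /word_len /= ?big_nil // big_cons /=.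
  by rewrite -[\sum_(x <- _) _]/(word_len _) IH; lia.
by rewrite !E.
Qed.

(** The abelianization of the braid group, which counts letters with signs. *)
Definition braid_len (g : G) : int := word_len (word_repr g).

Lemma braid_len_class w : braid_len (word_class _ w) = word_len w.
Proof. exact/word_len_eq/word_repr_class. Qed.

Lemma braid_lenM g h : braid_len (g * h)%g = braid_len g + braid_len h.
Proof.
rewrite -[g]word_reprK -[h]word_reprK -[(_ * _)%g]/(pg_mul _ _) pg_mul_class.
by rewrite !braid_len_class /word_len big_cat.
Qed.

Lemma braid_len1 : braid_len 1%g = 0.
Proof.
have := braid_lenM 1 1; rewrite mulg1 => /eqP; rewrite -subr_eq0 opprD addrA subrr sub0r.
by rewrite oppr_eq0 => /eqP.
Qed.

Lemma braid_len_ev u : letters N u -> braid_len (positive_braid N u) = (size u)%:Z.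
Proof.
move=> /lettersP [w ->]; rewrite ev_class braid_len_class size_map.
rewrite /word_len big_map; elim: w => [|j w IH]; rewrite ?big_nil // big_cons IH /=; lia.
Qed.

Lemma braid_len_positive (g : G) : is_positive g -> 0 <= braid_len g.
Proof. by case=> u uN ->; rewrite braid_len_ev. Qed.

Lemma braid_len_perm off m (s : 'S_m) : (off + m <= N)%N ->
  braid_len (perm_braid N off s) = (inv s)%:Z.
Proof.
by move=> mN; have [w wN [-> <-]] := is_positive_perm_braid s mN; rewrite braid_len_ev.
Qed.

End BraidLength.

Section GroupAlgebra.
Variables (k : comNzRingType) (G : groupType).
Local Notation V := (free k G).
Implicit Types (x y z : V) (g h : G).

Definition mul_by y : {linear V -> V} := lin (fun g => translate k^o g y).
Definition gmul x y : V := mul_by y x.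

Lemma gmul_bas g y : gmul (bas k g) y = translate k^o g y.
Proof. exact: lin_bas. Qed.

Lemma translate_bas g h : translate k^o g (bas k h) = bas k (g * h)%g.
Proof. exact: translate_in. Qed.

Lemma gmul_bas2 g h : gmul (bas k g) (bas k h) = bas k (g * h)%g.
Proof. by rewrite gmul_bas translate_bas. Qed.

Lemma gmul0l z : gmul 0 z = 0. Proof. exact: (linear0 (mul_by z)). Qed.
Lemma gmulDl x y z : gmul (x + y) z = gmul x z + gmul y z.
Proof. exact: (linearD (mul_by z)). Qed.
Lemma gmulZl c y z : gmul (c *: y) z = c *: gmul y z.
Proof. exact: (linearZZ (mul_by z)). Qed.

#[global] Opaque gmul.

Lemma gmul_linear x : linear (gmul x).
Proof.
move=> c y z; elim/free_ind: x => [|d g x IH].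
  by rewrite !gmul0l scaler0 addr0.
rewrite !gmulDl !gmulZl IH !gmul_bas (linearP (translate k^o g)).
by rewrite !scalerDr !scalerA [d * c]mulrC -!addrA; congr (_ + _); rewrite addrCA.
Qed.

HB.instance Definition _ x := GRing.isLinear.Build k V V _ (gmul x) (gmul_linear x).

Lemma gmulDr x y z : gmul x (y + z) = gmul x y + gmul x z.
Proof. exact: (linearD (gmul x)). Qed.
Lemma gmulZr c x y : gmul x (c *: y) = c *: gmul x y.
Proof. exact: (linearZZ (gmul x)). Qed.
Lemma gmul0r x : gmul x 0 = 0.
Proof. exact: (linear0 (gmul x)). Qed.
Lemma gmulBr x y z : gmul x (y - z) = gmul x y - gmul x z.
Proof. exact: (linearB (gmul x)). Qed.
Lemma gmulBl x y z : gmul (x - y) z = gmul x z - gmul y z.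
Proof. exact: (linearB (mul_by z)). Qed.
Lemma gmul_suml I (r : seq I) (P : pred I) F z :
  gmul (\sum_(i <- r | P i) F i) z = \sum_(i <- r | P i) gmul (F i) z.
Proof. exact: (linear_sum (mul_by z)). Qed.
Lemma gmul_sumr I (r : seq I) (P : pred I) F z :
  gmul z (\sum_(i <- r | P i) F i) = \sum_(i <- r | P i) gmul z (F i).
Proof. exact: (linear_sum (gmul z)). Qed.

Lemma gmulA x y z : gmul (gmul x y) z = gmul x (gmul y z).
Proof.
apply: (free_eq (f := mul_by z \o mul_by y) (g := mul_by (gmul y z))) => g.
change (gmul (gmul (bas k g) y) z = gmul (bas k g) (gmul y z)).
apply: (free_eq (f := mul_by z \o gmul (bas k g)) (g := gmul (bas k g) \o mul_by z)) => h.
change (gmul (gmul (bas k g) (bas k h)) z = gmul (bas k g) (gmul (bas k h) z)).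
rewrite gmul_bas2.
apply: (free_eq (f := gmul (bas k (g * h)%g)) (g := gmul (bas k g) \o gmul (bas k h))) => w.
by rewrite /= !gmul_bas2 mulgA.
Qed.

Lemma gmul1l x : gmul (bas k 1%g) x = x.
Proof.
rewrite gmul_bas; apply: (free_eq (f := translate k^o 1%g) (g := idfun)) => h.
by rewrite translate_bas mul1g.
Qed.

Lemma gmul1r x : gmul x (bas k 1%g) = x.
Proof.
apply: (free_eq (f := mul_by (bas k 1%g)) (g := idfun)) => h.
by change (gmul (bas k h) (bas k 1%g) = bas k h); rewrite gmul_bas2 mulg1.
Qed.

Lemma gmul_span (A B C : G -> Prop) x y :
  (forall g h, A g -> B h -> C (g * h)%g) ->
  x \in span A -> y \in span B -> gmul x y \in span C.
Proof.
move=> ABC xA yB; apply: (span_lin (f := mul_by y)) xA => g Ag.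
apply: (span_lin (f := gmul (bas k g))) yB => h Bh.
by rewrite /= gmul_bas2; apply/span_bas/ABC.
Qed.

Lemma gmul_commute (A B : G -> Prop) x y :
  (forall g h, A g -> B h -> commute g h) ->
  x \in span A -> y \in span B -> gmul x y = gmul y x.
Proof.
move=> AB xA yB; apply: (span_eq (f := mul_by y) (g := gmul y)) xA => g Ag.
apply: (span_eq (f := gmul (bas k g)) (g := mul_by (bas k g))) yB => h Bh.
change (gmul (bas k g) (bas k h) = gmul (bas k h) (bas k g)).
by rewrite !gmul_bas2 (AB _ _ Ag Bh).
Qed.

End GroupAlgebra.

Section Unipotent.
Variables (k : comNzRingType) (N : nat).
Local Notation G := (braid_group N).
Local Notation V := (free k G).
Implicit Types (x y z : V).

(** Elements of the group algebra whose part of smallest length is 1. *)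
Definition unipotent y := y - bas k 1%g \in span (fun g : G => 0 < braid_len g).

Lemma unipotentM y z : unipotent y -> unipotent z -> unipotent (gmul y z).
Proof.
rewrite /unipotent => yU zU.
have -> : gmul y z - bas k 1%g = gmul (y - bas k 1%g) (z - bas k 1%g) +
    (y - bas k 1%g) + (z - bas k 1%g).
  rewrite gmulBl !gmulBr !gmul1r gmul1l.
  by rewrite [X in _ = X + _]addrAC subrK addrA subrK.
rewrite rpredD // rpredD //; apply: gmul_span yU zU => g h g0 h0.
by rewrite braid_lenM addr_gt0.
Qed.

(** If x y = 0 with y = 1 + (terms of positive length), then x = - x (y - 1), so that the
    smallest length in x can be increased indefinitely. *)
Lemma unipotent_regular y x : unipotent y -> gmul x y = 0 -> x = 0.
Proof.
move=> yU xy0; have xE : x = - gmul x (y - bas k 1%g).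
  by rewrite gmulBr xy0 gmul1r sub0r opprK.
pose A (t : int) (g : G) := t <= braid_len g.
have [t0 xt0] : exists t, x \in span (A t).
  elim/free_ind: (x) => [|c g v [t vt]]; first by exists 0; apply: rpred0.
  exists (Num.min t (braid_len g)); rewrite rpredD ?rpredZ ?span_bas //.
    by rewrite /A ge_min lexx orbT.
  by apply: span_mono vt => h; rewrite /A ge_min => ->.
have xA (n : nat) : x \in span (A (t0 + n%:Z)).
  elim: n => [|n IH]; first by rewrite addr0.
  rewrite xE rpredN; apply: (gmul_span _ IH yU) => g h; rewrite /A braid_lenM; lia.
apply/malgP => g; rewrite mcoeff0; apply/eqP/negPn/negP => xg.
have := span_supp (xA (absz (braid_len g - t0 + 1)%R)) xg.
by rewrite /A; lia.
Qed.

End Unipotent.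

(** * The Salvetti complex *)

Section Symmetrizer.
Variables (k : comNzRingType) (N : nat).
Local Notation G := (braid_group N).
Local Notation V := (free k G).
Local Notation ev := (positive_braid N).

Definition symmetrizer (off m : nat) : V :=
  \sum_(s : 'S_m) (-1) ^+ s *: bas k (perm_braid N off s).

Definition shuffler (off p q : nat) : V :=
  \sum_(s : 'S_(p + q) | is_shuffle s) (-1) ^+ s *: bas k (perm_braid N off s).

Lemma sign_odd m (s : 'S_m) : (-1) ^+ s = (-1) ^+ inv s :> k.
Proof. by rewrite -[RHS]signr_odd -odd_inv. Qed.

(** Every permutation is uniquely a shuffle after a permutation of the two blocks, with
    lengths, signs and braids multiplying accordingly. *)
Lemma shuffler_symmetrizer off p q : (off + (p + q) <= N)%N ->
  gmul (shuffler off p q) (gmul (symmetrizer off p) (symmetrizer (off + p) q)) =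
  symmetrizer off (p + q).
Proof.
move=> mN; have -> : gmul (symmetrizer off p) (symmetrizer (off + p) q) =
  \sum_(s : 'S_p) \sum_(t : 'S_q) gmul ((-1) ^+ s *: bas k (perm_braid N off s))
    ((-1) ^+ t *: bas k (perm_braid N (off + p) t)).
  by rewrite gmul_suml; apply: eq_bigr => s _; rewrite gmul_sumr.
rewrite /symmetrizer big_shuffle_block /shuffler gmul_suml.
apply: eq_bigr => g gS; rewrite gmul_sumr; apply: eq_bigr => s _.
rewrite gmul_sumr; apply: eq_bigr => t _.
rewrite !(gmulZl, gmulZr) !gmul_bas2 !scalerA perm_braid_shuffle_block //.
by rewrite !sign_odd inv_shuffle_block // !exprD; congr (_ *: _); ring.
Qed.

Lemma symmetrizer_unipotent off m : (off + m <= N)%N -> unipotent (symmetrizer off m).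
Proof.
move=> mN; rewrite /unipotent /symmetrizer (bigD1 1%g) //=.
have -> : perm_braid N off (1 : 'S_m)%g = 1%g.
  by rewrite (@perm_braid_word _ _ _ _ [::]) //; split; rewrite ?inv1 // => x; rewrite perm1.
rewrite odd_perm1 expr0 scale1r addrAC subrr add0r rpred_sum // => s s1.
rewrite rpredZ // span_bas // braid_len_perm // ltz_nat lt0n.
by apply: contra s1 => /eqP /inv_eq0 ->.
Qed.

Definition strands_in (a b : nat) (g : G) : Prop :=
  exists2 u, letters N u && all (fun i => (a <= i) && (i.+1 < b))%N u & g = ev u.

Lemma strands_in_sub a b a' b' g : (a' <= a)%N -> (b <= b')%N ->
  strands_in a b g -> strands_in a' b' g.
Proof.
move=> aa bb [u /andP [uN ua] ->]; exists u => //; rewrite uN /=.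
by apply/allP => i /(allP ua); lia.
Qed.

Lemma strands_in_commute a b c d g h : (b <= c)%N ->
  strands_in a b g -> strands_in c d h -> commute g h.
Proof.
move=> bc [u /andP [uN ua] ->] [v /andP [vN va] ->].
elim: u uN ua => [|i u IH] /=; first by move=> *; apply: commute_sym; apply: commute1.
case/andP=> iN uN /andP [ib ub]; apply: commute_sym; apply: commuteM; last first.
  by apply: commute_sym; apply: IH.
apply: ev_far => //; apply/allP => j /(allP va); rewrite /far; lia.
Qed.

Lemma perm_braid_strands off m (s : 'S_m) : (off + m <= N)%N ->
  strands_in off (off + m) (perm_braid N off s).
Proof.
move=> mN; have ws := word_of_reduced s; rewrite (perm_braid_word mN ws).
exists (map (addn off) (map val (reduced_word s))) => //.
case: ws => uN _ _; apply/andP; split.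
  by apply/allP => _ /mapP [j /(allP uN) jm ->]; move: jm; lia.
by apply/allP => _ /mapP [j /(allP uN) jm ->]; move: jm; lia.
Qed.

Fixpoint sym_parts (off : nat) (l : seq nat) : V :=
  if l is a :: l' then gmul (symmetrizer off a) (sym_parts (off + a) l')
  else bas k 1%g.

Lemma sym_parts_unipotent off l : (off + sumn l <= N)%N -> unipotent (sym_parts off l).
Proof.
elim: l off => [|a l IH] off /= lN; first by rewrite /unipotent subrr rpred0.
apply: unipotentM; first by apply: symmetrizer_unipotent; lia.
by apply: IH; lia.
Qed.

Lemma shuffler_strands off p q : (off + (p + q) <= N)%N ->
  shuffler off p q \in span (strands_in off (off + (p + q))).
Proof.
move=> mN; rewrite /shuffler rpred_sum // => s _; rewrite rpredZ // span_bas //.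
exact: perm_braid_strands.
Qed.

Lemma symmetrizer_strands off m : (off + m <= N)%N ->
  symmetrizer off m \in span (strands_in off (off + m)).
Proof.
move=> mN; rewrite /symmetrizer rpred_sum // => s _; rewrite rpredZ // span_bas //.
exact: perm_braid_strands.
Qed.

Definition merge_shuffler (off i : nat) (l : seq nat) : V :=
  shuffler (off + sumn (take i l)) (nth 0%N l i) (nth 0%N l i.+1).

(** Right multiplication by the symmetrizers turns the shuffle sum of a merge into a bare
    merge; the symmetrizers of the other blocks commute with the shuffles. *)
Lemma merge_shuffler_sym off i l : (i.+1 < size l)%N -> (off + sumn l <= N)%N ->
  gmul (merge_shuffler off i l) (sym_parts off l) = sym_parts off (merge_parts i l).
Proof.
elim: i off l => [|i IH] off [|a [|b l]] il lN; try discriminate il.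
  have gmul4 (x y z w : V) : gmul x (gmul y (gmul z w)) = gmul (gmul x (gmul y z)) w.
    by rewrite (gmulA x) (gmulA y).
  rewrite merge_parts0 /merge_shuffler /= addn0.
  apply: etrans (gmul4 _ _ _ _) _.
  rewrite shuffler_symmetrizer ?addnA //.
  by move: lN => /=; lia.
have lN' : (off + a + sumn (b :: l) <= N)%N by move: lN => /=; lia.
have -> : merge_shuffler off i.+1 [:: a, b & l] = merge_shuffler (off + a) i (b :: l).
  by rewrite /merge_shuffler /= addnA.
have := IH (off + a)%N (b :: l) il lN'; set T := merge_shuffler _ _ _ => IHe.
rewrite merge_partsS.
change (gmul T (gmul (symmetrizer off a) (sym_parts (off + a) (b :: l))) =
  gmul (symmetrizer off a) (sym_parts (off + a) (merge_parts i (b :: l)))).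
rewrite -IHe; apply: etrans (esym (gmulA _ _ _)) (etrans _ (gmulA _ _ _)).
apply: (congr1 (mul_by (sym_parts (off + a) (b :: l)))); symmetry.
rewrite /T {T IHe}.
apply: (gmul_commute (A := strands_in off (off + a)) (B := strands_in (off + a) N)).
- by move=> g h; apply: strands_in_commute.
- by apply: symmetrizer_strands; move: lN => /=; lia.
have sz : (sumn (take i (b :: l)) + (nth 0%N (b :: l) i + nth 0%N (b :: l) i.+1) <= sumn (b :: l))%N.
  rewrite -[X in (_ <= sumn X)%N](cat_take_drop i) sumn_cat leq_add2l.
  rewrite (drop_nth 0%N) ?(drop_nth 0%N (n := i.+1)) //=; last by apply: ltnW.
  by rewrite addnA leq_addr.
apply: (span_mono (A := strands_in (off + a + sumn (take i (b :: l))) 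
  (off + a + sumn (take i (b :: l)) + (nth 0%N (b :: l) i + nth 0%N (b :: l) i.+1)))).
  by move=> g; apply: strands_in_sub; rewrite ?leq_addr //; lia.
by apply: shuffler_strands; lia.
Qed.

End Symmetrizer.

Section Compositions.
Variable N : nat.

Definition cparts p (l : composition N p) : seq nat := parts (val l).

Lemma cpartsP p (l : composition N p) :
  [/\ all (leq 1) (cparts l), sumn (cparts l) = N & (size (cparts l))%:Z = p - N%:Z].
Proof.
have /and3P [l1 /eqP l2 /eqP l3] := valP l; split=> //.
by rewrite /cparts /parts size_map.
Qed.

Lemma cparts_inj p : injective (@cparts p).
Proof. by move=> l l' /inj_map e; apply/val_inj/val_inj/e/val_inj. Qed.

Lemma leq_size_sumn l : all (leq 1) l -> (size l <= sumn l)%N.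
Proof. by elim: l => //= a l IH /andP [a0 /IH]; lia. Qed.

Lemma leq_mem_sumn l a : a \in l -> (a <= sumn l)%N.
Proof.
elim: l => //= b l IH; rewrite inE => /orP [/eqP ->|/IH]; first exact: leq_addr.
by move=> le; apply: leq_trans le (leq_addl _ _).
Qed.

Lemma composition_of p l : all (leq 1) l -> sumn l = N -> (size l)%:Z = p - N%:Z ->
  exists c : composition N p, cparts c = l.
Proof.
move=> l0 lN lp; have sz : (size (map (@inord N) l) <= N)%N.
  by rewrite size_map -lN leq_size_sumn.
have pE : parts (Bseq sz) = l.
  rewrite /parts /= -map_comp -[RHS]map_id; apply/eq_in_map => a al /=.
  by rewrite inordK // ltnS -lN leq_mem_sumn.
have cP : is_composition p (Bseq sz).
  by rewrite /is_composition pE l0 lN eqxx /= size_map lp eqxx.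
by exists (exist _ (Bseq sz) cP).
Qed.

End Compositions.

Section Salvetti.
Variables (k : comNzRingType) (N : nat).
Local Notation G := (braid_group N).
Local Notation V := (free k G).

Definition cells (p : int) : choiceType := (composition N p * G)%type.
Definition sal (p : int) := free k (cells p).

(** The summand of the complex that belongs to the composition l, as a left module over
    the group algebra. *)
Definition put p (l : composition N p) : {linear V -> sal p} :=
  lin (fun g => bas k ((l, g) : cells p)).

Lemma put_bas p (l : composition N p) g : put l (bas k g) = bas k ((l, g) : cells p).
Proof. exact: lin_bas. Qed.

(** The coefficient of the differential from m to l is an element of the group algebra that
    acts by right multiplication on the position. *)
Definition coef p p' (m : composition N p) (l : composition N p') : V :=
  \sum_(i < (size (cparts l)).-1 | merge_parts i (cparts l) == cparts m)
    (-1) ^+ i *: merge_shuffler k N 0 i (cparts l).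

(** The degree p is that of the Fox-Neuwirth complex, so that it goes up, from coarse to
    fine compositions: the homological degree is 2 N - p. *)
Definition sal_d p p' : {linear sal p -> sal p'} :=
  lin (fun c : cells p => \sum_(l : composition N p')
    put l (gmul (bas k c.2) (coef c.1 l))).

Lemma sal_d_put p p' (m : composition N p) x :
  sal_d p p' (put m x) = \sum_l put l (gmul x (coef m l)).
Proof.
pose F : V -> sal p' := fun x => \sum_l put l (gmul x (coef m l)).
have Flin : linear F.
  move=> c y z; rewrite /F scaler_sumr -big_split; apply: eq_bigr => l _ /=.
  by rewrite gmulDl gmulZl linearP.
pose fF := GRing.isLinear.Build k V (sal p') _ F Flin.
pose FL : {linear V -> sal p'} := HB.pack F fF.
apply: (free_eq (f := sal_d p p' \o put m) (g := FL)) => g.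
by rewrite /= put_bas /sal_d lin_bas.
Qed.

Lemma coef_sym p p' (m : composition N p) (l : composition N p') :
  gmul (coef m l) (sym_parts k N 0 (cparts l)) =
  inc k (cparts m) (cparts l) *: sym_parts k N 0 (cparts m).
Proof.
have [l0 lN _] := cpartsP l.
rewrite /coef gmul_suml /inc scaler_suml; apply: eq_bigr => i /eqP e.
by rewrite gmulZl merge_shuffler_sym ?lN ?e // -ltn_predRL.
Qed.

(** After right multiplication by the symmetrizers of r this is the square of the incidence
    matrix, and the symmetrizers are regular. *)
Lemma coef_sq p p' p'' (m : composition N p) (r : composition N p'') :
  p'' = p' + 1 -> \sum_(l : composition N p') gmul (coef m l) (coef l r) = 0.
Proof.
move=> pp; have [r0 rN rp] := cpartsP r.
apply: (@unipotent_regular _ _ (sym_parts k N 0 (cparts r))).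
  by apply: sym_parts_unipotent; rewrite rN.
rewrite gmul_suml.
under eq_bigr => l _ do rewrite gmulA coef_sym gmulZr coef_sym scalerA.
rewrite -scaler_suml; suff -> : \sum_(l : composition N p')
    inc k (cparts l) (cparts r) * inc k (cparts m) (cparts l) = 0 by rewrite scale0r.
apply: etrans (inc_sq k (cparts m) r0).
under eq_bigr => l _ do rewrite {1}/inc mulr_suml.
rewrite [LHS](exchange_big_dep predT) //=; apply: eq_bigr => i _.
have ir : (i.+1 < size (cparts r))%N by rewrite -ltn_predRL.
have [|||c cE] := @composition_of N p' (merge_parts i (cparts r)).
- exact: pos_merge.
- by rewrite sumn_merge.
- by rewrite size_merge //; lia.
rewrite (bigD1 c) ?cE //= big1 ?addr0 // => l /andP [/eqP e ne].
by case/eqP: ne; apply: cparts_inj; rewrite cE.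
Qed.

Lemma sal_dd p p' p'' x : p'' = p' + 1 -> sal_d p' p'' (sal_d p p' x) = 0.
Proof.
move=> pp; apply: (free_eq (f := sal_d p' p'' \o sal_d p p') (g := \0)) => -[m g] /=.
rewrite -(put_bas m) sal_d_put linear_sum /=.
under eq_bigr => l _ do rewrite sal_d_put.
rewrite exchange_big big1 //= => r _.
rewrite -linear_sum -[RHS](linear0 (put r)); congr (put r _).
under eq_bigr => l _ do rewrite gmulA.
by rewrite -gmul_sumr (coef_sq _ _ pp) gmul0r.
Qed.

End Salvetti.

#[global] Opaque put sal_d.

(** * The filtration by tops *)

Fixpoint twists (off : nat) (l : seq nat) : seq nat :=
  if l is a :: l' then half_twist off a ++ twists (off + a) l' else [::].

Lemma mem_twists off l i : i \in twists off l -> (off <= i)%N && (i.+1 < off + sumn l)%N.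
Proof.
elim: l off => //= a l IH off; rewrite mem_cat => /orP [/mem_half_twist|/IH]; lia.
Qed.

Lemma letters_twists N off l : (off + sumn l <= N)%N -> letters N (twists off l).
Proof. by move=> lN; apply/allP => i /mem_twists; lia. Qed.

Lemma twists_ones off s l : twists off (nseq s 1%N ++ l) = twists (off + s) l.
Proof. by elim: s off => [|s IH] off /=; rewrite ?addn0 // IH addn1 addSnnS. Qed.

Lemma take_ones s m : all (leq 1) m -> (s <= sumn m)%N ->
  (forall j, (j < s)%N -> take j m = nseq j 1%N -> (nth 0%N m j <= 1)%N) ->
  take s m = nseq s 1%N /\ (s <= size m)%N.
Proof.
move=> m0; elim: s => [|s IH] sm H; first by rewrite take0.
have [||e sz] := IH; first exact: ltnW.
  by move=> j js; apply: H; apply: ltnW.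
have sz' : (s < size m)%N.
  rewrite ltn_neqAle sz andbT; apply: contraTneq sm => sE.
  by rewrite -(take_oversize (eq_leq (esym sE))) e sumn_nseq mul1n ltnn.
split=> //; rewrite (take_nth 0%N sz') e.
have -> : nth 0%N m s = 1%N.
  apply/eqP; rewrite eqn_leq H //=.
  by move/allP: m0; apply; apply: mem_nth.
by rewrite -cats1 -[s.+1]addn1 nseqD.
Qed.

Lemma take_nth_bound i l : (i.+1 < size l)%N -> 
  (sumn (take i l) + (nth 0%N l i + nth 0%N l i.+1) <= sumn l)%N.
Proof.
move=> il; rewrite -[X in (_ <= sumn X)%N](cat_take_drop i) sumn_cat leq_add2l.
rewrite (drop_nth 0%N) ?(drop_nth 0%N (n := i.+1)) //=; last by apply: ltnW.
by rewrite addnA leq_addr.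
Qed.

Section TopShuffle.
Variable N : nat.
Local Notation ev := (positive_braid N).

(** This is why the longest shuffle preserves the top of a cell. *)
Lemma top_shuffle off i l : (i.+1 < size l)%N -> (off + sumn l <= N)%N ->
  (perm_braid N (off + sumn (take i l)) (max_shuffle (nth 0%N l i) (nth 0%N l i.+1)) *
   ev (twists off l) = ev (twists off (merge_parts i l)))%g.
Proof.
elim: i off l => [|i IH] off [|a [|b l]] il lN; try discriminate il.
  rewrite merge_parts0 /= addn0 !ev_cat !mulgA -(mulgA (perm_braid _ _ _)).
  by rewrite perm_braid_max_shuffle ?addnA //; move: lN => /=; lia.
have lN' : (off + a + sumn (b :: l) <= N)%N by move: lN => /=; lia.
have := IH (off + a)%N (b :: l) il lN'; rewrite merge_partsS.
rewrite -[take i.+1 _]/(a :: take i (b :: l)) -[sumn (a :: _)]/(a + sumn (take i (b :: l)))%N addnA.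
rewrite -[nth 0%N [:: a, b & l] i.+1]/(nth 0%N (b :: l) i).
rewrite -[nth 0%N [:: a, b & l] i.+2]/(nth 0%N (b :: l) i.+1).
set T := perm_braid _ _ _ => IHe.
rewrite -[twists off (a :: merge_parts _ _)]/(half_twist off a ++ 
   twists (off + a) (merge_parts i (b :: l))).
rewrite -[twists off (a :: b :: l)]/(half_twist off a ++ twists (off + a) (b :: l)).
rewrite !(ev_cat _ (half_twist off a)) -IHe !mulgA; congr (_ * _)%g; symmetry.
have aN : (off + a <= N)%N by move: lN => /=; lia.
change (commute (ev (half_twist off a)) T).
apply: (@strands_in_commute N off (off + a) (off + a) N) => //.
  exists (half_twist off a) => //; apply/andP; split; apply/allP => j /mem_half_twist; lia.
have := take_nth_bound (il : (i.+1 < size (b :: l))%N) => sz.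
apply: strands_in_sub (perm_braid_strands _ _); rewrite ?leq_addr //; lia.
Qed.

Lemma inv_top_shuffle off i l : (i.+1 < size l)%N -> (off + sumn l <= N)%N ->
  (inv (max_shuffle (nth 0%N l i) (nth 0%N l i.+1)) + size (twists off l) =
   size (twists off (merge_parts i l)))%N.
Proof.
move=> il lN; have := congr1 (@braid_len N) (top_shuffle il lN).
have sz : (off + sumn (take i l) + (nth 0%N l i + nth 0%N l i.+1) <= N)%N.
  by apply: leq_trans lN; rewrite -addnA leq_add2l take_nth_bound.
rewrite braid_lenM braid_len_perm // !braid_len_ev ?letters_twists ?sumn_merge //.
lia.
Qed.

End TopShuffle.

Section Filtration.
Variables (k : comNzRingType) (N : nat).
Local Notation G := (braid_group N).
Local Notation ev := (positive_braid N).
Local Notation sal := (sal k N).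
Local Notation sal_d := (sal_d k N).

Definition delta p (m : composition N p) : G := ev (twists 0 (cparts m)).
Definition height p (c : cells N p) : int := braid_len (c.2 * delta c.1)%g.
Definition delta_sign p (m : composition N p) : k := (-1) ^+ size (twists 0 (cparts m)).

Lemma delta_letters p (m : composition N p) : letters N (twists 0 (cparts m)).
Proof. by apply: letters_twists; have [_ -> _] := cpartsP m. Qed.

Lemma delta_positive p (m : composition N p) : is_positive (delta m).
Proof. exact/is_positive_ev/delta_letters. Qed.

Lemma delta_len p (m : composition N p) : braid_len (delta m) = (size (twists 0 (cparts m)))%:Z.
Proof. exact/braid_len_ev/delta_letters. Qed.

Lemma delta_sign2 p (m : composition N p) : delta_sign m * delta_sign m = 1.
Proof. by rewrite /delta_sign -expr2 sqrr_sign. Qed.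

Definition low_cell p (t : int) (c : cells N p) := is_positive c.2 /\ height c < t.
Local Notation low p t := (@span k (cells N p) (@low_cell p t)).

(** The cell of composition m with top h, with the sign that makes the leading part of the
    differential the simplicial one. *)
Definition top_cell p (m : composition N p) (h : G) : sal p :=
  delta_sign m *: bas k ((m, h * (delta m)^-1)%g : cells N p).

Lemma bas_top p (m : composition N p) g :
  bas k ((m, g) : cells N p) = delta_sign m *: top_cell m (g * delta m)%g.
Proof. by rewrite /top_cell scalerA delta_sign2 scale1r mulgK. Qed.

(** A shuffle c contributes the cell with position g c, whose top has length at most that of
    the top h = g Delta_m, with equality only for the longest shuffle; for that one the top
    is h itself. *)
Lemma sal_d_top p p' (m : composition N p) h : is_positive (h * (delta m)^-1)%g ->
  sal_d p p' (top_cell m h) - \sum_l inc k (cparts m) (cparts l) *: top_cell l h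
    \in low p' (braid_len h).
Proof.
set g := (h * _)%g => gP; rewrite /top_cell linearZ /= -/g.
rewrite -(put_bas k m g) sal_d_put scaler_sumr -sumrB rpred_sum // => l _.
have [l0 lN _] := cpartsP l.
rewrite /coef /inc gmul_sumr (linear_sum (put k l)) scaler_sumr scaler_suml -sumrB.
apply: rpred_sum => i /eqP e.
have il : (i.+1 < size (cparts l))%N by rewrite -ltn_predRL.
have := take_nth_bound il; rewrite lN => bN.
rewrite gmulZr (linearZZ (put k l)) /merge_shuffler /shuffler.
rewrite (bigD1 (max_shuffle _ _)) ?max_shuffle_shuffle //=.
rewrite gmulDr (linearD (put k l)) !scalerDr gmulZr (linearZZ (put k l)) gmul_bas2 put_bas.
have lN' : (0 + sumn (cparts l) <= N)%N by rewrite lN.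
have ts := top_shuffle il lN'; rewrite add0n in ts *.
have is_ := inv_top_shuffle il lN'; rewrite e in is_ ts.
rewrite [X in X + _ - _](_ : _ = (-1) ^+ i *: (delta_sign l *: bas k ((l, h * (delta l)^-1)%g : cells N p'))); last first.
  rewrite !scalerA sign_odd; congr (_ *: bas k (l, _)).
    rewrite /delta_sign -is_ exprD; 
    set a := inv _.
    have := sqrr_sign k a; move: ((-1) ^+ a : k) ((-1) ^+ size _ : k) ((-1) ^+ i : k) => x y z x2.
    by transitivity (x ^+ 2 * (z * y)); [ring | rewrite x2 mul1r].
  have dm : delta m = (perm_braid N (sumn (take i (cparts l)))
      (max_shuffle (nth 0%N (cparts l) i) (nth 0%N (cparts l) i.+1)) * delta l)%g by [].
  by rewrite /g dm invgM !mulgA mulgKV.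
rewrite -/(top_cell l h) addrAC subrr add0r !rpredZ // gmul_sumr (linear_sum (put k l)) rpred_sum //= => s /andP [sS ns].
rewrite gmulZr (linearZZ (put k l)) rpredZ // gmul_bas2 put_bas span_bas //.
have [w wN [wE wS]] := is_positive_perm_braid s bN.
split=> /=; first by rewrite wE; apply: is_positiveM => //; apply: is_positive_ev.
rewrite /height /= -mulgA (braid_lenM g) (braid_lenM (perm_braid _ _ _)) delta_len braid_len_perm //.
have -> : braid_len h = braid_len g + (size (twists 0 (cparts m)))%:Z.
  by rewrite -delta_len -braid_lenM /g mulgKV.
have [le eqv] := inv_shuffle sS; have [_ [_ eqm]] := inv_shuffle (max_shuffle_shuffle (nth 0%N (cparts l) i) (nth 0%N (cparts l) i.+1)).
have eqm' := eqm erefl.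
have ne : inv s <> inv (max_shuffle (nth 0%N (cparts l) i) (nth 0%N (cparts l) i.+1)).
  by move=> es; case/eqP: ns; apply/eqv; rewrite es.
lia.
Qed.

End Filtration.

(** * The contracting homotopy *)

Section Descent.
Variable N : nat.
Local Notation G := (braid_group N).

Definition first_descent (h : G) : nat :=
  find (fun s => `[< is_positive (h * (sigma N s)^-1)%g >]) (iota 0 N.-1).

Lemma first_descent_le h : (first_descent h <= N.-1)%N.
Proof. by rewrite -[X in (_ <= X)%N](size_iota 0 N.-1) find_size. Qed.

Lemma first_descentP h : (first_descent h < N.-1)%N ->
  is_positive (h * (sigma N (first_descent h))^-1)%g.
Proof.
move=> hN; have := hN; rewrite -[X in (_ < X)%N](size_iota 0 N.-1) -has_find.
by move=> /(nth_find 0%N) /asboolP; rewrite nth_iota // add0n.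
Qed.

Lemma before_first_descent h j : (j < first_descent h)%N ->
  ~ is_positive (h * (sigma N j)^-1)%g.
Proof.
move=> jh; have := before_find 0%N jh; rewrite nth_iota; last first.
  by apply: leq_trans jh (first_descent_le h).
by move=> /asboolP; rewrite add0n.
Qed.

Lemma first_descent_lt h : is_positive h -> h <> 1%g -> (first_descent h < N.-1)%N.
Proof.
case=> u; case/lastP: u => [|u s] uN -> // _.
rewrite -[X in (_ < X)%N](size_iota 0 N.-1) -has_find; apply/hasP; exists s.
  rewrite mem_iota /= ltn_predRL.
  by move: uN; rewrite /letters all_rcons => /andP [].
apply/asboolP; exists u; first by move: uN; rewrite /letters all_rcons => /andP [].
by rewrite -cats1 ev_cat /= mulg1 mulgK.
Qed.

Lemma drop_take_ones s (m : seq nat) : (0 < nth 0%N m s)%N -> take s m = nseq s 1%N ->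
  m = nseq s 1%N ++ nth 0%N m s :: drop s.+1 m.
Proof.
move=> ms e; have sz : (s < size m)%N.
  by rewrite ltnNge; apply: contraTN ms => sz; rewrite nth_default.
by rewrite -{1}e -drop_nth // cat_take_drop.
Qed.

(** A part of m larger than 1 gives right descents of g Delta_m on its strands, hence the
    parts before the first descent are equal to 1. *)
Lemma ones_before_descent p (m : composition N p) g : is_positive g ->
  let s := first_descent (g * delta m)%g in
  take s (cparts m) = nseq s 1%N /\ (s <= size (cparts m))%N.
Proof.
move=> gP s; have [m0 mN _] := cpartsP m; apply: take_ones => //.
  by rewrite mN; apply: leq_trans (first_descent_le _) (leq_pred _).
move=> j js ej; rewrite leqNgt; apply/negP => aj.
case: (before_first_descent js).
have mE := drop_take_ones (ltnW aj) ej.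
have sE := congr1 sumn mE; rewrite mN sumn_cat sumn_nseq mul1n /= in sE.
rewrite /delta mE twists_ones add0n /= ev_cat -!mulgA; apply: is_positiveM => //.
rewrite mulgA; apply: is_positive_half_twist_end => //; last by lia.
  by apply: letters_twists; lia.
by apply/allP => i /mem_twists; rewrite /far; lia.
Qed.

Lemma twists_merge_ones s (m : seq nat) : take s m = nseq s 1%N -> nth 0%N m s = 1%N ->
  (s.+1 < size m)%N ->
  twists 0 (merge_parts s m) = drun s (nth 0%N m s.+1) ++ twists 0 m /\
  twists 0 m = half_twist s.+1 (nth 0%N m s.+1) ++
    twists (s.+1 + nth 0%N m s.+1) (drop s.+2 m).
Proof.
move=> e m1 sz; have mE : m = nseq s 1%N ++ [:: 1%N, nth 0%N m s.+1 & drop s.+2 m].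
  by rewrite -e -(drop_nth 0%N) // -m1 -(drop_nth 0%N) ?(ltnW sz) // cat_take_drop.
have E2 : twists 0 m = half_twist s.+1 (nth 0%N m s.+1) ++
    twists (s.+1 + nth 0%N m s.+1) (drop s.+2 m).
  by rewrite [in LHS]mE twists_ones add0n /= addn1.
split=> //; rewrite {}E2 /merge_parts e twists_ones add0n m1 /= add1n /=.
by rewrite -catA addnS addSn.
Qed.

Lemma size_after_ones s (m : seq nat) : take s m = nseq s 1%N -> nth 0%N m s = 1%N ->
  (s.+1 < sumn m)%N -> (s.+1 < size m)%N.
Proof.
move=> e m1 sm; rewrite ltnNge; apply: contraTN sm => sz.
rewrite -leqNgt (drop_take_ones _ e) ?m1 // drop_oversize // sumn_cat sumn_nseq /=.
by rewrite mul1n addn1.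
Qed.

(** The top h is divisible by Delta_m and by sigma_s, where s is the strand of a part 1 of m
    just before a part q.  Stripping sigma_s from the half twist on the q strands gives the
    run that completes this half twist to the one of the merged part. *)
Lemma merge_is_positive p p' (m : composition N p) (m' : composition N p') h :
  is_positive (h * (delta m)^-1)%g -> (first_descent h < N.-1)%N ->
  nth 0%N (cparts m) (first_descent h) = 1%N ->
  cparts m' = merge_parts (first_descent h) (cparts m) ->
  is_positive (h * (delta m')^-1)%g.
Proof.
move=> gP hN m1 mE; have := ones_before_descent m gP; rewrite mulgKV => -[e _].
have [m0 mN _] := cpartsP m.
have sz : ((first_descent h).+1 < size (cparts m))%N.
  by apply: size_after_ones => //; rewrite mN -ltn_predRL.
have [E1 E2] := twists_merge_ones e m1 sz; have := first_descentP hN.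
set s := first_descent h in E1 E2 sz e m1 mE hN *; set q := nth 0%N _ s.+1 in E1 E2.
have q0 : (0 < q)%N by move/allP: m0; apply; apply: mem_nth.
have sN : (s + q + sumn (drop s.+2 (cparts m)) < N)%N.
  have := congr1 sumn (drop_take_ones (eq_leq (esym m1)) e).
  rewrite (drop_nth 0%N) // sumn_cat sumn_nseq mN m1 /= mul1n -/q; lia.
move=> hs; rewrite /delta mE E1 ev_cat invgM mulgA.
apply: (strip_half_twist (w := twists (s.+1 + q) (drop s.+2 (cparts m)))) => //.
- by lia.
- by apply: letters_twists; lia.
- by apply/allP => i /mem_twists; rewrite /far; lia.
- by rewrite -(mulgA (h * _)%g) -ev_cat -E2 mulgKV.
Qed.

End Descent.

Section Exactness.
Variables (k : comNzRingType) (N : nat).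
Local Notation sal := (sal k N).
Local Notation sal_d := (sal_d k N).
Local Notation low p t := (@span k (cells N p) (@low_cell N p t)).
Local Notation top := (@top_cell k N _).

Lemma top_low p (m : composition N p) h t : is_positive (h * (delta m)^-1)%g ->
  braid_len h < t -> top m h \in low p t.
Proof.
move=> gP ht; rewrite /top_cell rpredZ // span_bas //; split=> //=.
by rewrite /height /= mulgKV.
Qed.

(** The contraction of the simplex of the cells with a given top h: merge the part at the
    first descent s with the next one, if that part is 1. *)
Definition cone_cell p p' (c : cells N p) : sal p' :=
  let h := (c.2 * delta c.1)%g in let s := first_descent h in
  if (s < N.-1)%N && (nth 0%N (cparts c.1) s == 1%N) then
    (-1) ^+ s *: (delta_sign k c.1 *:
      \sum_(m : composition N p' | cparts m == merge_parts s (cparts c.1)) top m h)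
  else 0.

Definition sal_cone p p' : {linear sal p -> sal p'} := lin (@cone_cell p p').

Lemma cone_top p p' (m : composition N p) h : sal_cone p p' (top m h) =
  ((first_descent h < N.-1)%N && (nth 0%N (cparts m) (first_descent h) == 1%N))%:R *:
  ((-1) ^+ first_descent h *:
    \sum_(m' : composition N p' | cparts m' == merge_parts (first_descent h) (cparts m))
      top m' h).
Proof.
rewrite /top_cell linearZZ /sal_cone lin_bas /cone_cell /= mulgKV.
case: ifP => _; last by rewrite scale0r scaler0.
by rewrite scale1r !scalerA mulrAC delta_sign2 mul1r.
Qed.

Lemma cone_low p p' t x : x \in low p t -> sal_cone p p' x \in low p' t.
Proof.
apply: span_lin => -[m g] [/= gP ht]; rewrite (bas_top k m g) linearZZ rpredZ // cone_top.
case: andP => [[hN /eqP m1]|_]; last by rewrite scale0r rpred0.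
rewrite !rpredZ // rpred_sum // => m' /eqP mE; apply: top_low => //.
by apply: merge_is_positive mE => //; rewrite mulgK.
Qed.

(** Modulo cells with lower tops the differential and the contraction preserve h and are
    the simplicial ones, and the claim is [cone_identity]. *)
Lemma cone_homotopy p p' p'' (m : composition N p) h : p = p' + 1 -> p'' = p + 1 ->
  is_positive (h * (delta m)^-1)%g -> (first_descent h < N.-1)%N ->
  sal_d p' p (sal_cone p p' (top m h)) + sal_cone p'' p (sal_d p p'' (top m h)) - top m h
    \in low p (braid_len h).
Proof.
move=> pp' pp'' gP hN; set s := first_descent h.
have [m0 mN mp] := cpartsP m.
have [e sz] : take s (cparts m) = nseq s 1%N /\ (s <= size (cparts m))%N.
  by have := ones_before_descent m gP; rewrite mulgKV.
have sN : (s.+1 < sumn (cparts m))%N by rewrite mN -ltn_predRL.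
pose cA (l : composition N p) : k :=
  (nth 0%N (cparts m) s == 1%N)%:R * inc k (merge_parts s (cparts m)) (cparts l).
pose cB (l : composition N p) : k :=
  (1 < nth 0%N (cparts l) s)%N%:R * inc k (cparts m) (split_off s (cparts l)).
have A : sal_d p' p (sal_cone p p' (top m h)) -
    (-1) ^+ s *: \sum_l cA l *: top l h \in low p (braid_len h).
  rewrite cone_top -/s hN /= /cA; case: eqP => [m1|_]; last first.
    rewrite scale0r linear0 sub0r rpredN rpredZ // rpred_sum // => l _.
    by rewrite mul0r scale0r rpred0.
  rewrite scale1r linearZZ -scalerBr rpredZ //.
  have sz' : (s.+1 < size (cparts m))%N by apply: size_after_ones.
  have [|||c cE] := @composition_of N p' (merge_parts s (cparts m)).
  - exact: pos_merge.
  - by rewrite sumn_merge.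
  - by rewrite size_merge //; move: mp pp' sz'; lia.
  rewrite (big_pred1 c) => [|m']; last by rewrite /= -cE (inj_eq (@cparts_inj _ _)).
  under eq_bigr do rewrite mul1r -cE.
  apply: sal_d_top; apply: merge_is_positive cE => //.
have B : sal_cone p'' p (sal_d p p'' (top m h)) -
    (-1) ^+ s *: \sum_l cB l *: top l h \in low p (braid_len h).
  have := @cone_low _ p _ _ (sal_d_top k p'' gP).
  have L : sal_cone p'' p (\sum_l inc k (cparts m) (cparts l) *: top l h) =
      \sum_l sal_cone p'' p (inc k (cparts m) (cparts l) *: top l h).
    exact: (linear_sum (sal_cone p'' p)).
  rewrite (linearB (sal_cone p'' p)) {}L.
  suff -> : (-1) ^+ s *: \sum_l cB l *: top l h =
    \sum_(r : composition N p'') sal_cone p'' p (inc k (cparts m) (cparts r) *: top r h) by [].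
  rewrite scaler_sumr.
  have E (r : composition N p'') : sal_cone p'' p (inc k (cparts m) (cparts r) *: top r h) =
      \sum_(l : composition N p) ((cparts l == merge_parts s (cparts r)) &&
        (nth 0%N (cparts r) s == 1%N))%:R *: ((-1) ^+ s *: (inc k (cparts m) (cparts r) *: top l h)).
    rewrite linearZZ cone_top -/s hN andTb big_mkcond.
    rewrite scaler_sumr !scaler_sumr; apply: eq_bigr => l _.
    move: (top l h) (inc k _ _) (cparts l == _) (_ == 1%N) => u a [] [];
      rewrite ?(scale1r, scale0r, scaler0); [|by []|by []|by []].
    by rewrite !scalerA mulrC.
  rewrite [RHS](eq_bigr _ (fun r _ => E r)).
  rewrite [RHS]exchange_big; apply: eq_bigr => l _ /=.
  have [l0 lN lp] := cpartsP l.
  (* Only the composition obtained by splitting off a part 1 contracts to l. *)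
  have R (r : composition N p'') : (cparts l == merge_parts s (cparts r)) &&
      (nth 0%N (cparts r) s == 1%N) -> cparts r = split_off s (cparts l) /\
      (1 < nth 0%N (cparts l) s)%N.
    case/andP=> /eqP le /eqP r1; have [r0 rN rp] := cpartsP r.
    have sr : (s < size (cparts r))%N.
      by rewrite ltnNge; apply/negP => sr; rewrite nth_default in r1.
    have sr' : (s.+1 < size (cparts r))%N.
      rewrite ltn_neqAle sr andbT; apply/negP => /eqP sE.
      have : size (cparts l) = size (cparts r).
        rewrite le /merge_parts size_cat /= size_takel ?(ltnW sr) // drop_oversize /=.
          by rewrite addn1.
        by rewrite -sE ltnW.
      by lia.
    split; first by rewrite le split_off_merge.
    rewrite le /merge_parts nth_cat size_takel ?(ltnW sr) // ltnn subnn /= r1.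
    have : (0 < nth 0%N (cparts r) s.+1)%N by move/allP: r0; apply; apply: mem_nth.
    by lia.
  rewrite /cB; case: ltnP => ls; last first.
    rewrite mul0r scale0r scaler0 big1 // => r _.
    case: (boolP (_ && _)) => [/R [_]|_]; last by rewrite scale0r.
    by rewrite ltnNge ls.
  have l0s : (0 < nth 0%N (cparts l) s)%N by apply: ltnW.
  have [|||c cE] := @composition_of N p'' (split_off s (cparts l)).
  - exact: pos_split_off.
  - by rewrite sumn_split_off.
  - by rewrite size_split_off // pp'' -addn1 PoszD lp; ring.
  rewrite (bigD1 c) //= big1 ?addr0 => [|r ne].
    rewrite cE merge_split_off // eqxx /=.
    have -> : nth 0%N (split_off s (cparts l)) s = 1%N.
      have ss : (s < size (cparts l))%N.
        by rewrite ltnNge; apply/negP => ss; rewrite nth_default in l0s.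
      by rewrite /split_off nth_cat size_takel ?(ltnW ss) // ltnn subnn.
    by rewrite eqxx scale1r mul1r.
  case: (boolP (_ && _)) => [/R [rE _]|_]; last by rewrite scale0r.
  by case/eqP: ne; apply: cparts_inj; rewrite rE cE.
(* The coefficients cA and cB add up to the two sides of the cone identity. *)
have := rpredD A B; rewrite addrACA -opprD.
suff -> : (-1) ^+ s *: (\sum_l cA l *: top l h) + (-1) ^+ s *: (\sum_l cB l *: top l h) =
  top m h by [].
rewrite -scalerDr -big_split scaler_sumr /= (bigD1 m) //= big1 ?addr0 => [|l ne].
  rewrite -scalerDl scalerA (cone_identity k m0 m0) // eqxx mulr1 -expr2 sqrr_sign.
  by rewrite scale1r.
have [l0 lN lp] := cpartsP l.
rewrite -scalerDl scalerA (cone_identity k m0 l0) //; last by rewrite mN lN.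
by rewrite eq_sym (inj_eq (@cparts_inj _ _)) (negPf ne) !mulr0 scale0r.
Qed.

End Exactness.

(** * Exactness of the Salvetti complex *)

Lemma size_twists_gt0 off m : all (leq 1) m -> (size m < sumn m)%N ->
  (0 < size (twists off m))%N.
Proof.
elim: m off => //= a m IH off /andP [a0 m0] sz; rewrite size_cat size_half_twist.
have [a1|a1] := ltnP 1 a; first by rewrite addn_gt0 bin_gt0 a1.
by apply: ltn_addl; apply: IH => //; lia.
Qed.

Section Exactness.
Variables (k : comNzRingType) (N : nat).
Local Notation G := (braid_group N).
Local Notation sal := (sal k N).
Local Notation sal_d := (sal_d k N).
Local Notation ev := (positive_braid N).
Local Notation cone := (@sal_cone k N _ _).
Local Notation low p t := (@span k (cells N p) (@low_cell N p t)).
Local Notation top := (@top_cell k N _).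

Lemma low_mono p s t x : s <= t -> x \in low p s -> x \in low p t.
Proof. by move=> st; apply: span_mono => c [gP ct]; split=> //; apply: lt_le_trans st. Qed.

Lemma low_le0 p t x : t <= 0 -> x \in low p t -> x = 0.
Proof.
move=> t0 xl; apply: (@span_none _ _ x); apply: span_mono xl => -[m g] [/= gP ht].
have : 0 <= height (m, g) by apply: braid_len_positive; apply: is_positiveM => //; apply: delta_positive.
by move=> h0; have := lt_le_trans (le_lt_trans h0 ht) t0; rewrite ltxx.
Qed.

Lemma cone_homotopy_cell p p' p'' (m : composition N p) g : p = p' + 1 -> p'' = p + 1 ->
  is_positive g -> (g * delta m)%g <> 1%g ->
  sal_d p' p (cone (bas k ((m, g) : cells N p))) +
  (cone (sal_d p p'' (bas k ((m, g) : cells N p))) : sal p) - bas k ((m, g) : cells N p)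
    \in low p (height ((m, g) : cells N p)).
Proof.
move=> pp pp' gP h1; rewrite (bas_top k m g) /height /=.
have gP' : is_positive (g * delta m * (delta m)^-1)%g by rewrite mulgK.
have hN : (first_descent (g * delta m)%g < N.-1)%N.
  by apply: first_descent_lt => //; apply: is_positiveM => //; apply: delta_positive.
set u := top m _; rewrite (linearZZ (@sal_cone k N p p')) (linearZZ (sal_d p' p)).
rewrite (linearZZ (sal_d p p'')) (linearZZ (@sal_cone k N p'' p)) -scalerDr -scalerBr.
by rewrite rpredZ //; apply: cone_homotopy.
Qed.

Definition left_mul p (z : G) : {linear sal p -> sal p} :=
  lin (fun c : cells N p => bas k ((c.1, z * c.2)%g : cells N p)).

Lemma left_mul_bas p z (m : composition N p) g :
  left_mul p z (bas k ((m, g) : cells N p)) = bas k ((m, z * g)%g : cells N p).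
Proof. exact: lin_bas. Qed.

Lemma left_mul_put p z (m : composition N p) x :
  left_mul p z (put k m x) = put k m (gmul (bas k z) x).
Proof.
apply: (free_eq (f := left_mul p z \o put k m) (g := put k m \o gmul (bas k z))) => g.
by rewrite /= gmul_bas2 !put_bas left_mul_bas.
Qed.

Lemma left_mul_d p p' z x : left_mul p' z (sal_d p p' x) = sal_d p p' (left_mul p z x).
Proof.
apply: (free_eq (f := left_mul p' z \o sal_d p p') (g := sal_d p p' \o left_mul p z)) => -[m g].
rewrite /= -(put_bas k m) left_mul_put !sal_d_put (linear_sum (left_mul p' z)).
by apply: eq_bigr => l _; rewrite left_mul_put gmulA.
Qed.

Lemma left_mulM p z w x : left_mul p z (left_mul p w x) = left_mul p (z * w)%g x.
Proof.
apply: (free_eq (f := left_mul p z \o left_mul p w) (g := left_mul p (z * w)%g)) => -[m g].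
apply: etrans (congr1 (left_mul p z) (left_mul_bas w m g)) _.
apply: etrans (left_mul_bas z m _) (etrans _ (esym (left_mul_bas _ m g))).
by rewrite mulgA.
Qed.

Lemma left_mul1 p x : left_mul p 1%g x = x.
Proof.
apply: (free_eq (f := left_mul p 1%g) (g := idfun)) => -[m g].
by rewrite left_mul_bas mul1g.
Qed.

Lemma left_mul_low p z t x : is_positive z -> x \in low p t ->
  left_mul p z x \in low p (braid_len z + t).
Proof.
move=> zP; apply: span_lin => -[m g] [/= gP ht]; rewrite left_mul_bas span_bas //.
split=> /=; first exact: is_positiveM.
by move: ht; rewrite /height /= -mulgA (braid_lenM z) => ht; rewrite ltrD2l.
Qed.

(** A finite sum involves finitely many positions, all made positive by the same power of
    the full twist. *)
Lemma left_mul_low_exists p x : exists z (t : nat), left_mul p z x \in low p t%:Z.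
Proof.
have full_P j : is_positive (ev (full_twist N) ^+ j)%g.
  elim: j => [|j IH]; first exact: is_positive1.
  by rewrite expgSr; apply: is_positiveM => //; apply: is_positive_ev; apply: letters_full_twist.
suff [j [t xt]] : exists j (t : nat), left_mul p (ev (full_twist N) ^+ j)%g x \in low p t%:Z.
  by exists (ev (full_twist N) ^+ j)%g, t.
elim/free_ind: x => [|c [m g] x [j [t xt]]].
  by exists 0%N, 0%N; rewrite linear0 rpred0.
have [i gP] := full_twist_positive g.
pose h := height ((m, ev (full_twist N) ^+ j * (ev (full_twist N) ^+ i * g))%g : cells N p).
have lz := braid_len_positive (full_P i).
exists (i + j)%N, (t + absz (braid_len (ev (full_twist N) ^+ i)%g) + absz h).+1%N.
rewrite (linearP (left_mul p _)); apply: rpredD.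
  apply: rpredZ; rewrite left_mul_bas; apply: span_bas; split.
    by rewrite /= addnC expgD -mulgA; apply: is_positiveM.
  rewrite addnC expgD -mulgA -/h; lia.
rewrite expgD -left_mulM; apply: low_mono (left_mul_low (full_P i) xt).
lia.
Qed.

Section PositiveDegree.
Variables p p' p'' : int.
Hypothesis pp' : p = p' + 1.
Hypothesis pp'' : p'' = p + 1.
Hypothesis pN : p < (2 * N)%N%:Z.

Lemma delta_neq1 (m : composition N p) g : is_positive g -> (g * delta m)%g <> 1%g.
Proof.
move=> gP /(congr1 (@braid_len N)); rewrite braid_len1 braid_lenM delta_len.
have := braid_len_positive gP; have [m0 mN mp] := cpartsP m.
have : (0 < size (twists 0 (cparts m)))%N by apply: size_twists_gt0 => //; lia.
by lia.
Qed.

(** The homotopy writes a cycle x as a boundary plus a cycle of smaller height; the heights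
    are nonnegative. *)
Lemma exact_low (t : nat) x : x \in low p t%:Z -> sal_d p p'' x = 0 ->
  exists y, sal_d p' p y = x.
Proof.
elim: t x => [|t IH] x xt dx; first by exists 0; rewrite linear0 (low_le0 _ xt).
pose K : {linear sal p -> sal p} := (sal_d p' p \o cone) \+ (cone \o sal_d p p'') \- idfun.
have Kx : K x \in low p t%:Z.
  apply: span_lin xt => -[m g] [/= gP ht].
  have le : height ((m, g) : cells N p) <= t%:Z.
    by move: ht; rewrite -addn1 PoszD ltzD1.
  exact: (low_mono le (cone_homotopy_cell pp' pp'' gP (delta_neq1 (m := m) gP))).
have Kx' : K x = sal_d p' p (cone x) - x by rewrite /= dx linear0 addr0.
have [||y yE] := IH (- K x).
- by rewrite rpredN.
- by rewrite Kx' linearN linearB /= dx (sal_dd _ pp'') subr0 oppr0.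
by exists (cone x + y); rewrite linearD /= yE Kx' opprB addrC subrK.
Qed.

Lemma sal_exact x : sal_d p p'' x = 0 -> exists y, sal_d p' p y = x.
Proof.
move=> dx; have [z [t xt]] := left_mul_low_exists x.
have [|y yE] := exact_low xt; first by rewrite -left_mul_d dx linear0.
by exists (left_mul p' z^-1%g y); rewrite -left_mul_d yE left_mulM mulVg left_mul1.
Qed.

End PositiveDegree.

End Exactness.

(** * Exactness in the bottom degree *)

Section Augmentation.
Variables (k : comNzRingType) (N : nat).
Local Notation G := (braid_group N).
Local Notation sal := (sal k N).
Local Notation sal_d := (sal_d k N).
Local Notation cone := (@sal_cone k N _ _).
Local Notation left_mul := (@left_mul k N).
Local Notation aug := (aug k).
Local Notation low p t := (@span k (cells N p) (@low_cell N p t)).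

Lemma aug_put p (m : composition N p) x : aug _ (put k m x) = aug _ x.
Proof.
apply: (free_eq (f := aug (cells N p) \o put k m) (g := aug G)) => g.
by rewrite /= put_bas !aug_bas.
Qed.

Lemma aug_gmul_bas g x : aug _ (gmul (bas k g) x) = aug G x.
Proof.
apply: (free_eq (f := aug G \o gmul (bas k g)) (g := aug G)) => h.
by rewrite /= gmul_bas2 !aug_bas.
Qed.

Lemma perm2 (s : 'S_2) : s = 1%g \/ s = rev_perm 2.
Proof.
have := inv_rev_max s; rewrite inv_rev; have [/inv_eq0|i0 i1] := posnP (inv s); first by left.
by right; apply: inv_rev_eq; rewrite inv_rev; apply/eqP; rewrite eqn_leq i1.
Qed.

(** The two shuffles of two single strands have opposite signs. *)
Lemma aug_shuffler off : aug _ (shuffler k N off 1 1) = 0.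
Proof.
rewrite /shuffler (linear_sum (aug _)).
rewrite (eq_bigr (fun s : 'S_2 => (-1) ^+ inv s)) => [|s _]; last first.
  by rewrite (linearZZ (aug _)) aug_bas sign_odd [LHS]mulr1.
have sh (s : 'S_(1 + 1)) : is_shuffle s.
  apply/forallP => a; apply/forallP => b; apply/implyP => /andP [ab bl].
  by have := ltn_ord a; have := ltn_ord b; move: ab bl; lia.
rewrite (bigD1 (1%g : 'S_2)) // (bigD1 (rev_perm 2)) /=; last first.
  by rewrite sh /=; apply/eqP => /(congr1 (@inv 2)); rewrite inv1 inv_rev.
rewrite inv1 inv_rev expr0 expr1 big1 ?addr0 ?subrr // => s /andP [/andP [_ s1] s2].
by have [e|e] := perm2 s; [rewrite e eqxx in s1 | rewrite e eqxx in s2].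
Qed.

Section DegreeZero.
Variables p p' p'' : int.
Hypothesis pN : p = (2 * N)%N%:Z.
Hypothesis pp' : p = p' + 1.
Hypothesis pp'' : p'' = p + 1.

Lemma parts_ones (m : composition N p) : cparts m = nseq N 1%N.
Proof.
have [m0 mN mp] := cpartsP m; have sz : size (cparts m) = N by lia.
have [||e _] := take_ones (s := N) m0; first by rewrite mN.
  move=> j jN e; have [j1|j1] := ltnP 1 (nth 0%N (cparts m) j); last by [].
  have /(congr1 sumn) := drop_take_ones (ltnW j1) e.
  rewrite sumn_cat sumn_nseq /= mN.
  have : all (leq 1) (drop j.+1 (cparts m)).
    by apply/allP => a /mem_drop /(allP m0).
  move/leq_size_sumn; rewrite size_drop sz; lia.
by rewrite -e take_oversize // sz.
Qed.

Lemma aug_sal_d x : aug _ (sal_d p' p x) = 0.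
Proof.
apply: (free_eq (f := aug _ \o sal_d p' p) (g := \0)) => -[m g] /=.
rewrite -(put_bas k m) sal_d_put (linear_sum (aug _)) big1 //= => l _.
rewrite aug_put aug_gmul_bas /coef (linear_sum (aug _)) big1 // => i _.
have : (i.+1 < N)%N.
  by have := ltn_ord i; move: (nat_of_ord i) => j; rewrite parts_ones size_nseq ltn_predRL.
move: (nat_of_ord i) => j jN; rewrite (linearZZ (aug _)) /merge_shuffler parts_ones.
by rewrite !nth_nseq jN (ltnW jN) aug_shuffler scaler0.
Qed.

Lemma delta_ones (m : composition N p) : delta m = 1%g.
Proof.
by rewrite /delta parts_ones -[nseq _ _]cats0 twists_ones.
Qed.

Lemma first_descent1 : (first_descent (1 : G)%g < N.-1)%N = false.
Proof.
apply/negP => h; have := first_descentP h; rewrite mul1g => /braid_len_positive.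
have iN : ((first_descent (1 : G)%g).+1 < N)%N by rewrite -ltn_predRL.
have : braid_len (sigma N (first_descent (1%g : G)))^-1%g = -1.
  have := braid_lenM (sigma N (first_descent (1%g : G))) (sigma N (first_descent (1%g : G)))^-1%g.
  rewrite mulgV braid_len1.
  have -> : braid_len (sigma N (first_descent (1%g : G))) = 1.
    have := @braid_len_ev N [:: first_descent (1%g : G)].
    by rewrite /letters /= iN mulg1; apply.
  lia.
by move=> ->.
Qed.

Lemma sal_d_none x : sal_d p p'' x = 0.
Proof.
apply: (free_eq (f := sal_d p p'') (g := \0)) => -[m g] /=.
rewrite -(put_bas k m) sal_d_put big1 // => l _.
have [l0 lN lp] := cpartsP l; have := leq_size_sumn l0; lia.
Qed.

Variable m1 : composition N p.
Let b0 : sal p := bas k ((m1, 1%g) : cells N p).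

(** In the bottom degree the only composition has all its parts equal to 1 and the induction
    stops at the cell [b0] of height 0, which the augmentation detects. *)
Lemma exact_low0 (t : nat) x : x \in low p t%:Z -> aug _ x = 0 ->
  exists y, sal_d p' p y = x.
Proof.
elim: t x => [|t IH] x xt dx; first by exists 0; rewrite linear0 (low_le0 _ xt).
pose K : {linear sal p -> sal p} := (sal_d p' p \o cone) \+ (scale_by b0 \o aug _) \- idfun.
have Kx : K x \in low p t%:Z.
  apply: span_lin xt => -[m g] [/= gP ht].
  have le : height ((m, g) : cells N p) <= t%:Z by move: ht; rewrite -addn1 PoszD ltzD1.
  have hE : height ((m, g) : cells N p) = braid_len g by rewrite /height /= delta_ones mulg1.
  have mE : m = m1 by apply: cparts_inj; rewrite !parts_ones.
  apply: (low_mono le); rewrite /= aug_bas /scale_by scale1r.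
  have [g1|/eqP g1] := eqVneq g 1%g.
    rewrite g1 mE -/b0 [X in sal_d p' p X](_ : _ = 0); last first.
      rewrite /b0 /sal_cone lin_bas /cone_cell /= delta_ones mulg1.
      by rewrite first_descent1.
    by rewrite linear0 add0r subrr rpred0.
  have h1 : (g * delta m)%g <> 1%g by rewrite delta_ones mulg1.
  have := cone_homotopy_cell k pp' pp'' gP h1.
  rewrite sal_d_none linear0 addr0 => H.
  rewrite addrAC; apply: rpredD => //; apply: span_bas; split=> /=; first exact: is_positive1.
  rewrite hE /height /= delta_ones mulg1 braid_len1 lt_neqAle braid_len_positive // andbT.
  case: gP g1 => u uN ->; rewrite braid_len_ev // eq_sym.
  by case: u uN.
have Kx' : K x = sal_d p' p (cone x) - x by rewrite /= dx /scale_by scale0r addr0.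
have [||y yE] := IH (- K x).
- by rewrite rpredN.
- by rewrite Kx' linearN linearB /= dx aug_sal_d subr0 oppr0.
by exists (cone x + y); rewrite linearD /= yE Kx' opprB addrC subrK.
Qed.

Lemma aug_left_mul z x : aug _ (left_mul p z x) = aug _ x.
Proof.
apply: (free_eq (f := aug _ \o left_mul p z) (g := aug _)) => -[m g] /=.
apply: etrans (congr1 (aug _) (left_mul_bas k z m g)) _.
by apply: etrans (aug_bas k _) (esym (aug_bas k _)).
Qed.

Lemma sal_exact0 x : aug _ x = 0 -> exists y, sal_d p' p y = x.
Proof.
move=> dx; have [z [t xt]] := left_mul_low_exists x.
have [|y yE] := exact_low0 xt; first by rewrite aug_left_mul dx.
by exists (left_mul p' z^-1%g y); rewrite -left_mul_d yE left_mulM mulVg left_mul1.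
Qed.

End DegreeZero.
End Augmentation.

(** * Free resolutions and their comparison *)

Section FreeRightModules.
Variables (k : comNzRingType) (H : groupType).
Local Notation F B := (free k (B * H)%type).

Definition rmul (B : choiceType) (h : H) : {linear F B -> F B} :=
  lin (fun x : B * H => bas k (x.1, (x.2 * h)%g)).

Lemma rmul_bas (B : choiceType) h (b : B) x : rmul B h (bas k (b, x)) = bas k (b, (x * h)%g).
Proof. exact: lin_bas. Qed.

Lemma rmulM (B : choiceType) g h x : rmul B h (rmul B g x) = rmul B (g * h)%g x.
Proof.
apply: (free_eq (f := rmul B h \o rmul B g) (g := rmul B (g * h)%g)) => -[b y].
apply: etrans (congr1 (rmul B h) (rmul_bas g b y)) _.
by apply: etrans (rmul_bas h b _) (etrans _ (esym (rmul_bas _ b y))); rewrite mulgA.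
Qed.

Lemma rmul1 (B : choiceType) x : rmul B 1%g x = x.
Proof.
apply: (free_eq (f := rmul B 1%g) (g := idfun)) => -[b y].
by rewrite rmul_bas mulg1.
Qed.

Lemma aug_rmul (B : choiceType) h x : aug k _ (rmul B h x) = aug k _ x.
Proof.
apply: (free_eq (f := aug k _ \o rmul B h) (g := aug k _)) => -[b y].
by apply: etrans (congr1 (aug k _) (rmul_bas h b y)) _; rewrite !aug_bas.
Qed.

Section Ext.
Variables (B C : choiceType) (u : B -> F C).

(** The H-linear extension of a map defined on a basis; [free k (B * H)] is the free right
    H-module on B. *)
Definition ext : {linear F B -> F C} := lin (fun x : B * H => rmul C x.2 (u x.1)).

Lemma ext_bas b h : ext (bas k (b, h)) = rmul C h (u b).
Proof. exact: lin_bas. Qed.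

Lemma ext_bas1 b : ext (bas k (b, 1%g)) = u b.
Proof. by rewrite ext_bas rmul1. Qed.

Lemma ext_rmul h x : ext (rmul B h x) = rmul C h (ext x).
Proof.
apply: (free_eq (f := ext \o rmul B h) (g := rmul C h \o ext)) => -[b y].
apply: etrans (congr1 ext (rmul_bas h b y)) _.
apply: etrans (ext_bas b _) (etrans _ (esym (congr1 (rmul C h) (ext_bas b y)))).
by rewrite rmulM.
Qed.

End Ext.

Lemma ext_comp (A B C : choiceType) (u : A -> F B) (v : B -> F C) x :
  ext v (ext u x) = ext (fun a => ext v (u a)) x.
Proof.
apply: (free_eq (f := ext v \o ext u) (g := ext (fun a => ext v (u a)))) => -[a h].
apply: etrans (congr1 (ext v) (ext_bas u a h)) _.
by apply: etrans (ext_rmul v h (u a)) (esym (ext_bas (fun a => ext v (u a)) a h)).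
Qed.

Lemma ext_eq (A B : choiceType) (u v : A -> F B) x : (forall a, u a = v a) -> ext u x = ext v x.
Proof.
move=> uv; apply: (free_eq (f := ext u) (g := ext v)) => -[a h].
by rewrite !ext_bas uv.
Qed.

Lemma ext_add (A B : choiceType) (u v : A -> F B) x :
  ext (fun a => u a + v a) x = ext u x + ext v x.
Proof.
apply: (free_eq (f := ext (fun a => u a + v a)) (g := ext u \+ ext v)) => -[a h] /=.
by rewrite !ext_bas (linearD (rmul B h)).
Qed.

Lemma ext_id (B : choiceType) x : ext (fun b : B => bas k (b, 1%g)) x = x.
Proof.
apply: (free_eq (f := ext _) (g := idfun)) => -[b h] /=.
by rewrite ext_bas rmul_bas mul1g.
Qed.

Section Tensor.
Variables (L : lmodType k) (rho : representation H L).

(** The map x |-> x (x) v to the coinvariants, identified with the direct sum of copies of L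
    indexed by the basis. *)
Definition act_at (B : choiceType) (v : L) : {linear F B -> dsum B L} :=
  lin (fun x : B * H => dsum_in x.1 (rho x.2 v)).

Lemma act_at_bas (B : choiceType) v (b : B) h : act_at B v (bas k (b, h)) = dsum_in b (rho h v).
Proof. exact: lin_bas. Qed.

Definition act_fun (B : choiceType) (x : F B) (v : L) : dsum B L := act_at B v x.

Lemma act_linear B x : linear (@act_fun B x).
Proof.
move=> c v w; rewrite /act_fun.
apply: (free_eq (f := act_at B (c *: v + w)) (g := c \*: act_at B v \+ act_at B w)) => -[b h] /=.
by rewrite !act_at_bas !linearP.
Qed.

HB.instance Definition _ B x := GRing.isLinear.Build k L (dsum B L) _ (@act_fun B x) (@act_linear B x).

(** The map induced by u after tensoring with L over H. *)
Definition tens (B C : choiceType) (u : B -> F C) : {linear dsum B L -> dsum C L} :=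
  dsum_ext (fun b => @act_fun C (u b) : {linear L -> dsum C L}).

Lemma tens_in (B C : choiceType) (u : B -> F C) b v : tens u (dsum_in b v) = act_at C v (u b).
Proof. exact: dsum_ext_in. Qed.

(** The identification of the coinvariants is natural; all functoriality follows from this. *)
Lemma tens_act (B C : choiceType) (u : B -> F C) v x :
  tens u (act_at B v x) = act_at C v (ext u x).
Proof.
apply: (free_eq (f := tens u \o act_at B v) (g := act_at C v \o ext u)) => -[b h].
apply: etrans (congr1 (tens u) (act_at_bas v b h)) _.
apply: etrans (tens_in u b _) (etrans _ (esym (congr1 (act_at C v) (ext_bas u b h)))).
apply: (free_eq (f := act_at C (rho h v)) (g := act_at C v \o rmul C h)) => -[c g].
apply: etrans (act_at_bas _ c g) (etrans _ (esym (congr1 (act_at C v) (rmul_bas h c g)))).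
by rewrite act_at_bas repr_actM.
Qed.

Lemma tens_comp (A B C : choiceType) (u : A -> F B) (v : B -> F C) x :
  tens v (tens u x) = tens (fun a => ext v (u a)) x.
Proof.
apply: (dsum_eq_linear (f := tens v \o tens u) (g := tens (fun a => ext v (u a)))) => a w.
apply: etrans (congr1 (tens v) (tens_in u a w)) _.
by apply: etrans (tens_act v w (u a)) (esym (tens_in _ a w)).
Qed.

Lemma tens_eq (A B : choiceType) (u v : A -> F B) x : (forall a, u a = v a) -> tens u x = tens v x.
Proof.
move=> uv; apply: (dsum_eq_linear (f := tens u) (g := tens v)) => a w.
by rewrite !tens_in uv.
Qed.

Lemma tens_add (A B : choiceType) (u v : A -> F B) x :
  tens (fun a => u a + v a) x = tens u x + tens v x.
Proof.
apply: (dsum_eq_linear (f := tens (fun a => u a + v a)) (g := tens u \+ tens v)) => a w /=.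
by rewrite !tens_in (linearD (act_at B w)).
Qed.

Lemma tens_id (B : choiceType) x : tens (fun b : B => bas k (b, 1%g)) x = x.
Proof.
apply: (dsum_eq_linear (f := tens _) (g := idfun)) => b v /=.
by rewrite tens_in act_at_bas repr_act1.
Qed.

End Tensor.

Section Comparison.

Definition resolution (B : nat -> choiceType) (d : forall q, B q.+1 -> F (B q)) : Prop :=
  [/\ inhabited (B 0%N),
      forall b, aug k _ (d 0%N b) = 0,
      forall q b, ext (d q) (d q.+1 b) = 0,
      forall x, aug k _ x = 0 -> exists y, ext (d 0%N) y = x &
      forall q x, ext (d q) x = 0 -> exists y, ext (d q.+1) y = x].

Definition chain_map (B C : nat -> choiceType) (d : forall q, B q.+1 -> F (B q))
    (e : forall q, C q.+1 -> F (C q)) (f : forall q, B q -> F (C q)) : Prop :=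
  forall q b, ext (e q) (f q.+1 b) = ext (f q) (d q b).

Definition homotopy (B C : nat -> choiceType) (d : forall q, B q.+1 -> F (B q))
    (e : forall q, C q.+1 -> F (C q)) (f g : forall q, B q -> F (C q))
    (s : forall q, B q -> F (C q.+1)) : Prop :=
  (forall b, f 0%N b = g 0%N b + ext (e 0%N) (s 0%N b)) /\
  forall q b, f q.+1 b = g q.+1 b + ext (e q.+1) (s q.+1 b) + ext (s q) (d q b).

(** The choice of a preimage whenever there is one, with 0 as a default value, allows chain
    maps to be defined by plain recursion on the degree. *)
Definition pick_preimage (V W : lmodType k) (f : V -> W) (w : W) : V :=
  if pselect (exists v, f v = w) is left h then sval (cid h) else 0.

Lemma pick_preimageP (V W : lmodType k) (f : V -> W) w :
  (exists v, f v = w) -> f (pick_preimage f w) = w.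
Proof. by rewrite /pick_preimage; case: pselect => // h _; case: (cid h). Qed.

Variables (B C : nat -> choiceType).
Variables (d : forall q, B q.+1 -> F (B q)) (e : forall q, C q.+1 -> F (C q)).
Arguments d : clear implicits.
Arguments e : clear implicits.
Hypotheses (dP : resolution d) (eP : resolution e).

Lemma chain_map_ext f q x : chain_map d e f -> ext (e q) (ext (f q.+1) x) = ext (f q) (ext (d q) x).
Proof. by move=> fP; rewrite !ext_comp; apply: ext_eq => b; apply: fP. Qed.

Lemma chain_map_exists : exists f, chain_map d e f /\ forall b, aug k _ (f 0%N b) = 1.
Proof.
have [[c0] e0 ee ex0 ex] := eP; have [_ d0 dd _ _] := dP.
pose fix f (q : nat) : B q -> F (C q) :=
  if q is q'.+1 then fun b => pick_preimage (ext (e q')) (ext (f q') (d q' b))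
  else fun _ => bas k (c0, 1%g).
exists f; split; last by move=> b; exact: (aug_bas k (c0, 1%g)).
move=> q b; apply: pick_preimageP.
elim: q b => [|q IH] b.
  apply: ex0; apply: etrans (d0 b).
  apply: (free_eq (f := aug k _ \o ext (f 0%N)) (g := aug k _)) => -[c h].
  apply: etrans (congr1 (aug k _) (ext_bas _ c h)) _.
  by rewrite aug_rmul !aug_bas.
apply: ex; rewrite ext_comp.
apply: etrans (_ : ext (fun b => ext (f q) (d q b)) (d q.+1 b) = 0).
  by apply: ext_eq => c; apply: pick_preimageP; apply: IH.
by rewrite -ext_comp dd (linear0 (ext (f q))).
Qed.

(** The difference w of the two maps is a chain map that vanishes on augmentations.  The
    homotopy is built by recursion: w - s d is a cycle because e s = w - s d one degree below. *)
Lemma homotopy_exists f g : chain_map d e f -> chain_map d e g ->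
  (forall b, aug k _ (f 0%N b) = aug k _ (g 0%N b)) -> exists s, homotopy d e f g s.
Proof.
have [_ e0 ee ex0 ex] := eP; have [_ d0 dd _ _] := dP.
move=> fP gP fg; pose w q b := f q b - g q b.
have wE q x : ext (w q) x = ext (f q) x - ext (g q) x.
  apply/eqP; rewrite eq_sym subr_eq -ext_add; apply/eqP/ext_eq => b.
  by rewrite /w subrK.
pose fix s (q : nat) : B q -> F (C q.+1) :=
  match q with
  | 0%N => fun b => pick_preimage (ext (e 0%N)) (w 0%N b)
  | q'.+1 => fun b => pick_preimage (ext (e q'.+1)) (w q'.+1 b - ext (s q') (d q' b))
  end.
have s0 b : ext (e 0%N) (s 0%N b) = w 0%N b.
  by apply/pick_preimageP/ex0; rewrite (linearB (aug k _)) fg subrr.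
have wd q b : ext (e q) (w q.+1 b) = ext (w q) (d q b).
  by rewrite (linearB (ext (e q))) fP gP wE.
have sS q : forall b, ext (e q.+1) (s q.+1 b) = w q.+1 b - ext (s q) (d q b).
  elim: q => [|q IH] b; apply: pick_preimageP; apply: ex.
    rewrite (linearB (ext (e 0%N))) wd ext_comp.
    by apply/eqP; rewrite subr_eq0; apply/eqP/ext_eq => c; rewrite s0.
  rewrite (linearB (ext (e q.+1))) wd ext_comp.
  pose sd b := ext (s q) (d q b).
  have -> : ext (w q.+1) (d q.+1 b) =
      ext (fun b => ext (e q.+1) (s q.+1 b)) (d q.+1 b) + ext sd (d q.+1 b).
    by rewrite -ext_add; apply: ext_eq => c; rewrite IH subrK.
  by rewrite addrAC subrr add0r -ext_comp dd (linear0 (ext (s q))).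
exists s; split=> [b|q b]; first by rewrite s0 /w addrCA subrr addr0.
by rewrite sS -addrA subrK /w addrCA subrr addr0.
Qed.

End Comparison.

Lemma chain_map_comp (B C D : nat -> choiceType) d e e' (f : forall q, B q -> F (C q))
    (g : forall q, C q -> F (D q)) :
  chain_map d e f -> chain_map e e' g -> chain_map d e' (fun q b => ext (g q) (f q b)).
Proof.
by move=> fP gP q b; rewrite (chain_map_ext _ gP) fP ext_comp.
Qed.

Lemma chain_map_id (B : nat -> choiceType) d : chain_map d d (fun q (b : B q) => bas k (b, 1%g)).
Proof. by move=> q b; rewrite ext_bas1 ext_id. Qed.

End FreeRightModules.

Section Coefficients.
Variables (k : comNzRingType) (H : groupType) (L : lmodType k) (rho : representation H L).
Local Notation F B := (free k (B * H)%type).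

Section TensorHomotopy.
Variables (B C : nat -> choiceType).
Variables (d : forall q, B q.+1 -> F (B q)) (e : forall q, C q.+1 -> F (C q)).
Arguments d : clear implicits.
Arguments e : clear implicits.

Lemma tens_chain_map f : chain_map d e f -> forall q x,
  tens rho (e q) (tens rho (f q.+1) x) = tens rho (f q) (tens rho (d q) x).
Proof. by move=> fP q x; rewrite !tens_comp; apply: tens_eq => b; apply: fP. Qed.

Lemma tens_homotopy f g s : homotopy d e f g s ->
  (forall x, tens rho (f 0%N) x = tens rho (g 0%N) x + tens rho (e 0%N) (tens rho (s 0%N) x)) /\
  forall q x, tens rho (f q.+1) x = tens rho (g q.+1) x +
    tens rho (e q.+1) (tens rho (s q.+1) x) + tens rho (s q) (tens rho (d q) x).
Proof.
case=> s0 sS; split=> [x|q x]; rewrite !tens_comp -!tens_add; apply: tens_eq => b.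
  exact: s0.
exact: sS.
Qed.

End TensorHomotopy.

Definition homotopic_to_id (D : nat -> lmodType k) (d : forall q, {linear D q.+1 -> D q})
    (h : forall q, D q -> D q) : Prop :=
  exists s : forall q, {linear D q -> D q.+1},
    (forall x, h 0%N x = x + d 0%N (s 0%N x)) /\
    forall q x, h q.+1 x = x + d q.+1 (s q.+1 x) + s q (d q x).

Definition tens_d (B : nat -> choiceType) (d : forall q, B q.+1 -> F (B q)) q :
  {linear dsum (B q.+1) L -> dsum (B q) L} := tens rho (d q).

(** The fundamental lemma of homological algebra, with coefficients: two free resolutions of
    the trivial module have homotopy equivalent complexes of coinvariants. *)
Lemma resolution_compare (B C : nat -> choiceType) (d : forall q, B q.+1 -> F (B q))
    (e : forall q, C q.+1 -> F (C q)) : resolution d -> resolution e ->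
  exists (f : forall q, {linear dsum (B q) L -> dsum (C q) L})
         (g : forall q, {linear dsum (C q) L -> dsum (B q) L}),
  [/\ forall q x, tens_d e q (f q.+1 x) = f q (tens_d d q x),
      forall q x, tens_d d q (g q.+1 x) = g q (tens_d e q x),
      @homotopic_to_id (fun q => dsum (B q) L) (tens_d d) (fun q x => g q (f q x)) &
      @homotopic_to_id (fun q => dsum (C q) L) (tens_d e) (fun q x => f q (g q x))].
Proof.
move=> dP eP.
have [f [fP f0]] := chain_map_exists dP eP.
have [g [gP g0]] := chain_map_exists eP dP.
have aug1 (A : choiceType) (D : choiceType) (h : A -> F D) x :
    (forall a, aug k _ (h a) = 1) -> aug k _ (ext h x) = aug k _ x.
  move=> h1; apply: (free_eq (f := aug k _ \o ext h) (g := aug k _)) => -[a y].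
  apply: etrans (congr1 (aug k _) (ext_bas h a y)) _.
  by rewrite aug_rmul h1 aug_bas.
have [|s sP] := homotopy_exists dP dP (chain_map_comp fP gP) (chain_map_id d).
  by move=> b; rewrite (aug1 _ _ (g 0%N)) // f0 aug_bas.
have [|s' sP'] := homotopy_exists eP eP (chain_map_comp gP fP) (chain_map_id e).
  by move=> b; rewrite (aug1 _ _ (f 0%N)) // g0 aug_bas.
exists (fun q => tens rho (f q)), (fun q => tens rho (g q)); split.
- exact: tens_chain_map fP.
- exact: tens_chain_map gP.
- exists (fun q => tens rho (s q)); have [h0 hS] := tens_homotopy sP.
  split=> [x|q x]; rewrite tens_comp; first by rewrite h0 tens_id.
  by rewrite hS tens_id.
- exists (fun q => tens rho (s' q)); have [h0 hS] := tens_homotopy sP'.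
  split=> [x|q x]; rewrite tens_comp; first by rewrite h0 tens_id.
  by rewrite hS tens_id.
Qed.

End Coefficients.

(** * The bar resolution *)

Section Bar.
Variables (k : comNzRingType) (H : groupType).
Local Notation B q := (q.-tuple H).
Local Notation F q := (free k ((q.-tuple H) * H)%type).

Definition bar_last q (g : q.+1.-tuple H) (j : 'I_q.+2) : H :=
  if j == ord_max then tnth g ord_max else 1%g.

(** The differential of the free bar resolution on its basis.  The last face leaves the last
    entry of the tuple as a coefficient on the right. *)
Definition bar_diff q (g : q.+1.-tuple H) : F q :=
  \sum_(j < q.+2) (-1) ^+ j *: bas k (bar_face j g, bar_last g j).

(** The k-linear contraction of the bar resolution that appends the coefficient to the tuple. *)
Definition bar_cone q : {linear F q -> F q.+1} :=
  lin (fun x : B q * H => bas k ([tuple of rcons x.1 x.2], 1%g)).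

Lemma bar_cone_bas q (g : B q) h :
  bar_cone q (bas k (g, h)) = bas k ([tuple of rcons g h], 1%g).
Proof. exact: lin_bas. Qed.

Lemma tnth_rcons_max q (g : B q) h : tnth [tuple of rcons g h] ord_max = h.
Proof. by rewrite (tnth_nth 1%g) /= nth_rcons size_tuple ltnn eqxx. Qed.

Lemma nth_rconst q (g : B q) h i : nth 1%g [tuple of rcons g h] i =
  if (i < q)%N then nth 1%g g i else if i == q then h else 1%g.
Proof. by rewrite /= nth_rcons size_tuple. Qed.

Lemma bar_face_nth q j (g : q.+1.-tuple H) i : (i < q)%N ->
  nth 1%g (bar_face j g) i =
    (if (i.+1 < j)%N then nth 1%g g i
     else if i.+1 == j then nth 1%g g i * nth 1%g g i.+1 else nth 1%g g i.+1)%g.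
Proof.
move=> iq; rewrite -(tnth_nth 1%g _ (Ordinal iq)) tnth_mktuple.
by rewrite !(tnth_nth 1%g).
Qed.

Lemma tuple_eq q (a b : B q) : (forall i, (i < q)%N -> nth 1%g a i = nth 1%g b i) -> a = b.
Proof.
move=> ab; apply: val_inj; apply: (@eq_from_nth _ 1%g) => [|i] /=; rewrite !size_tuple //.
exact: ab.
Qed.

Lemma bar_face_drop q (g : B q) h : bar_face q.+1 [tuple of rcons g h] = g.
Proof.
apply: tuple_eq => i iq.
by rewrite bar_face_nth // ltnS iq /= nth_rcons size_tuple iq.
Qed.

Lemma bar_face_mult q (g : B q.+1) h :
  bar_face q.+1 [tuple of rcons g h] =
  [tuple of rcons (bar_face q.+1 g) (tnth g ord_max * h)%g].
Proof.
apply: tuple_eq => i iq.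
rewrite bar_face_nth // !nth_rconst !eqSS.
have [e|ne] := eqVneq i q.
  by rewrite e !ltnn !ltnSn (tnth_nth 1%g).
have lt : (i < q)%N by rewrite ltn_neqAle ne -ltnS.
by rewrite !ltnS lt (ltnW lt) bar_face_nth // ltnS lt.
Qed.

Lemma bar_face_rcons q j (g : B q.+1) h : (j < q.+1)%N ->
  bar_face j [tuple of rcons g h] = [tuple of rcons (bar_face j g) h].
Proof.
move=> jq; apply: tuple_eq => i iq.
rewrite bar_face_nth // !nth_rconst !eqSS iq.
have [e|ne] := eqVneq i q.
  have [H1 H2] : (q.+1 < j)%N = false /\ (q.+1 == j) = false by split; lia.
  by rewrite e H1 H2 !ltnn.
have lt : (i < q)%N by rewrite ltn_neqAle ne -ltnS.
by rewrite ltnS lt bar_face_nth.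
Qed.

Lemma bar_diff_cone q (g : B q.+1) h :
  bar_diff [tuple of rcons g h] =
  bar_cone q (rmul k _ h (bar_diff g)) + (-1) ^+ q.+2 *: bas k (g, h).
Proof.
rewrite /bar_diff big_ord_recr /= bar_face_drop /bar_last eqxx tnth_rcons_max.
congr (_ + _); rewrite (linear_sum (rmul k _ h)) (linear_sum (bar_cone q)).
apply: eq_bigr => j _.
rewrite (linearZZ (rmul k _ h)) (linearZZ (bar_cone q)) rmul_bas bar_cone_bas.
have -> : (widen_ord (leqnSn q.+2) j == ord_max) = false.
  by apply/negP => /eqP /(congr1 val) /=; case: j => /= j jq e; lia.
rewrite /bar_last.
have [->|ne] := eqVneq j ord_max; first by rewrite bar_face_mult.
rewrite mul1g bar_face_rcons //.
by rewrite ltn_neqAle -ltnS ltn_ord andbT.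
Qed.

Lemma bar_diff_cone0 (g : B 0) h :
  bar_diff [tuple of rcons g h] = bas k (g, 1%g) - bas k (g, h).
Proof.
rewrite /bar_diff !big_ord_recr big_ord0 /= add0r /bar_last eqxx tnth_rcons_max.
by rewrite expr0 scale1r expr1 scaleN1r !(tuple0 (bar_face _ _)) [g]tuple0.
Qed.

Lemma bar_homotopy q x :
  ext (@bar_diff q.+1) (bar_cone q.+1 x) =
  bar_cone q (ext (@bar_diff q) x) + (-1) ^+ q.+2 *: x.
Proof.
apply: (free_eq (f := ext (@bar_diff q.+1) \o bar_cone q.+1)
  (g := (bar_cone q \o ext (@bar_diff q)) \+ ((-1) ^+ q.+2 \*: idfun))) => -[g h].
apply: etrans (congr1 (ext (@bar_diff q.+1)) (bar_cone_bas g h)) _.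
by rewrite ext_bas1 bar_diff_cone /= ext_bas.
Qed.

Lemma bar_homotopy0 x :
  ext (@bar_diff 0) (bar_cone 0 x) = (aug k _ x : k) *: bas k ([tuple], 1%g) - x.
Proof.
apply: (free_eq (f := ext (@bar_diff 0) \o bar_cone 0)
  (g := (scale_by (bas k ([tuple] : B 0, 1%g)) \o aug k _) \- idfun)) => -[g h].
apply: etrans (congr1 (ext (@bar_diff 0)) (bar_cone_bas g h)) _.
rewrite ext_bas1 bar_diff_cone0 /= aug_bas /scale_by scale1r.
by rewrite [g]tuple0.
Qed.

Lemma tuple_rcons q (g : B q.+1) : exists (g' : B q) h, g = [tuple of rcons g' h].
Proof.
case: g => s; case/lastP: s => [//|s h] sP.
have sP' : size s == q by move: sP; rewrite size_rcons eqSS.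
by exists (Tuple sP'), h; apply: val_inj.
Qed.

Lemma aug_bar_diff (g : B 1) : aug k _ (bar_diff g) = 0.
Proof.
have [g' [h ->]] := tuple_rcons g.
rewrite bar_diff_cone0 (linearB (aug k _)).
by apply: etrans (congr2 (fun a b => a - b) (aug_bas k _) (aug_bas k _)) (subrr _).
Qed.

(** The contraction reaches all basis elements, so that the vanishing of the square follows
    by induction on the degree from the homotopy formula alone. *)
Lemma bar_diff2 q (g : B q.+2) : ext (@bar_diff q) (bar_diff g) = 0.
Proof.
elim: q g => [|q IH] b; have [g [h ->]] := tuple_rcons b; rewrite bar_diff_cone.
  rewrite (linearD (ext (@bar_diff 0))) bar_homotopy0 aug_rmul aug_bar_diff scale0r.
  by rewrite sub0r sqrrN expr1n scale1r ext_bas addNr.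
rewrite (linearD (ext (@bar_diff q.+1))) bar_homotopy ext_rmul IH.
rewrite (linear0 (rmul k _ h)) (linear0 (bar_cone q)) add0r.
rewrite (linearZZ (ext (@bar_diff q.+1))) ext_bas -scalerDl.
by rewrite [(-1) ^+ q.+3]exprS mulN1r subrr scale0r.
Qed.

Lemma bar_resolution : resolution bar_diff.
Proof.
split.
- exact: inhabits [tuple].
- exact: aug_bar_diff.
- exact: bar_diff2.
- move=> x x0; exists (- bar_cone 0 x).
  by rewrite (linearN (ext (@bar_diff 0))) bar_homotopy0 x0 scale0r sub0r opprK.
move=> q x x0; exists ((-1) ^+ q.+2 *: bar_cone q.+1 x).
rewrite (linearZZ (ext (@bar_diff q.+1))) bar_homotopy x0 (linear0 (bar_cone q)) add0r.
by rewrite scalerA -expr2 sqrr_sign scale1r.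
Qed.

Lemma tens_bar (L : lmodType k) (rho : representation H L) q x :
  tens rho (@bar_diff q) x = bar_d rho q x.
Proof.
apply: (dsum_eq_linear (f := tens rho (@bar_diff q)) (g := bar_d rho q)) => g v.
rewrite tens_in; have -> : bar_d rho q (dsum_in g v) = bar_dterm_fun rho g v.
  exact: dsum_ext_in.
rewrite /bar_dterm_fun /bar_diff (linear_sum (act_at rho _ v)).
apply: eq_bigr => j _; rewrite (linearZZ (act_at rho _ v)) act_at_bas /bar_last.
by case: (j == ord_max); [reflexivity | rewrite repr_act1; reflexivity].
Qed.

End Bar.

(** * The Salvetti complex as a resolution over the subgroup *)

Section CosetCells.
Variables (k : comNzRingType) (n : nat).
Local Notation N := n.+1.
Local Notation G := (braid_group n.+1).
Local Notation H := (artinB n).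
Local Notation phi := (@artinB_embed n).
Variables (t : 'I_n.+1 -> G) (dec : G -> 'I_n.+1 * H).
Hypothesis decK : forall g, (t (dec g).1 * phi (dec g).2)%g = g.
Hypothesis decE : forall i h, dec (t i * phi h)%g = (i, h).
Local Notation sal := (sal k N).
Local Notation sal_d := (sal_d k N).

Definition coset_cells (p : int) : choiceType := (composition N p * 'I_n.+1)%type.
Local Notation F p := (free k (coset_cells p * H)%type).

(** The inverse of the position is decomposed, because H acts on the right of the complex by
    (m, g) . h = (m, phi(h)^-1 g). *)
Definition to_cosets p : {linear sal p -> F p} :=
  lin (fun x : cells N p => bas k ((x.1, (dec x.2^-1%g).1) : coset_cells p, (dec x.2^-1%g).2)).

Definition of_cosets p : {linear F p -> sal p} :=
  lin (fun y : coset_cells p * H => bas k ((y.1.1, (t y.1.2 * phi y.2)^-1%g) : cells N p)).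

Lemma to_cosets_bas p m g : to_cosets p (bas k ((m, g) : cells N p)) =
  bas k ((m, (dec g^-1%g).1) : coset_cells p, (dec g^-1%g).2).
Proof. exact: lin_bas. Qed.

Lemma of_cosets_bas p m i h : of_cosets p (bas k ((m, i) : coset_cells p, h)) =
  bas k ((m, (t i * phi h)^-1%g) : cells N p).
Proof. exact: lin_bas. Qed.

Lemma to_cosetsK p x : of_cosets p (to_cosets p x) = x.
Proof.
apply: (free_eq (f := of_cosets p \o to_cosets p) (g := idfun)) => -[m g].
apply: etrans (congr1 (of_cosets p) (to_cosets_bas m g)) _.
by rewrite of_cosets_bas decK invgK.
Qed.

Lemma of_cosetsK p x : to_cosets p (of_cosets p x) = x.
Proof.
apply: (free_eq (f := to_cosets p \o of_cosets p) (g := idfun)) => -[[m i] h].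
apply: etrans (congr1 (to_cosets p) (of_cosets_bas m i h)) _.
by rewrite to_cosets_bas invgK decE.
Qed.

Lemma to_cosets_left_mul p h x :
  to_cosets p (left_mul k p (phi h)^-1%g x) = rmul k (coset_cells p) h (to_cosets p x).
Proof.
apply: (free_eq (f := to_cosets p \o left_mul k p (phi h)^-1%g) (g := rmul k _ h \o to_cosets p)) => -[m g].
apply: etrans (congr1 (to_cosets p) (left_mul_bas k _ m g)) _.
apply: etrans (to_cosets_bas m _) (etrans _ (esym (congr1 (rmul k (coset_cells p) h) (to_cosets_bas m g)))).
rewrite rmul_bas /= invgM invgK -[(g^-1)%g in LHS]decK -mulgA -artinB_embedM decE.
by [].
Qed.

Definition coset_sal_d p p' (b : coset_cells p) : F p' :=
  to_cosets p' (sal_d p p' (bas k ((b.1, (t b.2)^-1%g) : cells N p))).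

Lemma ext_coset_sal_d p p' x : ext (@coset_sal_d p p') (to_cosets p x) = to_cosets p' (sal_d p p' x).
Proof.
apply: (free_eq (f := ext (@coset_sal_d p p') \o to_cosets p) (g := to_cosets p' \o sal_d p p')) => -[m g].
apply: etrans (congr1 (ext (@coset_sal_d p p')) (to_cosets_bas m g)) _.
apply: etrans (ext_bas _ _ _) _.
rewrite /coset_sal_d -to_cosets_left_mul left_mul_d left_mul_bas.
by rewrite -invgM decK invgK.
Qed.

Lemma aug_to_cosets p x : aug k _ (to_cosets p x) = aug k _ x.
Proof.
apply: (free_eq (f := aug k _ \o to_cosets p) (g := aug k _)) => -[m g].
apply: etrans (congr1 (aug k _) (to_cosets_bas m g)) _.
by apply: etrans (aug_bas k _) (esym (aug_bas k _)).
Qed.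

Definition deg (q : nat) : int := (2 * N)%N%:Z - q%:Z.

Lemma degS q : deg q = deg q.+1 + 1.
Proof. by rewrite /deg; lia. Qed.

Lemma ones_composition : inhabited (composition N (deg 0)).
Proof.
have [||| c _] := @composition_of N (deg 0) (nseq N 1%N); last exact: inhabits c.
- by apply/allP => i; rewrite mem_nseq => /andP[_ /eqP ->].
- by rewrite sumn_nseq mul1n.
- by rewrite size_nseq /deg; lia.
Qed.

(** Exactness is that of the Salvetti complex, transported along a bijection of bases that
    commutes with the differentials. *)
Lemma coset_sal_resolution :
  @resolution k H (fun q => coset_cells (deg q)) (fun q => @coset_sal_d (deg q.+1) (deg q)).
Proof.
have [c0] := ones_composition.
have e0 : deg 0 = (2 * N)%N%:Z by rewrite /deg subr0.
split.
- exact: inhabits (c0, ord0).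
- by move=> b; rewrite aug_to_cosets (aug_sal_d e0 (degS 0) (erefl _)).
- by move=> q b; rewrite ext_coset_sal_d (sal_dd _ (degS q)) (linear0 (to_cosets (deg q))).
- move=> x x0; have [|y yE] := @sal_exact0 k N _ _ _ e0 (degS 0) (erefl _) c0 (of_cosets _ x).
    by rewrite -aug_to_cosets of_cosetsK.
  by exists (to_cosets _ y); rewrite ext_coset_sal_d yE of_cosetsK.
move=> q x x0; have lt : deg q.+1 < (2 * N)%N%:Z by rewrite /deg; lia.
have [|y yE] := @sal_exact k N _ _ _ (degS q.+1) (degS q) lt (of_cosets _ x).
  by apply: (can_inj (@to_cosetsK _)); rewrite -ext_coset_sal_d of_cosetsK x0 (linear0 (to_cosets _)).
by exists (to_cosets _ y); rewrite ext_coset_sal_d yE of_cosetsK.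
Qed.

End CosetCells.

(** * Perfect pairings of complexes *)

Section HomologyDuality.
Variables (k : comNzRingType) (U V W U' V' W' : lmodType k).
Variables (f : {linear U -> V}) (g : {linear V -> W}).
Variables (f' : {linear U' -> V'}) (g' : {linear V' -> W'}).
Variable beta : {linear V -> dual V'}.

Hypothesis beta_boundary_r : forall z u, g z = 0 -> beta z (f' u) = 0.
Hypothesis beta_boundary_l : forall u c, g' c = 0 -> beta (f u) c = 0.
Hypothesis beta_nondegenerate : forall z, g z = 0 ->
  (forall c, g' c = 0 -> beta z c = 0) -> exists u, f u = z.
Hypothesis beta_represents : forall psi : {linear cycles g' -> k^o},
  (forall (c : cycles g') u, f' u = val c -> psi c = 0) ->
  exists2 z, g z = 0 & forall c : cycles g', beta z (val c) = psi c.

Local Notation Bd := (@boundaries k U V W f g).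
Local Notation Bd' := (@boundaries k U' V' W' f' g').

Lemma cycleP (A B : lmodType k) (h : {linear A -> B}) (c : cycles h) : h (val c) = 0.
Proof. by apply/eqP; have := valP c; rewrite unfold_in. Qed.

Definition on_cycles (z : V) : {linear cycles g' -> k^o} :=
  (beta z : {linear V' -> k^o}) \o (val : {linear cycles g' -> V'}).

Lemma on_cycles_boundary (z : cycles g) c : c \in Bd' -> on_cycles (val z) c = 0.
Proof.
move=> /asboolP [u uc]; rewrite /on_cycles /= -uc; apply: beta_boundary_r; exact: cycleP.
Qed.

Definition pair_fun (z : cycles g) : dual (homology f' g') :=
  quot_lift (@on_cycles_boundary z).

Lemma pair_fun_pi z c : (pair_fun z : {linear _ -> _}) (quot_pi Bd' c) = on_cycles (val z) c.
Proof. exact: (quot_liftE (@on_cycles_boundary z)). Qed.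

Lemma pair_linear : linear pair_fun.
Proof.
move=> a z w; apply: dual_eq => x; rewrite -[x]quot_reprK.
apply: etrans (pair_fun_pi _ _) _.
have E v : v = a *: val z + val w ->
    on_cycles v (quot_repr x) = a *: on_cycles (val z) (quot_repr x) + on_cycles (val w) (quot_repr x).
  by move=> ->; rewrite /on_cycles /= linearP.
apply: etrans (E _ _) _; first exact: linearP.
by rewrite -!pair_fun_pi.
Qed.

HB.instance Definition _ := GRing.isLinear.Build k (cycles g) (dual (homology f' g')) _ pair_fun pair_linear.

Lemma pair_fun_boundary z : z \in Bd -> pair_fun z = 0.
Proof.
move=> /asboolP [u uz]; apply: dual_eq => x; rewrite -[x]quot_reprK pair_fun_pi.
by rewrite /on_cycles /= -uz; apply: beta_boundary_l; apply: cycleP.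
Qed.

Lemma bijective_of (A B : Type) (h : A -> B) : injective h -> (forall y, exists x, h x = y) -> bijective h.
Proof.
move=> hI hS; have [h' h'P] := choice hS.
by exists h' => [x|y] //; apply: hI.
Qed.

(** A pairing of chains descends to a bijection from the homology of one complex to the dual
    of that of the other if it kills boundaries against cycles, detects boundaries and
    represents every functional on the homology. *)
Theorem homology_duality :
  exists h : {linear homology f g -> dual (homology f' g')}, bijective h.
Proof.
exists (quot_lift pair_fun_boundary); apply: bijective_of => [x y|psi].
  rewrite -[x]quot_reprK -[y]quot_reprK => e0; apply/quot_piP.
  set z := quot_repr x; set w := quot_repr y.
  have e : pair_fun z = pair_fun w.
    by apply: etrans (esym (quot_liftE pair_fun_boundary _)) (etrans e0 (quot_liftE pair_fun_boundary _)).
  apply/asboolP; apply: beta_nondegenerate; first exact: cycleP.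
  move=> c gc; have cP : c \in kernel g' by rewrite unfold_in gc.
  have := congr1 (fun h : dual _ => (h : {linear _ -> k^o}) (quot_pi Bd' (Cycle cP))) e.
  move=> e1; have {e1} : on_cycles (val z) (Cycle cP) = on_cycles (val w) (Cycle cP).
    by apply: etrans (esym (pair_fun_pi _ _)) (etrans e1 (pair_fun_pi _ _)).
  rewrite /on_cycles /= => e'.
  have E v : v = val z - val w -> beta v c = 0.
    by move=> ->; rewrite linearB; apply/eqP; rewrite subr_eq0; apply/eqP.
  by apply: E; exact: (linearB (val : {linear cycles g -> V}) z w).
pose psi' : {linear homology f' g' -> k^o} := psi.
have [c u e|z gz zE] := beta_represents (psi := psi' \o quot_pi Bd').
  rewrite /=; have -> : quot_pi Bd' c = 0 by apply/quot_pi_eq0/asboolP; exists u.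
  exact: linear0.
have zP : z \in kernel g by rewrite unfold_in gz.
exists (quot_pi Bd (Cycle zP)).
apply: etrans (quot_liftE pair_fun_boundary _) _; apply: dual_eq => x.
rewrite -[x]quot_reprK; apply: etrans (pair_fun_pi _ _) _.
exact: zE.
Qed.

End HomologyDuality.

Section LinearAlgebra.
Variable k : fieldType.

(** The xi are the coordinates along a complement of W. *)
Lemma complement_coordinates (V : vectType k) (W : {vspace V}) :
  exists (m : nat) (e : 'I_m -> V) (xi : 'I_m -> {linear V -> k^o}),
    (forall j w, w \in W -> xi j w = 0) /\
    forall v, v - \sum_j (xi j v : k) *: e j \in W.
Proof.
have dWC : (W^C :&: W = 0)%VS by rewrite capvC capv_compl.
have dW : (W :&: W^C = 0)%VS by rewrite capv_compl.
have full v : v \in (W^C + W)%VS by rewrite addvC addv_complf memvf.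
pose pr : 'End(V) := daddv_pi W^C W.
exists (\dim W^C), (fun j => (vbasis W^C)`_j),
  (fun j => (coord (vbasis W^C) j : {linear V -> k^o}) \o (pr : {linear V -> V})).
have prE v : pr v + daddv_pi W W^C v = v by apply: daddv_pi_add.
split=> [j w wW|v] /=.
  have -> : pr w = 0.
    by apply: (addIr w); rewrite add0r; have := prE w; rewrite (daddv_pi_id dW wW).
  exact: (linear0 (coord (vbasis W^C) j)).
have <- : pr v = \sum_j coord (vbasis W^C) j (pr v) *: (vbasis W^C)`_j.
  exact: coord_vbasis (memv_pi _ _ _).
by rewrite -{1}(prE v) [pr v + _]addrC addrK memv_pi.
Qed.

(** The image of f is cut out by finitely many functionals, with dual vectors e; for a field
    this holds in finite dimension. *)
Definition split_image (A D : lmodType k) (f : {linear A -> D}) : Prop :=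
  exists (m : nat) (e : 'I_m -> D) (xi : 'I_m -> {linear D -> k^o}),
    (forall j a, xi j (f a) = 0) /\
    forall v, exists a, v = f a + \sum_j (xi j v : k) *: e j.

Lemma split_image_finite (A D : lmodType k) (vA vD : vectType k) (f : {linear A -> D})
    (iA : {linear A -> vA}) (jA : {linear vA -> A}) (iD : {linear D -> vD}) (jD : {linear vD -> D}) :
  cancel iA jA -> cancel iD jD -> cancel jD iD -> split_image f.
Proof.
move=> iAK iDK jDK.
pose h : 'Hom(vA, vD) := linfun (iD \o f \o jA).
have hE a : h a = iD (f (jA a)) by rewrite lfunE.
have [m [e [xi [xi0 xiE]]]] := complement_coordinates (limg h).
exists m, (fun j => jD (e j)), (fun j => xi j \o iD); split=> [j a|v] /=.
  by apply: xi0; rewrite -[a]iAK -hE memv_img ?memvf.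
have /memv_imgP [a _ aE] := xiE (iD v); exists (jA a).
rewrite -[v in LHS]iDK -[f _]iDK -hE -aE.
rewrite -[X in _ = _ + X](_ : jD (\sum_j (xi j (iD v) : k) *: e j) = _).
  by rewrite -linearD subrK.
by rewrite linear_sum; apply: eq_bigr => j _; rewrite linearZ.
Qed.

Section PerfectPairing.
Variables (A D C C' : lmodType k) (f : {linear A -> D}) (g : {linear C -> C'}).
Variable pr : C -> {linear D -> k^o}.
Hypothesis fS : split_image f.
Hypothesis prD : forall a c c' w, pr (a *: c + c') w = a * pr c w + pr c' w.
Hypothesis pr_rep : forall xi : {linear D -> k^o}, exists c, forall w, pr c w = xi w.
Hypothesis pr_eq0 : forall c, (forall w, pr c w = 0) -> c = 0.
Hypothesis gP : forall c, (forall a, pr c (f a) = 0) -> g c = 0.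
Hypothesis gN : forall c a, g c = 0 -> pr c (f a) = 0.

Lemma image_of_orthogonal w : (forall c, g c = 0 -> pr c w = 0) -> exists a, f a = w.
Proof.
have [m [e [xi [xi0 xiE]]]] := fS => w0.
have [a wE] := xiE w; exists a; rewrite [RHS]wE big1 ?addr0 // => j _.
have [c cE] := pr_rep (xi j).
by rewrite -cE w0 ?scale0r //; apply: gP => b; rewrite cE xi0.
Qed.

(** The vectors representing the functionals xi are a basis of the cycles, with coordinates
    the pairings with the e. *)
Lemma functional_represented (psi : {linear cycles g -> k^o}) :
  exists w, forall c : cycles g, pr (val c) w = psi c.
Proof.
have [m [e [xi [xi0 xiE]]]] := fS.
have [c cE] := choice (fun j => pr_rep (xi j)).
have cP j : c j \in kernel g by rewrite unfold_in; apply/eqP/gP => a; rewrite cE xi0.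
exists (\sum_j (psi (Cycle (cP j)) : k) *: e j) => z.
have gz : g (val z) = 0 by apply/eqP; have := valP z; rewrite unfold_in.
have pr_sum (F : 'I_m -> k) (E : 'I_m -> C) w : pr (\sum_j F j *: E j) w = \sum_j F j * pr (E j) w.
  have pr00 : pr 0 w = 0.
    have := prD 1 0 0 w; rewrite scaler0 add0r mul1r => e0.
    by apply: (addrI (pr 0 w)); rewrite addr0 -e0.
  elim/big_rec2: _ => // j y x _ <-; exact: prD.
have zE : val z = \sum_j pr (val z) (e j) *: c j.
  apply/eqP; rewrite -subr_eq0; apply/eqP/pr_eq0 => w.
  have [a wE] := xiE w.
  have e1 : pr (val z) w = \sum_j pr (val z) (e j) * pr (c j) w.
    rewrite [in LHS]wE linearD gN // add0r linear_sum; apply: eq_bigr => j _.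
    by rewrite linearZ /= cE mulrC.
  by rewrite addrC -scaleN1r prD pr_sum e1 mulN1r addNr.
have zE' : z = \sum_j (pr (val z) (e j) : k) *: Cycle (cP j).
  apply: val_inj; rewrite [LHS]zE linear_sum; apply: eq_bigr => j _.
  by rewrite linearZ.
rewrite [in RHS]zE' (linear_sum psi) (linear_sum (pr _)); apply: eq_bigr => j _.
by rewrite !linearZ; exact: mulrC.
Qed.

End PerfectPairing.
End LinearAlgebra.

(** * The induced dual representation *)

Section InducedDual.
Variables (k : fieldType) (n : nat).
Local Notation G := (braid_group n.+1).
Local Notation H := (artinB n).
Local Notation phi := (@artinB_embed n).
Variables (t : 'I_n.+1 -> G) (dec : G -> 'I_n.+1 * H).
Hypothesis decK : forall g, (t (dec g).1 * phi (dec g).2)%g = g.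
Hypothesis decE : forall i h, dec (t i * phi h)%g = (i, h).
Hypothesis t_last : t ord_max = 1%g.
Variables (L : lmodType k) (rho : representation H L).
Local Notation M := (dual L).
Local Notation T := (ind (@artinB_embed n) (dual_repr rho)).
Local Notation S := (span_of (balanced (@artinB_embed n) (dual_repr rho))).
Local Notation piT := (quot_pi S).

(** The functional that f, placed at the coset of 1, induces at the element y: it vanishes
    unless y lies in phi(H). *)
Definition at_elt (y : G) : {linear M -> M} :=
  if (dec y).1 == ord_max then dual_act rho (dec y).2^-1%g else \0.

Lemma dec_phi h : dec (phi h) = (ord_max, h).
Proof. by rewrite -[phi h]mul1g -t_last decE. Qed.

Lemma dec_mulr y h : dec (y * phi h)%g = ((dec y).1, ((dec y).2 * h)%g).
Proof. by rewrite -{1}[y]decK -mulgA -artinB_embedM decE. Qed.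

Lemma at_elt_mulr y h f : at_elt (y * phi h)%g f = dual_act rho h^-1%g (at_elt y f).
Proof.
rewrite /at_elt dec_mulr /=; case: ifP => _; last by rewrite /= linear0.
by rewrite invgM dual_actM.
Qed.

Lemma dec_mull y h : (dec y).1 = ord_max ->
  dec (phi h * y)%g = (ord_max, (h * (dec y).2)%g).
Proof.
move=> e; rewrite -{1}[y]decK e t_last mul1g -artinB_embedM; exact: dec_phi.
Qed.

(** This is the compatibility with the relations defining the induced representation. *)
Lemma at_elt_mull y h f : at_elt ((phi h)^-1 * y)%g f = at_elt y (dual_act rho h f).
Proof.
rewrite -artinB_embedV /at_elt; have [e|ne] := eqVneq (dec y).1 ord_max.
  by rewrite dec_mull //= eqxx invgM invgK dual_actM.
case: eqP => [e|//]; case/eqP: ne.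
by rewrite -[y](mulKg (phi (h^-1)%g)) -artinB_embedV invgK dec_mull.
Qed.

Definition eval_sum (g : G) : {linear dsum G M -> M} :=
  dsum_ext (fun x : G => at_elt (x^-1 * g)%g).

Lemma eval_sum_in g x f : eval_sum g (dsum_in x f) = at_elt (x^-1 * g)%g f.
Proof. exact: dsum_ext_in. Qed.

Lemma eval_sum_balanced g x : x \in S -> eval_sum g x = 0.
Proof.
move=> /span_ofP; elim=> [|c {}x v [a [h [f ->]]] _ IH]; first exact: linear0.
rewrite linearP IH addr0 linearB /= !eval_sum_in.
by rewrite invgM -mulgA at_elt_mull subrr scaler0.
Qed.

(** An element of the induced representation, seen as a function on G with values in the
    dual of L that is equivariant on the right under H. *)
Definition eval (g : G) : {linear T -> M} := quot_lift (@eval_sum_balanced g).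

Lemma eval_pi g x : eval g (piT x) = eval_sum g x.
Proof. exact: (quot_liftE (@eval_sum_balanced g)). Qed.

Lemma ind_ind (P : T -> Prop) : (forall x, P (piT x)) -> forall y, P y.
Proof. by move=> Pp y; rewrite -[y]quot_reprK. Qed.

Lemma eval_act g y x : eval g (ind_repr phi (dual_repr rho) y x) = eval (y^-1 * g)%g x.
Proof.
elim/ind_ind: x => x.
apply: etrans (congr1 (eval g) (ind_act_pi _ _ y x)) _; rewrite !eval_pi.
apply: (dsum_eq_linear (f := eval_sum g \o translate M y) (g := eval_sum (y^-1 * g)%g)) => z f.
apply: etrans (congr1 (eval_sum g) (translate_in y z f)) _.
by rewrite !eval_sum_in invgM mulgA.
Qed.

Lemma eval_phi g h x : eval (g * phi h)%g x = dual_act rho h^-1%g (eval g x).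
Proof.
elim/ind_ind: x => x; rewrite !eval_pi.
apply: (dsum_eq_linear (f := eval_sum (g * phi h)%g) (g := dual_act rho h^-1%g \o eval_sum g)) => z f.
by rewrite /= !eval_sum_in mulgA at_elt_mulr.
Qed.

Definition tensor (i : 'I_n.+1) (f : M) : T := piT (dsum_in (t i) f).

Lemma tensor_linear i : linear (tensor i).
Proof. by move=> c f f'; rewrite /tensor !linearP. Qed.

Lemma tensorD i f f' : tensor i (f + f') = tensor i f + tensor i f'.
Proof. by have := tensor_linear i 1 f f'; rewrite !scale1r. Qed.

Lemma tensor0 i : tensor i 0 = 0.
Proof. by rewrite /tensor !linear0. Qed.

Lemma eval_tensor_phi i j h f :
  eval (t j) (piT (dsum_in (t i * phi h)%g f)) = if i == j then dual_act rho h f else 0.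
Proof.
rewrite eval_pi eval_sum_in invgM -mulgA at_elt_mull /at_elt.
have [<-|ne] := eqVneq i j.
  by rewrite mulVg -(artinB_embed1 n) dec_phi eqxx invg1 dual_act1.
case: eqP => // e; case/eqP: ne.
have := decK ((t i)^-1 * t j)%g; rewrite e t_last mul1g => e1.
have e2 : (t i * phi (dec ((t i)^-1 * t j)).2 = t j * phi 1)%g by rewrite e1 mulVKg artinB_embed1 mulg1.
by have := congr1 dec e2; rewrite !decE => -[].
Qed.

Lemma eval_tensor i j f : eval (t j) (tensor i f) = if i == j then f else 0.
Proof. by rewrite /tensor -[t i]mulg1 -(artinB_embed1 n) eval_tensor_phi dual_act1. Qed.

Lemma tensor_act i h f : piT (dsum_in (t i * phi h)%g f) = tensor i (dual_act rho h f).
Proof. by apply/quot_piP/in_span_gen; exists (t i), h, f. Qed.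

(** An element of the induced representation is determined by its values at the coset
    representatives. *)
Lemma ind_decompose x : x = \sum_i tensor i (eval (t i) x).
Proof.
pose P (y : T) := y = \sum_i tensor i (eval (t i) y).
have PD y z : P y -> P z -> P (y + z).
  rewrite /P => {1}-> {1}->; rewrite -big_split; apply: eq_bigr => i _.
  by rewrite linearD tensorD.
have P0 : P 0 by rewrite /P big1 // => i _; rewrite linear0 tensor0.
have Pin g f : P (piT (dsum_in g f)).
  rewrite -(decK g) tensor_act /P; move: (dec g).1 (dual_act _ _ _) => i {}f.
  rewrite (bigD1 i isT) eval_tensor eqxx big1; first exact: esym (addr0 _).
  by move=> j /andP [_ ji]; rewrite eval_tensor eq_sym (negPf ji) tensor0.
rewrite -/(P x); elim/ind_ind: x; elim/dsum_ind => [|g f x IH].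
  by apply: (eq_ind_r P P0); exact: linear0.
by apply: (eq_ind_r P (PD _ _ (Pin g f) IH)); exact: linearD.
Qed.

Lemma eval_inj x : (forall i, eval (t i) x = 0) -> x = 0.
Proof. by move=> x0; rewrite [x]ind_decompose big1 // => i _; rewrite x0 tensor0. Qed.

Lemma eval_surj (f : 'I_n.+1 -> M) : exists x, forall i, eval (t i) x = f i.
Proof.
exists (\sum_i tensor i (f i)) => j; rewrite (linear_sum (eval (t j))) (bigD1 j isT).
rewrite eval_tensor eqxx big1; first exact: addr0.
by move=> i /andP [_ ij]; rewrite eval_tensor (negPf ij).
Qed.

End InducedDual.

#[global] Opaque eval.

(** * The duality *)

Section EvalVector.
Variables (k : comNzRingType) (V : lmodType k).

Definition at_vec (v : V) (f : dual V) : k^o := (f : {linear V -> k^o}) v.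

Lemma at_vec_linear v : linear (at_vec v).
Proof. by []. Qed.

HB.instance Definition _ v :=
  GRing.isLinear.Build k (dual V) k^o _ (at_vec v) (at_vec_linear v).
End EvalVector.

Section FiniteSum.
Variables (k : fieldType) (I : finType) (L : lmodType k).

Definition coordinates (x : dsum I L) : {ffun I -> L} := [ffun b => x@_b].

Lemma coordinates_linear : linear coordinates.
Proof.
move=> c x y; apply/ffunP => b; rewrite !ffunE mcoeffD.
by rewrite [in LHS]/GRing.scale /= dsum_scaleE.
Qed.

HB.instance Definition _ := GRing.isLinear.Build k (dsum I L) {ffun I -> L} _ coordinates coordinates_linear.

Definition of_coordinates (f : {ffun I -> L}) : dsum I L := \sum_b dsum_in b (f b).

Lemma of_coordinates_linear : linear of_coordinates.
Proof.
move=> c f g; rewrite /of_coordinates scaler_sumr -big_split; apply: eq_bigr => b _ /=.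
by rewrite !ffunE linearP.
Qed.

HB.instance Definition _ := GRing.isLinear.Build k {ffun I -> L} (dsum I L) _ of_coordinates of_coordinates_linear.

Lemma of_coordinatesK : cancel of_coordinates coordinates.
Proof.
move=> f; apply/ffunP => b; rewrite ffunE /of_coordinates raddf_sum (bigD1 b) //=.
rewrite mcoeffUU big1 ?addr0 // => a ab.
by rewrite mcoeffU (negPf ab).
Qed.

Lemma coordinatesK : cancel coordinates of_coordinates.
Proof.
move=> x; apply/malgP => b; rewrite /of_coordinates raddf_sum (bigD1 b) //=.
rewrite ffunE mcoeffUU big1 ?addr0 // => a ab.
by rewrite mcoeffU (negPf ab).
Qed.

End FiniteSum.

Section Pairing.
Variables (k : fieldType) (n : nat).
Local Notation N := n.+1.
Local Notation G := (braid_group n.+1).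
Local Notation H := (artinB n).
Local Notation phi := (@artinB_embed n).
Variables (t : 'I_n.+1 -> G) (dec : G -> 'I_n.+1 * H).
Hypothesis decK : forall g, (t (dec g).1 * phi (dec g).2)%g = g.
Hypothesis decE : forall i h, dec (t i * phi h)%g = (i, h).
Hypothesis t_last : t ord_max = 1%g.
Variables (L : vectType k) (rho : representation H L).
Local Notation T := (ind (@artinB_embed n) (dual_repr rho)).
Local Notation R := (ind_repr (@artinB_embed n) (dual_repr rho)).
Local Notation eval := (eval decK decE t_last rho).
Local Notation D p := (dsum (coset_cells n p) L).
Local Notation coset_sal_d p p' := (@coset_sal_d k n t dec p p').
Local Notation chain p := (fn_chain N T p).

Definition pairing p (c : chain p) : {linear D p -> k^o} :=
  dsum_ext (fun x : coset_cells n p => (eval (t x.2) (c x.1) : {linear L -> k^o})).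

Lemma pairing_in p (c : chain p) b v :
  pairing c (dsum_in b v) = at_vec v (eval (t b.2) (c b.1)).
Proof. exact: dsum_ext_in. Qed.

(** The pairing before passing to coinvariants, on cells with an arbitrary position g; there
    the transposition of the differentials is read off from the formulas. *)
Definition cell_pairing p (c : chain p) (v : L) : {linear sal k N p -> k^o} :=
  lin (fun x : cells N p => at_vec v (eval x.2^-1%g (c x.1))).

Lemma cell_pairing_bas p (c : chain p) v m g :
  cell_pairing c v (bas k ((m, g) : cells N p)) = at_vec v (eval g^-1%g (c m)).
Proof. exact: lin_bas. Qed.

Lemma pairing_to_cosets p (c : chain p) v x :
  pairing c (act_at rho _ v (to_cosets k dec p x)) = cell_pairing c v x.
Proof.
apply: (free_eq (f := pairing c \o (act_at rho _ v \o to_cosets k dec p)) (g := cell_pairing c v)) => -[m g].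
apply: etrans (congr1 (pairing c \o act_at rho _ v) (to_cosets_bas _ _ m g)) _.
apply: etrans (congr1 (pairing c) (act_at_bas rho v _ _)) _.
rewrite pairing_in cell_pairing_bas /= -[in RHS](decK g^-1%g) eval_phi.
by rewrite /at_vec /= invgK.
Qed.

Lemma cell_pairing_put p (c : chain p) v (l : composition N p) g y :
  cell_pairing c v (put k l (gmul (bas k g) y)) =
  lin (fun x : G => at_vec v (eval g^-1%g (R x (c l)))) y.
Proof.
apply: (free_eq (f := cell_pairing c v \o (put k l \o gmul (bas k g)))
  (g := lin (fun x : G => at_vec v (eval g^-1%g (R x (c l)))))) => x.
rewrite lin_bas /= gmul_bas2 put_bas cell_pairing_bas.
by rewrite eval_act -invgM.
Qed.

(** A braid c moves the position to g c, at whose inverse a chain is evaluated; by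
    equivariance this is the value at g^-1 of c acting on the chain. *)
Lemma cell_pairing_d p p' (c : chain p') v m g :
  cell_pairing c v (sal_d k N p p' (bas k ((m, g) : cells N p))) =
  cell_pairing (fn_d R p' p c) v (bas k ((m, g) : cells N p)).
Proof.
rewrite -(put_bas k m g) sal_d_put (linear_sum (cell_pairing c v)) put_bas cell_pairing_bas.
rewrite /fn_d /= /fn_d_fun ffunE.
pose E : {linear T -> k^o} := @at_vec k L v \o eval g^-1%g.
pose F (l : composition N p') : T :=
  \sum_(i < (size (val l)).-1 | merge_parts i (parts (val l)) == parts (val m))
    (-1) ^+ i *: shuffle_sum R (parts (val l)) i (c l).
have main l : cell_pairing c v (put k l (gmul (bas k g) (coef k m l))) = E (F l).
  pose act := lin (fun x : G => R x (c l)).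
  have -> : F l = act (coef k m l).
    rewrite /coef (linear_sum act) /F.
    rewrite -(big_mkord (fun i => merge_parts i (cparts l) == cparts m)
      (fun i => act ((-1) ^+ i *: merge_shuffler k N 0 i (cparts l)))).
    rewrite -(big_mkord (fun i => merge_parts i (cparts l) == cparts m)
      (fun i => (-1) ^+ i *: shuffle_sum R (cparts l) i (c l))).
    rewrite size_map; apply: eq_bigr => i _.
    rewrite (linearZZ act) /merge_shuffler /shuffler (linear_sum act).
    congr (_ *: _); apply: eq_bigr => s _.
    by rewrite (linearZZ act) lin_bas.
  rewrite cell_pairing_put.
  apply: (free_eq (f := lin _) (g := E \o act)) => x.
  by rewrite /= !lin_bas.
rewrite (eq_bigr (fun l => E (F l)) (fun l _ => main l)).
exact: esym (linear_sum E _ _ _).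
Qed.

Definition sal_tens_d p p' : {linear D p -> D p'} := tens rho (coset_sal_d p p').

Lemma pairing_transpose p p' (c : chain p') y :
  pairing c (sal_tens_d p p' y) = pairing (fn_d R p' p c) y.
Proof.
apply: (dsum_eq_linear (f := pairing c \o sal_tens_d p p') (g := pairing (fn_d R p' p c))) => b v.
apply: etrans (congr1 (pairing c) (tens_in rho _ b v)) _.
rewrite pairing_to_cosets cell_pairing_d cell_pairing_bas pairing_in invgK.
by [].
Qed.

Lemma pairing_lin p a (c c' : chain p) w :
  pairing (a *: c + c') w = a * pairing c w + pairing c' w.
Proof.
apply: (dsum_eq_linear (f := pairing (a *: c + c')) (g := a \*: pairing c \+ pairing c')) => b v.
by rewrite /= !pairing_in !ffunE !linearP.
Qed.

Lemma pairing_rep p (xi : {linear D p -> k^o}) : exists c : chain p, forall w, pairing c w = xi w.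
Proof.
pose part b : dual L := xi \o (dsum_in b : {linear L -> D p}).
have [c cE] := choice (fun m : composition N p =>
  eval_surj decK decE t_last rho (fun i => part (m, i))).
exists [ffun m => c m] => w.
apply: (dsum_eq_linear (f := pairing [ffun m => c m]) (g := xi)) => -[m i] v.
by rewrite pairing_in ffunE cE.
Qed.

Lemma pairing_eq0 p (c : chain p) : (forall w, pairing c w = 0) -> c = 0.
Proof.
move=> c0; apply/ffunP => m; rewrite [RHS]ffunE; apply: (@eval_inj _ _ _ _ decK decE t_last _ rho) => i.
apply: dual_eq => v; have := c0 (dsum_in ((m, i) : coset_cells n p) v).
by rewrite pairing_in.
Qed.

Lemma split_image_cells p p' (f : {linear D p -> D p'}) : split_image f.
Proof.
apply: (@split_image_finite _ _ _ {ffun (composition N p * 'I_n.+1)%type -> L}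
  {ffun (composition N p' * 'I_n.+1)%type -> L} f
  (@coordinates k _ L) (@of_coordinates k _ L) (@coordinates k _ L) (@of_coordinates k _ L)).
- exact: coordinatesK.
- exact: coordinatesK.
- exact: of_coordinatesK.
Qed.

Lemma pairing_nondegenerate p (w : D p) : (forall c : chain p, pairing c w = 0) -> w = 0.
Proof.
move=> w0; have [m [e [xi [_ xiE]]]] := split_image_cells (\0 : {linear D p -> D p}).
have [a ->] := xiE w; rewrite add0r big1 // => j _.
by have [c cE] := pairing_rep (xi j); rewrite -cE w0 scale0r.
Qed.

Lemma fn_d2 q (c : chain (deg n q)) :
  fn_d R (deg n q.+1) (deg n q.+2) (fn_d R (deg n q) (deg n q.+1) c) = 0.
Proof.
apply: pairing_eq0 => y; rewrite -!pairing_transpose /sal_tens_d tens_comp.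
rewrite (@tens_eq _ _ _ rho _ _ _ (fun _ => 0)); last first.
  by move=> b; have [_ _ dd _ _] := coset_sal_resolution k decK decE; apply: dd.
have -> : tens rho (fun _ : coset_cells n (deg n q.+2) => 0) y = 0 :> D (deg n q).
  apply: (dsum_eq_linear (f := tens rho (fun _ => 0)) (g := \0)) => b v.
  by apply: etrans (tens_in rho _ b v) _; exact: (linear0 (act_at rho _ v)).
exact: linear0.
Qed.

Definition pair_dual_fun p (w : D p) (c : chain p) : k^o := pairing c w.

Lemma pair_dual_linear p w : linear (@pair_dual_fun p w).
Proof. by move=> a c c'; apply: pairing_lin. Qed.

HB.instance Definition _ p w :=
  GRing.isLinear.Build k (chain p) k^o _ (@pair_dual_fun p w) (@pair_dual_linear p w).

Definition pair_dual p (w : D p) : dual (chain p) := @pair_dual_fun p w.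

Lemma pair_dual_is_linear p : linear (@pair_dual p).
Proof.
by move=> a w w'; apply: dual_eq => c; apply: (linearP (pairing c)).
Qed.

HB.instance Definition _ p :=
  GRing.isLinear.Build k (D p) (dual (chain p)) _ (@pair_dual p) (@pair_dual_is_linear p).

(** A composition of N has at most N parts. *)
Lemma no_composition p (c : composition N p) : (p <= (2 * N)%N%:Z)%R.
Proof.
have [c1 cN cs] := cpartsP c.
by have := leq_size_sumn c1; rewrite cN; lia.
Qed.

(** The composite of the comparison with the bar resolution and of the pairing satisfies the
    hypotheses of [homology_duality].  The degrees p' and p'' of the target are kept free,
    because they are only propositionally equal to the degrees of the resolution. *)
Theorem duality i p' p'' : p' = deg n i.+1 -> (p'' = deg n i + 1) ->
  exists f : {linear group_homology rho i ->
      dual (homology (fn_d R p'' (deg n i)) (fn_d R (deg n i) p'))}, bijective f.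
Proof.
move=> -> pE.
have [f [g [fP gP [s [s0 sS]] [s' [s'0 s'S]]]]] :=
  resolution_compare rho (@bar_resolution k H) (coset_sal_resolution k decK decE).
pose cycle j : D (deg n j) -> Prop :=
  if j is j'.+1 then fun w => sal_tens_d (deg n j'.+1) (deg n j') w = 0 else fun => True.
have barE q x : tens_d rho (@bar_diff k H) q x = bar_d rho q x by apply: tens_bar.
have fd q x : sal_tens_d (deg n q.+1) (deg n q) (f q.+1 x) = f q (bar_d rho q x).
  by rewrite -barE; exact: fP.
have gd q x : bar_d rho q (g q.+1 x) = g q (sal_tens_d (deg n q.+1) (deg n q) x).
  by rewrite -barE; exact: gP.
have gf j z : bar_out rho j z = 0 -> exists y, g j (f j z) = z + bar_d rho j y.
  case: j z => [|j] z z0; first by exists (s 0%N z); rewrite s0 barE.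
  by exists (s j.+1 z); rewrite sS !barE [bar_d rho j z]z0 linear0 addr0.
have fg j w : cycle j w -> exists y, f j (g j w) = w + sal_tens_d (deg n j.+1) (deg n j) y.
  case: j w => [|j] w w0; first by exists (s' 0%N w); apply: s'0.
  exists (s' j.+1 w); rewrite s'S [tens_d _ _ _ w]w0 linear0 addr0 //.
have g_cycle j w : cycle j w -> bar_out rho j (g j w) = 0.
  by case: j w => [//|j] w w0; rewrite [LHS]gd w0 linear0.
have represented_cycle j (psi : {linear cycles (fn_d R (deg n j) (deg n j.+1)) -> k^o}) w :
    (forall l, j = l.+1 -> forall c u, fn_d R (deg n l) (deg n j) u = val c -> psi c = 0) ->
    (forall c, pairing (val c) w = psi c) -> cycle j w.
  case: j psi w => [//|j] psi w psi0 wE; apply: pairing_nondegenerate => c.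
  have cP : fn_d R (deg n j) (deg n j.+1) c \in kernel (fn_d R (deg n j.+1) (deg n j.+2)).
    by rewrite unfold_in fn_d2.
  by rewrite pairing_transpose; apply: etrans (wE (Cycle cP)) _; apply: (psi0 j _ _ c).
pose beta : {linear bar_chain H L i -> dual (chain (deg n i))} := @pair_dual (deg n i) \o f i.
(* In degree 0 there is no composition of the next degree, and the target is zero. *)
have fz z : bar_out rho i z = 0 -> sal_tens_d (deg n i) p'' (f i z) = 0.
  case: i pE z {beta} => [|j] pE z z0.
    apply/malgP => -[c x]; have le := no_composition c; exfalso.
    by move: le; rewrite pE /deg; lia.
  by rewrite pE -degS fd [bar_d rho j z]z0 linear0.
(* By transposition, a chain is a cycle exactly if it is orthogonal to all boundaries. *)
have pairing0 w : pairing (0 : chain (deg n i.+1)) w = 0 by exact: (linear0 (pair_dual w)).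
have gP' c : (forall a, pairing c (sal_tens_d (deg n i.+1) (deg n i) a) = 0) ->
    fn_d R (deg n i) (deg n i.+1) c = 0.
  by move=> c0; apply: pairing_eq0 => y; rewrite -pairing_transpose.
have gN' c a : fn_d R (deg n i) (deg n i.+1) c = 0 -> pairing c (sal_tens_d (deg n i.+1) (deg n i) a) = 0.
  by move=> c0; rewrite pairing_transpose c0 pairing0.
have split_i := split_image_cells (sal_tens_d (deg n i.+1) (deg n i)).
apply: (homology_duality (beta := beta)) => [z u z0|u c c0|z z0 zc|psi psi0].
- by apply: etrans (esym (pairing_transpose _ _)) _; rewrite fz // linear0.
- by rewrite /beta /= /pair_dual /= /pair_dual_fun -fd gN'.
- have [a aE] := image_of_orthogonal split_i (@pairing_rep _) gP' zc.
  have [y yE] := gf i z z0; exists (g i.+1 a - y).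
  by rewrite linearB gd aE yE addrK.
(* The vector w represents psi; it is a cycle because psi vanishes on boundaries. *)
have [w wE] := functional_represented split_i (@pairing_lin _) (@pairing_rep _) (@pairing_eq0 _) gP' gN' psi.
have wc : cycle i w.
  apply: represented_cycle wE => l il.
  have e : p'' = deg n l by rewrite pE il -degS.
  by rewrite e in psi0; apply: psi0.
exists (g i w) => [|c]; first exact: g_cycle.
have [y yE] := fg i w wc; apply: etrans (wE c).
rewrite /beta /= /pair_dual /= /pair_dual_fun yE linearD gN' ?addr0 //.
by apply/eqP; have := valP c; rewrite unfold_in.
Qed.

End Pairing.

Theorem corollary3p4 (k : fieldType) (n : nat) (n_gt0 : (0 < n)%N)
    (L : vectType k) (rho : representation (artinB n) L) (i : nat) :
  exists f : {linear group_homology rho i ->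
      dual (fn_homology (ind_repr (@artinB_embed n) (dual_repr rho))
                        ((2 * n + 2)%N%:Z - i%:Z))},
    bijective f.
Proof.
have [t [dec [decK decE t_last]]] := coset_decomposition n_gt0.
have -> : (2 * n + 2)%N%:Z - i%:Z = deg n i by rewrite /deg; lia.
apply: (duality decK decE t_last) => //.
by rewrite /deg; lia.
Qed.
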